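(* Let $r := (\log n)^{O((m^2/\varepsilon^2)\cdot \log\log n)}$ (for a suitable absolute constant in the exponent). For any $\varepsilon>0$, any $T$, and any solution $\boldsymbol{x} \in \mathtt{SA}(K(T),r)$, one can find a feasible schedule $\sigma : J\to\mathbb{N}$ of the jobs in time $n^{O(r)}$ so that $$\max_{j\in J}\sigma(j) \le (1+\varepsilon)\cdot T .$$
   Context: An instance consists of a finite set $J$ of $n=|J|$ unit-size jobs, a strict (transitive) partial order $\prec$ on $J$, and a number $m\ge 1$ of identical machines. A feasible schedule is a map $\sigma$ from $J$ to positive integers with $|\sigma^{-1}(t)|\le m$ for all $t$, and $j\prec j'\Rightarrow\sigma(j)<\sigma(j')$. Write $[T]=\{1,\ldots,T\}$. Logarithms are to base 2; $O(\cdot)$ hides absolute constants; the bound is understood for $n\ge 4$. Time-indexed LP: $K(T)\subseteq\mathbb{R}^{J\times[T]}$ is the set of $x$ satisfying: $\sum_{t=1}^T x_{j,t}=1$ for all $j\in J$; $\sum_{j\in J}x_{j,t}\le m$ for all $t\in[T]$; $\sum_{t'<t}x_{i,t'}\ge\sum_{t'\le t}x_{j,t'}$ for all $i\prec j$ and $t\in[T]$; $0\le x_{j,t}\le1$ for all $j,t$. Hierarchy: a partial assignment is a map $\sigma:J\to[T]\cup\{*\}$, with $\mathrm{supp}(\sigma)=\{j:\sigma(j)\ne *\}$; $\emptyset$ is the one with empty support; for $j\notin\mathrm{supp}(\sigma)$, $\sigma\cup(j,t)$ is $\sigma$ augmented by $\sigma(j)=t$. For a set $K$, $\mathrm{cone}(K)=\{\sum_i\lambda_ix_i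 : x_i\in K,\lambda_i\ge0\}$ (finite sums, containing $0$ always). A solution $\boldsymbol{x}\in\mathtt{SA}(K(T),r)$ is a family of vectors $\boldsymbol{x}=\{x^\sigma\}_{|\mathrm{supp}(\sigma)|\le r}$ in $\mathbb{R}^{J\times[T]}$, with $x:=x^\emptyset$, such that (I) $x^\sigma=\sum_{t\in[T]}x^{\sigma\cup(j,t)}$ for all $\sigma$ with $|\mathrm{supp}(\sigma)|<r$ and all $j\notin\mathrm{supp}(\sigma)$; (II) $x^\sigma\in\mathrm{cone}\big(K(T)\cap\{x: x_{j,\sigma(j)}=1\ \forall j\in\mathrm{supp}(\sigma)\}\big)$ for all $\sigma$ with $|\mathrm{supp}(\sigma)|\le r$; (III) $x\in K(T)$. *)

(* Defs.v *)
From mathcomp Require Import all_boot all_order all_algebra.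
From mathcomp Require Import all_classical all_reals all_analysis.

Set Implicit Arguments.
Unset Strict Implicit.
Unset Printing Implicit Defensive.

Import Order.TTheory GRing.Theory Num.Theory.

Local Open Scope classical_set_scope.
Local Open Scope ring_scope.

(* A time slot t : 'I_T stands for the time t.+1, so that 'I_T plays the role
   of [T] = {1, ..., T}.  Schedules, in contrast, take their values in nat and
   are required to be positive. *)

Definition feasible (J : finType) (prec : rel J) (m : nat) (sigma : J -> nat)
  : Prop :=
  [/\ forall j, (0 < sigma j)%N,
      forall t : nat, (#|[set j | sigma j == t]%SET| <= m)%N
    & forall i j, prec i j -> (sigma i < sigma j)%N].

(* R^o is R seen as a module over itself; it makes the following type, which
   stands for R^{J x [T]}, an lmodType R. *)
Notation lpvec R J T := {ffun J * 'I_T -> R^o}.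

Definition coor (R : realType) (J : finType) (T : nat) (x : lpvec R J T)
  (j : J) (t : 'I_T) : R := x (j, t).

Definition lpK (R : realType) (J : finType) (prec : rel J) (m T : nat)
  : set (lpvec R J T) :=
  [set x | [/\ forall j, \sum_(t < T) coor x j t = 1,
               forall t, \sum_(j : J) coor x j t <= m%:R,
               forall i j (t : 'I_T), prec i j ->
                 \sum_(t' < T | (t' < t)%N) coor x i t' >=
                 \sum_(t' < T | (t' <= t)%N) coor x j t'
             & forall j t, 0 <= coor x j t <= 1]].

Arguments lpK {R J} prec m T _.

Definition cone (R : realType) (V : lmodType R) (K : set V) : set V :=
  [set v | exists (k : nat) (l : 'I_k -> R) (y : 'I_k -> V),
     [/\ forall i, 0 <= l i, forall i, K (y i)
       & v = \sum_(i < k) l i *: y i]].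

(* sigma j = None means sigma(j) = *. *)
Notation passign J T := {ffun J -> option 'I_T}.

Definition psupp (J : finType) (T : nat) (sigma : passign J T) : {set J} :=
  [set j | sigma j != None]%SET.

Definition pempty (J : finType) (T : nat) : passign J T := [ffun=> None].

Definition pext (J : finType) (T : nat) (sigma : passign J T) (j : J)
  (t : 'I_T) : passign J T := [ffun i => if i == j then Some t else sigma i].

(* The family is a total function of the partial assignment; its values at
   assignments with more than r assigned jobs are unconstrained and are
   masked in [query] below. *)
Definition SA (R : realType) (J : finType) (T : nat) (K : set (lpvec R J T))
  (r : nat) (x : passign J T -> lpvec R J T) : Prop :=
  [/\ forall (sigma : passign J T) (j : J),
        (#|psupp sigma| < r)%N -> j \notin psupp sigma ->
        x sigma = \sum_(t < T) x (pext sigma j t),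
      forall sigma : passign J T, (#|psupp sigma| <= r)%N ->
        cone (K `&` [set y | forall j t, sigma j = Some t -> coor y j t = 1])
             (x sigma)
    & K (x (pempty J T))].

Definition log2 (R : realType) (y : R) : R := ln y / ln 2%:R.

(* floor of (log n)^(C (m^2/eps^2) loglog n): as supports have integral size,
   rounding the level down is no restriction. *)
Definition level (R : realType) (C n m : nat) (eps : R) : nat :=
  let lg := log2 n%:R in
  Num.truncn (lg `^ (C%:R * (m%:R ^+ 2 / eps ^+ 2) * log2 lg)).

(* Model of computation: a uniform real RAM, programmed by while programs.
   The memory consists of arrays of natural numbers and arrays of reals, both
   with indirect addressing (array names are literals, so a program uses
   finitely many of them).  Reals carry the field operations and comparisons,
   but can not be rounded.  On naturals only addition and truncated
   subtraction are primitive: unit-cost multiplication of unbounded integers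
   would be unreasonably powerful.  Every command costs 1, which up to a
   constant factor accounts for the evaluation of its expressions since these
   are part of the fixed program; looking up an entry of the hierarchy
   solution costs n + 1, as it reads n cells.

   The input is read-only: the numbers n, m, T, r, the real eps, the relation
   prec on job numbers, and the family x. *)

Inductive aexp : Type :=
| ACst of nat
| AJobs
| AMachines
| AHorizon
| ALevel
| ALoad of nat & aexp
| AAdd of aexp & aexp
| ASub of aexp & aexp.

Inductive rexp : Type :=
| REps
| RNat of aexp
| RLoad of nat & aexp
| RAdd of rexp & rexp
| RSub of rexp & rexp
| RMul of rexp & rexp
| RDiv of rexp & rexp.

Inductive bexp : Type :=
| BPrec of aexp & aexp
| BEq of aexp & aexp
| BLt of aexp & aexp
| BREq of rexp & rexp
| BRLt of rexp & rexp
| BNot of bexp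
| BAnd of bexp & bexp.

(* CQuery b e a ej et stores x^sigma_{j,t} into real cell e of array b, where
   j and t are the values of ej and et, and sigma is described by the array a
   of naturals. *)
Inductive cmd : Type :=
| CSet of nat & aexp & aexp
| CRSet of nat & aexp & rexp
| CQuery of nat & aexp & nat & aexp & aexp
| CSeq of cmd & cmd
| CIf of bexp & cmd & cmd
| CWhile of bexp & cmd.

Record input (R : realType) := Input {
  in_job : finType;
  in_prec : rel in_job;
  in_m : nat;
  in_T : nat;
  in_eps : R;
  in_r : nat;
  in_x : passign in_job in_T -> lpvec R in_job in_T }.

(* Jobs are numbered from 0 in the order of enum. *)
Definition job_num (J : finType) (j : J) : nat := index j (enum J).

Definition job_of (J : finType) (i : nat) : option J := onth (enum J) i.

(* Times are numbered 1, ..., T; any other number means * / no time. *)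
Definition slot_of (T k : nat) : option 'I_T :=
  if k is k'.+1 then insub k' else None.

Definition prec_num (R : realType) (inp : input R) (i k : nat) : bool :=
  if (job_of (in_job inp) i, job_of (in_job inp) k) is (Some a, Some b)
  then in_prec a b else false.

Definition query (R : realType) (inp : input R) (f : nat -> nat) (i k : nat)
  : R :=
  let sigma : passign (in_job inp) (in_T inp) :=
    [ffun j => slot_of (in_T inp) (f (job_num j))] in
  if (#|psupp sigma| <= in_r inp)%N then
    if (job_of (in_job inp) i, slot_of (in_T inp) k) is (Some j, Some t)
    then coor (in_x sigma) j t else 0
  else 0.

Record store (R : realType) := Store {
  nmem : nat -> nat -> nat;
  rmem : nat -> nat -> R }.

Definition store0 (R : realType) : store R :=
  Store (fun _ _ => 0%N) (fun _ _ => 0).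

Definition upd (A : Type) (f : nat -> nat -> A) (a i : nat) (v : A)
  : nat -> nat -> A :=
  fun a' i' => if (a' == a) && (i' == i) then v else f a' i'.

Section Eval.
Context (R : realType) (inp : input R) (s : store R).

Fixpoint aeval (e : aexp) : nat :=
  match e with
  | ACst c => c
  | AJobs => #|in_job inp|
  | AMachines => in_m inp
  | AHorizon => in_T inp
  | ALevel => in_r inp
  | ALoad a e => nmem s a (aeval e)
  | AAdd e1 e2 => (aeval e1 + aeval e2)%N
  | ASub e1 e2 => (aeval e1 - aeval e2)%N
  end.

Fixpoint reval (e : rexp) : R :=
  match e with
  | REps => in_eps inp
  | RNat e => (aeval e)%:R
  | RLoad a e => rmem s a (aeval e)
  | RAdd e1 e2 => reval e1 + reval e2
  | RSub e1 e2 => reval e1 - reval e2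
  | RMul e1 e2 => reval e1 * reval e2
  | RDiv e1 e2 => reval e1 / reval e2
  end.

Fixpoint beval (b : bexp) : bool :=
  match b with
  | BPrec e1 e2 => prec_num inp (aeval e1) (aeval e2)
  | BEq e1 e2 => aeval e1 == aeval e2
  | BLt e1 e2 => (aeval e1 < aeval e2)%N
  | BREq e1 e2 => reval e1 == reval e2
  | BRLt e1 e2 => reval e1 < reval e2
  | BNot b => ~~ beval b
  | BAnd b1 b2 => beval b1 && beval b2
  end.

End Eval.

(* exec inp c s k s': on input inp, command c started in s halts in s' after
   time k.  This relation is deterministic. *)
Inductive exec (R : realType) (inp : input R)
  : cmd -> store R -> nat -> store R -> Prop :=
| ExecSet a e1 e2 s :
    exec inp (CSet a e1 e2) s 1
      (Store (upd (nmem s) a (aeval inp s e1) (aeval inp s e2)) (rmem s))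
| ExecRSet a e1 e2 s :
    exec inp (CRSet a e1 e2) s 1
      (Store (nmem s) (upd (rmem s) a (aeval inp s e1) (reval inp s e2)))
| ExecQuery b e a ej et s :
    exec inp (CQuery b e a ej et) s #|in_job inp|.+1
      (Store (nmem s) (upd (rmem s) b (aeval inp s e)
         (query inp (nmem s a) (aeval inp s ej) (aeval inp s et))))
| ExecSeq c1 c2 s s1 s2 k1 k2 :
    exec inp c1 s k1 s1 -> exec inp c2 s1 k2 s2 ->
    exec inp (CSeq c1 c2) s (k1 + k2)%N s2
| ExecIf b c1 c2 s s' k :
    exec inp (if beval inp s b then c1 else c2) s k s' ->
    exec inp (CIf b c1 c2) s k.+1 s'
| ExecWhileDone b c s :
    beval inp s b = false -> exec inp (CWhile b c) s 1 s
| ExecWhileStep b c s s1 s2 k1 k2 :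
    beval inp s b = true ->
    exec inp c s k1 s1 -> exec inp (CWhile b c) s1 k2 s2 ->
    exec inp (CWhile b c) s (k1 + k2).+1 s2.

(* The output is read off array 0 of the naturals. *)
Definition output (R : realType) (J : finType) (s : store R) : J -> nat :=
  fun j => nmem s 0 (job_num j).

(* Main.v *)
(* For a nonzero x^sigma let the window of a job span the times that x^sigma
   gives it.  Windows increase along the partial order, at most m (b - a) of
   them lie in ]a, b], and they shrink when sigma is extended by a job and
   the left end of its window.

   Cut [0, T] recursively into intervals of lengths K^h.  In one of length
   K^h, condition on any job crossing a point of the grid of spacing K^(h-k)
   together with K^(h-k-1) of its predecessors: these predecessors then cross
   that point no more, so that this ends after m K^(2k+1) steps.  Now the chains
   of jobs crossing a grid point are short.  Choose i < k, serve here the jobs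
   that cross the grid of spacing K^(h-i), discard those that cross only the
   next finer grid of spacing B = K^(h-i-1), and recurse into the cells of the
   latter.  If no i < k had few discarded jobs, the number of crossing jobs
   would grow by a factor 1 + eps/(8m) k times in a row.

   The jobs served here get their windows rounded inwards to multiples of B and
   are scheduled greedily by deadline, after those of the deeper intervals.  A
   slot that they leave unfilled is blocked by a chain, so that few slots are
   unfilled before a missed deadline and, by packing, few jobs miss it.  In total
   at most eps T jobs are discarded or miss their deadlines; each of them is
   inserted at the end into a slot of its own.

   For eps < 1 and T < n, suitable K, k, L exist for the given level, and the
   program tries all triples K, k, L < n until the makespan is small enough.
   The triple (1, 0, 0) stands for list scheduling, which has makespan at most 2T
   and covers eps >= 1; (0, 0, 0) uses one slot per job, which covers T >= n. *)

Require Import Defs.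
From mathcomp Require Import all_boot all_order all_algebra.
From mathcomp Require Import all_classical all_reals all_analysis.
From mathcomp Require Import zify ring lra.

Set Implicit Arguments.
Unset Strict Implicit.
Unset Printing Implicit Defensive.

Import Order.TTheory GRing.Theory Num.Theory.
Local Open Scope ring_scope.

(** * For-programs and their compilation *)

(** The number of steps is polynomial in n, whatever the level: only the entries of the hierarchy
    that the recursion asks for are looked up. The level limits the conditioning alone, which adds
    up over the at most L nested intervals around a job. The machine can neither round reals nor
    take logarithms, so K, k and L are searched for; a useless triple is harmless, as greedy
    placement and insertion yield a feasible schedule from any table and only the makespan test can
    fail.

    The obstacle is that discarding happens in every interval of the recursion. With A jobs served
    and N members, up to eps (L A + N) / (8 m L) jobs may be discarded: a job is served once, so A
    can bear the factor L, while the members are charged again in each of the intervals around them.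
    The weight L A + N lies between N and (L + 1) N, whence the requirement (1 + eps/(8m))^k >= L +
    1.

    The combinatorial part uses functions on job numbers that are convertible with the evaluation of
    the program text; hence the counts compared with 0, minima expressed by maxima, and products
    written as sums. *)

Section Programs.
Local Open Scope nat_scope.

(* XPos asks whether a job has positive weight at a time, under the partial
   assignment in array 1, and XEps whether e1 <= eps * e2.  With loops running
   over the jobs only, every program takes polynomially many steps.
   Binders are named by de Bruijn levels; those of big operators range over
   0, ..., n - 1 for n the number of jobs. *)
Inductive nexp : Type :=
| XCst of nat
| XJobs
| XMach
| XHor
| XVar of nat
| XLoad of nat & nexp
| XAdd of nexp & nexp
| XSub of nexp & nexp
| XBig of bool & test & nexp
with test : Type :=
| XPrec of nexp & nexp
| XEq of nexp & nexp
| XLt of nexp & nexp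
| XPos of nexp & nexp
| XEps of nexp & nexp
| XNot of test
| XAnd of test & test.

Scheme nexp_test_ind := Induction for nexp Sort Prop
  with test_nexp_ind := Induction for test Sort Prop.
Combined Scheme nexp_test_mutind from nexp_test_ind, test_nexp_ind.

Inductive stmt : Type :=
| SSet of nat & nexp & nexp
| SSeq of stmt & stmt
| SIf of test & stmt
| SFor of stmt.

Definition bigmx (n : nat) (mx : bool) (p : nat -> bool) (F : nat -> nat) :=
  if mx then \max_(0 <= i < n | p i) F i else \sum_(0 <= i < n | p i) F i.

Section Semantics.
Context (R : realType) (inp : input R).
Notation n := #|in_job inp|.
Implicit Types (U : nat -> nat -> nat) (env : seq nat).

Definition suppq (f : nat -> nat) (j t : nat) : bool := (0 < query inp f j t)%R.

Definition epsle (a b : nat) : bool := (a%:R <= in_eps inp * b%:R)%R.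

Fixpoint neval U env (e : nexp) : nat :=
  match e with
  | XCst c => c
  | XJobs => n
  | XMach => in_m inp
  | XHor => in_T inp
  | XVar l => nth 0 env l
  | XLoad a e => U a (neval U env e)
  | XAdd e1 e2 => neval U env e1 + neval U env e2
  | XSub e1 e2 => neval U env e1 - neval U env e2
  | XBig mx b e => bigmx n mx (fun i => teval U (rcons env i) b)
                     (fun i => neval U (rcons env i) e)
  end
with teval U env (b : test) : bool :=
  match b with
  | XPrec e1 e2 => prec_num inp (neval U env e1) (neval U env e2)
  | XEq e1 e2 => neval U env e1 == neval U env e2
  | XLt e1 e2 => neval U env e1 < neval U env e2
  | XPos e1 e2 => suppq (U 1) (neval U env e1) (neval U env e2)
  | XEps e1 e2 => epsle (neval U env e1) (neval U env e2)
  | XNot b => ~~ teval U env b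
  | XAnd b1 b2 => teval U env b1 && teval U env b2
  end.

Fixpoint run env U (c : stmt) : nat -> nat -> nat :=
  match c with
  | SSet a e1 e2 => upd U a (neval U env e1) (neval U env e2)
  | SSeq c1 c2 => run env (run env U c1) c2
  | SIf b c => if teval U env b then run env U c else U
  | SFor c => foldl (fun U i => run (rcons env i) U c) U (iota 0 n)
  end.

End Semantics.

(* In the compiled program, user array a is array 3a, the binder of level l
   is cell 0 of array 3l+1, and temporary t is cell 0 of array 3t+2. *)
Definition user (a : nat) := 3 * a.
Definition binder (l : nat) := (3 * l).+1.
Definition tmp (t : nat) := (3 * t).+2.
Notation scal a := (ALoad a (ACst 0)).

Definition cset (a : nat) (e : aexp) := CSet a (ACst 0) e.

Definition cbool (t : nat) (b : bexp) :=
  CIf b (cset (tmp t) (ACst 1)) (cset (tmp t) (ACst 0)).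

Definition cloop (l : nat) (c : cmd) :=
  CSeq (cset (binder l) (ACst 0))
    (CWhile (BLt (scal (binder l)) AJobs)
       (CSeq c (cset (binder l) (AAdd (scal (binder l)) (ACst 1))))).

(** A maximum is accumulated as a + (v - a), with truncated subtraction. A binder out of scope reads
    as 0, like the default of [nth], because its cell may hold a stale value. As there is no skip
    command, an empty branch clears a temporary. *)
Fixpoint ncomp (l t : nat) (e : nexp) : cmd :=
  match e with
  | XCst c => cset (tmp t) (ACst c)
  | XJobs => cset (tmp t) AJobs
  | XMach => cset (tmp t) AMachines
  | XHor => cset (tmp t) AHorizon
  | XVar i => cset (tmp t) (if i < l then scal (binder i) else ACst 0)
  | XLoad a e =>
      CSeq (ncomp l t e) (cset (tmp t) (ALoad (user a) (scal (tmp t))))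
  | XAdd e1 e2 =>
      CSeq (ncomp l t e1) (CSeq (ncomp l t.+1 e2)
        (cset (tmp t) (AAdd (scal (tmp t)) (scal (tmp t.+1)))))
  | XSub e1 e2 =>
      CSeq (ncomp l t e1) (CSeq (ncomp l t.+1 e2)
        (cset (tmp t) (ASub (scal (tmp t)) (scal (tmp t.+1)))))
  | XBig mx b e =>
      CSeq (cset (tmp t) (ACst 0))
       (cloop l (CSeq (tcomp l.+1 t.+1 b)
         (CIf (BLt (ACst 0) (scal (tmp t.+1)))
            (CSeq (ncomp l.+1 t.+1 e)
               (cset (tmp t) (AAdd (scal (tmp t))
                  (if mx then ASub (scal (tmp t.+1)) (scal (tmp t))
                   else scal (tmp t.+1)))))
            (cset (tmp t.+1) (ACst 0)))))
  end
with tcomp (l t : nat) (b : test) : cmd :=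
  match b with
  | XPrec e1 e2 => CSeq (ncomp l t e1) (CSeq (ncomp l t.+1 e2)
      (cbool t (BPrec (scal (tmp t)) (scal (tmp t.+1)))))
  | XEq e1 e2 => CSeq (ncomp l t e1) (CSeq (ncomp l t.+1 e2)
      (cbool t (BEq (scal (tmp t)) (scal (tmp t.+1)))))
  | XLt e1 e2 => CSeq (ncomp l t e1) (CSeq (ncomp l t.+1 e2)
      (cbool t (BLt (scal (tmp t)) (scal (tmp t.+1)))))
  | XPos e1 e2 => CSeq (ncomp l t e1) (CSeq (ncomp l t.+1 e2)
      (CSeq (CQuery 0 (ACst 0) (user 1) (scal (tmp t)) (scal (tmp t.+1)))
         (cbool t (BRLt (RNat (ACst 0)) (RLoad 0 (ACst 0))))))
  | XEps e1 e2 => CSeq (ncomp l t e1) (CSeq (ncomp l t.+1 e2)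
      (cbool t (BNot (BRLt (RMul REps (RNat (scal (tmp t.+1))))
                        (RNat (scal (tmp t)))))))
  | XNot b => CSeq (tcomp l t b) (cbool t (BEq (scal (tmp t)) (ACst 0)))
  | XAnd b1 b2 => CSeq (tcomp l t b1) (CSeq (tcomp l t.+1 b2)
      (cbool t (BAnd (BLt (ACst 0) (scal (tmp t)))
                  (BLt (ACst 0) (scal (tmp t.+1))))))
  end.

Fixpoint scomp (l : nat) (c : stmt) : cmd :=
  match c with
  | SSet a e1 e2 => CSeq (ncomp l 0 e1) (CSeq (ncomp l 1 e2)
      (CSet (user a) (scal (tmp 0)) (scal (tmp 1))))
  | SSeq c1 c2 => CSeq (scomp l c1) (scomp l c2)
  | SIf b c => CSeq (tcomp l 0 b)
      (CIf (BLt (ACst 0) (scal (tmp 0))) (scomp l c)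
         (cset (tmp 0) (ACst 0)))
  | SFor c => cloop l (scomp l.+1 c)
  end.

Section Correctness.
Context (R : realType) (inp : input R).
Notation n := #|in_job inp|.
Implicit Types (s : store R) (env : seq nat).

Definition umem s : nat -> nat -> nat := fun a => nmem s (user a).

Definition env_ok env s :=
  forall l, l < size env -> nmem s (binder l) 0 = nth 0 env l.

(* The code for a binder level l and temporary t only touches binders of
   level at least l and temporaries at least t. *)
Definition frame (l t : nat) s s' :=
  [/\ umem s' = umem s, forall i, i < l -> nmem s' (binder i) = nmem s (binder i)
    & forall i, i < t -> nmem s' (tmp i) = nmem s (tmp i)].

Lemma frame_trans l t l' t' s s' s'' :
  frame l t s s' -> frame l' t' s' s'' -> l <= l' -> t <= t' -> frame l t s s''.
Proof.
move=> [u1 b1 t1] [u2 b2 t2] ll tt; split; first by rewrite u2 u1.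
- by move=> i il; rewrite b2 ?b1 // (leq_trans il).
- by move=> i it; rewrite t2 ?t1 // (leq_trans it).
Qed.

Lemma env_ok_frame env t s s' :
  frame (size env) t s s' -> env_ok env s -> env_ok env s'.
Proof. by move=> [_ b _] ok l ll; rewrite b ?ok. Qed.

Lemma upd_neq (A : Type) (f : nat -> nat -> A) a i v a' :
  a' != a -> upd f a i v a' = f a'.
Proof. by move=> /negbTE aa'; apply/funext => i'; rewrite /upd aa'. Qed.

Lemma upd_eq (A : Type) (f : nat -> nat -> A) a i v : upd f a i v a i = v.
Proof. by rewrite /upd !eqxx. Qed.

Lemma frame_tmp l t s v r :
  frame l t s (Store (upd (nmem s) (tmp t) 0 v) r).
Proof.
split=> [|i il|i it] /=; rewrite ?upd_neq //; last 2 first.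
- by rewrite /binder /tmp; lia.
- by rewrite /tmp; lia.
by apply/funext => a; rewrite /umem /= upd_neq // /user /tmp; lia.
Qed.

(** A Hoare triple for total correctness within time N; the exact time, which depends on the
    branches taken, stays hidden. *)
Definition does (c : cmd) (s : store R) (N : nat) (Q : store R -> Prop) :=
  exists k s', [/\ exec inp c s k s', k <= N & Q s'].

Lemma does_seq c1 c2 s N1 N2 (Q1 Q2 : store R -> Prop) :
  does c1 s N1 Q1 -> (forall s', Q1 s' -> does c2 s' N2 Q2) ->
  does (CSeq c1 c2) s (N1 + N2) Q2.
Proof.
move=> [k1 [s1 [e1 l1 q1]]] /(_ _ q1) [k2 [s2 [e2 l2 q2]]].
by exists (k1 + k2), s2; split; [apply: ExecSeq e1 e2|apply: leq_add|].
Qed.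

Lemma does_cset a e s (Q : store R -> Prop) :
  Q (Store (upd (nmem s) a 0 (aeval inp s e)) (rmem s)) ->
  does (cset a e) s 1 Q.
Proof.
move=> q; exists 1, (Store (upd (nmem s) a 0 (aeval inp s e)) (rmem s)); split=> //.
exact: ExecSet.
Qed.

Lemma does_if b c1 c2 s N1 N2 Q :
  (beval inp s b -> does c1 s N1 Q) -> (~~ beval inp s b -> does c2 s N2 Q) ->
  does (CIf b c1 c2) s (maxn N1 N2).+1 Q.
Proof.
move=> h1 h2; case: (boolP (beval inp s b)) => hb.
- have [k [s' [e l q]]] := h1 hb.
  by exists k.+1, s'; split=> //; [apply: ExecIf; rewrite hb|rewrite ltnS leq_max l].
- have [k [s' [e l q]]] := h2 hb.
  by exists k.+1, s'; split=> //; [apply: ExecIf; rewrite (negbTE hb)|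
    rewrite ltnS leq_max l orbT].
Qed.

Lemma does_weaken c s N N' (Q Q' : store R -> Prop) :
  does c s N Q -> N <= N' -> (forall s', Q s' -> Q' s') -> does c s N' Q'.
Proof.
by move=> [k [s' [e l q]]] NN QQ; exists k, s'; split=> //; [apply: leq_trans NN|apply: QQ].
Qed.

Lemma does_cbool l t b s :
  does (cbool t b) s 2
    (fun s' => frame l t s s' /\ nmem s' (tmp t) 0 = beval inp s b).
Proof.
by apply: (@does_weaken _ _ (maxn 1 1).+1 _ _ _ _ (leqnn 2) (fun _ => id));
  apply: does_if => hb; apply: does_cset; split; rewrite ?frame_tmp //= ?upd_eq;
  [exact: frame_tmp|rewrite hb|exact: frame_tmp|rewrite (negbTE hb)].
Qed.

(** The invariant speaks of the store whose binder already holds the index, as the body needs it.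
    Each round adds 2 for the test and the increment; the final 2 pays for the initialization and
    the failing test. *)
Lemma does_loop l c s N (P : nat -> store R -> Prop) :
  P 0 (Store (upd (nmem s) (binder l) 0 0) (rmem s)) ->
  (forall i s', i < n -> nmem s' (binder l) 0 = i -> P i s' -> does c s' N
     (fun s'' => nmem s'' (binder l) 0 = i /\
        P i.+1 (Store (upd (nmem s'') (binder l) 0 i.+1) (rmem s'')))) ->
  does (cloop l c) s (n * (N + 2) + 2) (P n).
Proof.
move=> P0 Pstep; pose w := CWhile (BLt (scal (binder l)) AJobs)
  (CSeq c (cset (binder l) (AAdd (scal (binder l)) (ACst 1)))).
suff loop d i s' : i + d = n -> nmem s' (binder l) 0 = i -> P i s' ->
    does w s' (d * (N + 2) + 1) (P n).
  apply: (@does_weaken _ _ (1 + (n * (N + 2) + 1)) _ (P n)) => //; last by lia.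
  apply: does_seq; first exact: (does_cset (Q := fun s' => s' =
    Store (upd (nmem s) (binder l) 0 0) (rmem s))).
  by move=> _ ->; apply: (loop n 0) => //=; rewrite upd_eq.
elim: d i s' => [|d IH] i s' id iv Pi.
  exists 1, s'; split; [|by []|by rewrite -id addn0].
  by apply: ExecWhileDone; rewrite /= iv -id addn0 ltnn.
have il : i < n by lia.
have [k1 [s1 [e1 l1 [v1 P1]]]] := Pstep _ _ il iv Pi.
have id' : i.+1 + d = n by lia.
have [k2 [s2 [e2 l2 P2]]] := IH i.+1
  (Store (upd (nmem s1) (binder l) 0 i.+1) (rmem s1)) id' (upd_eq _ _ _ _) P1.
exists ((k1 + 1) + k2).+1, s2; split=> //; last by lia.
apply: ExecWhileStep e2; first by rewrite /= iv.
apply: ExecSeq e1 _.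
have -> : i.+1 = aeval inp s1 (AAdd (scal (binder l)) (ACst 1)).
  by rewrite /= v1 addn1.
exact: ExecSet.
Qed.

Fixpoint ncost (N : nat) (e : nexp) : nat :=
  match e with
  | XCst _ | XJobs | XMach | XHor | XVar _ => 1
  | XLoad _ e => ncost N e + 1
  | XAdd e1 e2 | XSub e1 e2 => ncost N e1 + (ncost N e2 + 1)
  | XBig _ b e => 1 + (N * (tcost N b + (maxn (ncost N e + 1) 1).+1 + 2) + 2)
  end
with tcost (N : nat) (b : test) : nat :=
  match b with
  | XPrec e1 e2 | XEq e1 e2 | XLt e1 e2 | XEps e1 e2 =>
      ncost N e1 + (ncost N e2 + 2)
  | XPos e1 e2 => ncost N e1 + (ncost N e2 + (N.+1 + 2))
  | XNot b => tcost N b + 2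
  | XAnd b1 b2 => tcost N b1 + (tcost N b2 + 2)
  end.

Fixpoint scost (N : nat) (c : stmt) : nat :=
  match c with
  | SSet _ e1 e2 => ncost N e1 + (ncost N e2 + 1)
  | SSeq c1 c2 => scost N c1 + scost N c2
  | SIf b c => tcost N b + (maxn (scost N c) 1).+1
  | SFor c => N * (scost N c + 2) + 2
  end.

Lemma iota_rcons i : iota 0 i.+1 = rcons (iota 0 i) i.
Proof. by rewrite -cats1 -[in LHS]addn1 iotaD. Qed.

Lemma bigmxS mx p F i : bigmx i.+1 mx p F =
  (if p i then (if mx then maxn (bigmx i mx p F) (F i)
                else bigmx i mx p F + F i) else bigmx i mx p F).
Proof.
rewrite /bigmx; case: mx; rewrite big_mkcond big_nat_recr //= -big_mkcond;
  by case: ifP; rewrite ?maxn0 ?addn0.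
Qed.

Lemma frame_le l t l' t' s s' :
  frame l' t' s s' -> l <= l' -> t <= t' -> frame l t s s'.
Proof.
move=> [u b tt] ll lt; split=> // i il; [apply: b|apply: tt];
  exact: leq_trans il _.
Qed.

Lemma frame_binder l t s v r :
  frame l t s (Store (upd (nmem s) (binder l) 0 v) r).
Proof.
split=> [|i il|i it] /=; rewrite ?upd_neq //; last 2 first.
- by rewrite /binder; lia.
- by rewrite /binder /tmp; lia.
by apply/funext => a; rewrite /umem /= upd_neq // /user /binder; lia.
Qed.

Lemma env_ok_rcons env i s :
  env_ok env s -> nmem s (binder (size env)) 0 = i -> env_ok (rcons env i) s.
Proof.
move=> ok iv l; rewrite size_rcons ltnS nth_rcons leq_eqVlt.
by case/orP => [/eqP->|ll]; [rewrite ltnn eqxx iv|rewrite ll ok].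
Qed.

(** Operands go to temporaries t and t + 1. By the frame condition, evaluating the second one
    preserves the first result, the binders in scope and the user arrays. *)
Lemma comp_ok :
  (forall e t env s, env_ok env s ->
     does (ncomp (size env) t e) s (ncost n e)
       (fun s' => frame (size env) t s s' /\
          nmem s' (tmp t) 0 = neval inp (umem s) env e)) /\
  (forall b t env s, env_ok env s ->
     does (tcomp (size env) t b) s (tcost n b)
       (fun s' => frame (size env) t s s' /\
          nmem s' (tmp t) 0 = teval inp (umem s) env b)).
Proof.
(* The pattern shared by all binary constructors: two operands, then a command that combines the two
   temporaries. *)
have seq2 (c1 c2 : cmd) (v1 v2 : nat) env t s N1 N2 N3 c v :
  env_ok env s ->
  does c1 s N1 (fun s' => frame (size env) t s s' /\ nmem s' (tmp t) 0 = v1) ->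
  (forall s', env_ok env s' -> umem s' = umem s -> does c2 s' N2
     (fun s'' => frame (size env) t.+1 s' s'' /\ nmem s'' (tmp t.+1) 0 = v2)) ->
  (forall s', umem s' = umem s ->
     nmem s' (tmp t) 0 = v1 -> nmem s' (tmp t.+1) 0 = v2 ->
     does c s' N3
       (fun s'' => frame (size env) t s' s'' /\ nmem s'' (tmp t) 0 = v)) ->
  does (CSeq c1 (CSeq c2 c)) s (N1 + (N2 + N3))
    (fun s' => frame (size env) t s s' /\ nmem s' (tmp t) 0 = v).
- move=> ok h1 h2 h3; apply: does_seq h1 _ => s1 [f1 e1].
  have u1 : umem s1 = umem s by case: f1.
  apply: does_seq (h2 _ (env_ok_frame f1 ok) u1) _ => s2 [f2 e2].
  have f2' := frame_le f2 (leqnn _) (leqnSn t).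
  have u2 : umem s2 = umem s by case: f2 => ->.
  have e1' : nmem s2 (tmp t) 0 = v1 by case: f2 => _ _ ->.
  apply: does_weaken (h3 _ u2 e1' e2) (leqnn _) _ => s3 [f3 e3]; split=> //.
  exact: frame_trans (frame_trans f1 f2' _ _) f3 _ _.
have cs env t s e v : aeval inp s e = v -> does (cset (tmp t) e) s 1
    (fun s' => frame (size env) t s s' /\ nmem s' (tmp t) 0 = v).
  by move=> ev; apply: does_cset; rewrite /= upd_eq; split=> //; exact: frame_tmp.
have cb env t s b v : beval inp s b = v -> does (cbool t b) s 2
    (fun s' => frame (size env) t s s' /\ nmem s' (tmp t) 0 = v).
  by move=> <-; exact: does_cbool.
apply: nexp_test_mutind => /=.
- by move=> c t env s ok; exact: cs.
- by move=> t env s ok; exact: cs.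
- by move=> t env s ok; exact: cs.
- by move=> t env s ok; exact: cs.
- move=> i t env s ok; apply: cs; case: ltnP => il /=; first by rewrite ok.
  by rewrite nth_default.
- move=> a e IH t env s ok; apply: does_seq (IH _ _ _ ok) _ => s1 [f1 e1].
  apply: does_weaken (cs env t s1 _ _ erefl) (leqnn _) _ => s2 [f2 ->].
  split; first exact: frame_trans f1 f2 _ _.
  by rewrite /= e1; case: f1 => <-.
- move=> e1 IH1 e2 IH2 t env s ok.
  apply: (seq2 _ _ (neval inp (umem s) env e1 : nat) (neval inp (umem s) env e2 : nat)
    _ _ _ _ _ _ _ _ ok (IH1 _ _ _ ok)).
    by move=> s' ok' u; have := IH2 t.+1 env s' ok'; rewrite u.
  move=> s' u v1 v2; by apply: cs; rewrite /= v1 v2.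
- move=> e1 IH1 e2 IH2 t env s ok.
  apply: (seq2 _ _ (neval inp (umem s) env e1 : nat) (neval inp (umem s) env e2 : nat)
    _ _ _ _ _ _ _ _ ok (IH1 _ _ _ ok)).
    by move=> s' ok' u; have := IH2 t.+1 env s' ok'; rewrite u.
  move=> s' u v1 v2; by apply: cs; rewrite /= v1 v2.
- move=> mx b IHb e IHe t env s ok.
  set l := size env; pose p i := teval inp (umem s) (rcons env i) b.
  pose F i := neval inp (umem s) (rcons env i) e.
  apply: does_seq (cs env t s _ _ erefl) _ => s1 /= [f1 e1].
  pose P i s' := [/\ frame l t s s', nmem s' (binder l) 0 = i
    & nmem s' (tmp t) 0 = bigmx i mx p F].
  have P0 : P 0 (Store (upd (nmem s1) (binder l) 0 0) (rmem s1)).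
    split=> /=; [exact: frame_trans f1 (frame_binder _ _ _ _ _) _ _|
      by rewrite upd_eq|].
    rewrite upd_neq /binder /tmp; last by lia.
    by rewrite -/(tmp t) e1 /bigmx; case: (mx); rewrite big_geq.
  apply: does_weaken (does_loop P0 _) (leqnn _) _; last by move=> s' [].
  move=> i s' il vi [fi _ ei].
  have ok' : env_ok (rcons env i) s'.
    by apply: env_ok_rcons => //; exact: env_ok_frame fi ok.
  have u' : umem s' = umem s by case: fi.
  have := IHb t.+1 _ _ ok'; rewrite size_rcons -/l u' => hb.
  apply: (@does_weaken _ _ (tcost n b + (maxn (ncost n e + 1) 1).+1)
    _ (fun s'' => [/\ frame l.+1 t s' s'' & nmem s'' (tmp t) 0 = bigmx i.+1 mx p F])).
  + apply: does_seq hb _ => s2 [f2 e2]; apply: does_if => /=; rewrite e2 lt0b => pi.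
    * have ok2 : env_ok (rcons env i) s2.
        by apply: (@env_ok_frame _ t.+1 s') => //; rewrite size_rcons.
      have := IHe t.+1 _ _ ok2; rewrite size_rcons -/l.
      have -> : umem s2 = umem s by case: f2 => ->.
      move=> he; apply: does_seq he _ => s3 [f3 e3]; apply: does_cset; split.
        have f23 : frame l.+1 t s' s3.
          by apply: frame_le (frame_trans f2 f3 _ _) _ _.
        exact: frame_trans f23 (frame_tmp l.+1 t _ _ _) _ _.
      rewrite /= upd_eq bigmxS; have -> : p i = true by [].
      have e4 : nmem s3 (tmp t) 0 = bigmx i mx p F.
        by case: f3 => _ _ ->//; case: f2 => _ _ ->.
      move: e4; set q := bigmx i mx p F => e4.
      by rewrite e4; case: (mx) => /=; rewrite ?e4 e3 -/(F i); lia.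
    * apply: does_cset; split; last first.
        rewrite /= upd_neq; last by rewrite /tmp; lia.
        rewrite bigmxS; have -> : p i = false by exact: negbTE.
        by case: f2 => _ _ ->.
      have f2' : frame l.+1 t s' s2 by exact: frame_le f2 _ _.
      exact: frame_trans f2' (frame_tmp l.+1 t.+1 _ _ _) _ _.
  + by [].
  + move=> s2 [f2 e2]; split; first by case: f2 => _ ->.
    split=> /=.
    * apply: frame_trans (frame_trans fi f2 _ _) (frame_binder _ _ _ _ _) _ _ => //.
    * by rewrite upd_eq.
    * by rewrite upd_neq // /tmp /binder; lia.
- move=> e1 IH1 e2 IH2 t env s ok.
  apply: (seq2 _ _ (neval inp (umem s) env e1 : nat) (neval inp (umem s) env e2 : nat)
    _ _ _ _ _ _ _ _ ok (IH1 _ _ _ ok)).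
    by move=> s' ok' u; have := IH2 t.+1 env s' ok'; rewrite u.
  move=> s' u v1 v2; by apply: cb; rewrite /= v1 v2.
- move=> e1 IH1 e2 IH2 t env s ok.
  apply: (seq2 _ _ (neval inp (umem s) env e1 : nat) (neval inp (umem s) env e2 : nat)
    _ _ _ _ _ _ _ _ ok (IH1 _ _ _ ok)).
    by move=> s' ok' u; have := IH2 t.+1 env s' ok'; rewrite u.
  move=> s' u v1 v2; by apply: cb; rewrite /= v1 v2.
- move=> e1 IH1 e2 IH2 t env s ok.
  apply: (seq2 _ _ (neval inp (umem s) env e1 : nat) (neval inp (umem s) env e2 : nat)
    _ _ _ _ _ _ _ _ ok (IH1 _ _ _ ok)).
    by move=> s' ok' u; have := IH2 t.+1 env s' ok'; rewrite u.
  move=> s' u v1 v2; by apply: cb; rewrite /= v1 v2.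
- move=> e1 IH1 e2 IH2 t env s ok.
  apply: (seq2 _ _ (neval inp (umem s) env e1 : nat) (neval inp (umem s) env e2 : nat)
    _ _ _ _ _ _ _ _ ok (IH1 _ _ _ ok)).
    by move=> s' ok' u; have := IH2 t.+1 env s' ok'; rewrite u.
  move=> s' u v1 v2; 
  pose s1 := Store (nmem s') (upd (rmem s') 0 0
    (query inp (umem s 1) (neval inp (umem s) env e1) (neval inp (umem s) env e2))).
  apply: (@does_seq _ _ _ _ _ (fun s'' => s'' = s1)).
    exists n.+1, s1; split=> //; rewrite /s1.
    have := @ExecQuery R inp 0 (ACst 0) (user 1) (scal (tmp t)) (scal (tmp t.+1)) s'.
    by rewrite /= v1 v2 -[nmem s' (user 1)]/(umem s' 1) u.
  move=> _ ->; apply: does_weaken (cb env t s1 _ _ erefl) (leqnn _) _.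
  by move=> s2 [f2 ->]; split=> //=; rewrite upd_eq /suppq.
- move=> e1 IH1 e2 IH2 t env s ok.
  apply: (seq2 _ _ (neval inp (umem s) env e1 : nat) (neval inp (umem s) env e2 : nat)
    _ _ _ _ _ _ _ _ ok (IH1 _ _ _ ok)).
    by move=> s' ok' u; have := IH2 t.+1 env s' ok'; rewrite u.
  move=> s' u v1 v2; by apply: cb; rewrite /= v1 v2 -leNgt.
- move=> b IH t env s ok; apply: does_seq (IH _ _ _ ok) _ => s1 [f1 e1].
  apply: does_weaken (cb env t s1 _ _ erefl) (leqnn _) _ => s2 [f2 ->].
  by split; [exact: frame_trans f1 f2 _ _|rewrite /= e1; case: teval].
- move=> e1 IH1 e2 IH2 t env s ok.
  apply: (seq2 _ _ (teval inp (umem s) env e1 : nat) (teval inp (umem s) env e2 : nat)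
    _ _ _ _ _ _ _ _ ok (IH1 _ _ _ ok)).
    by move=> s' ok' u; have := IH2 t.+1 env s' ok'; rewrite u.
  move=> s' u v1 v2; by apply: cb; rewrite /= v1 v2 !lt0b.
Qed.

Lemma scomp_ok c env s : env_ok env s ->
  does (scomp (size env) c) s (scost n c)
    (fun s' => umem s' = run inp env (umem s) c /\ env_ok env s').
Proof.
have [nok tok] := comp_ok.
elim: c env s => [a e1 e2|c1 IH1 c2 IH2|b c IH|c IH] env s ok /=.
- apply: does_seq (nok e1 0 _ _ ok) _ => s1 [f1 v1].
  apply: does_seq (nok e2 1 _ _ (env_ok_frame f1 ok)) _ => s2 [f2 v2].
  have u1 : umem s1 = umem s by case: f1.
  have u2 : umem s2 = umem s by case: f2 => ->.
  exists 1, (Store (upd (nmem s2) (user a) (nmem s2 (tmp 0) 0) (nmem s2 (tmp 1) 0))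
    (rmem s2)); split=> //; first exact: ExecSet.
  have v1' : nmem s2 (tmp 0) 0 = nmem s1 (tmp 0) 0 by case: f2 => _ _ ->.
  split.
    rewrite v2 v1' v1 u1 -u2; apply/funext => a'; apply/funext => i.
    by rewrite /umem /upd /= /user eqn_mul2l.
  move=> l ll /=; rewrite upd_neq /binder /user; last by lia.
  exact: (env_ok_frame f2 (env_ok_frame f1 ok)).
- apply: does_seq (IH1 _ _ ok) _ => s1 [u1 ok1].
  by have := IH2 _ _ ok1; rewrite u1.
- apply: does_seq (tok b 0 _ _ ok) _ => s1 [f1 v1].
  have u1 : umem s1 = umem s by case: f1.
  apply: does_if => /=; rewrite v1 lt0b => hb.
    by have := IH _ _ (env_ok_frame f1 ok); rewrite u1 hb.
  rewrite (negbTE hb); apply: does_cset.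
  have [u2 _ _] := frame_tmp (size env) 0 s1 0 (rmem s1).
  split; first by rewrite -u1 -u2.
  apply: env_ok_frame (env_ok_frame f1 ok); exact: frame_tmp.
- pose f U i := run inp (rcons env i) U c.
  pose P i s' := [/\ umem s' = foldl f (umem s) (iota 0 i), env_ok env s'
    & nmem s' (binder (size env)) 0 = i].
  have P0 : P 0 (Store (upd (nmem s) (binder (size env)) 0 0) (rmem s)).
    split=> /=; [by case: (frame_binder (size env) 0 s 0 (rmem s))| |by rewrite upd_eq].
    apply: (@env_ok_frame _ 0 s) => //; exact: frame_binder.
  apply: does_weaken (does_loop P0 _) (leqnn _) _; last by move=> s' [].
  move=> i s' il vi [ui oki _].
    have := IH _ _ (env_ok_rcons oki vi); rewrite size_rcons => h.
    apply: does_weaken h (leqnn _) _ => s2 [u2 ok2].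
    have e2 : nmem s2 (binder (size env)) 0 = i.
      by rewrite ok2 ?size_rcons // nth_rcons ltnn eqxx.
    split=> //; split; last by rewrite /= upd_eq.
      rewrite iota_rcons foldl_rcons -ui /f -u2.
      by case: (frame_binder (size env) 0 s2 i.+1 (rmem s2)).
    apply: (@env_ok_frame _ 0 s2); first exact: frame_binder.
    move=> l ll; rewrite ok2 ?size_rcons ?ltnS 1?ltnW //.
    by rewrite nth_rcons ll.
Qed.

End Correctness.

Definition poly_bounded (f : nat -> nat) :=
  exists a d, forall N, f N <= a * N.+1 ^ d.

Lemma poly_boundedC c : poly_bounded (fun=> c).
Proof. by exists c, 0 => N; rewrite muln1. Qed.

Lemma poly_bounded_id : poly_bounded id.
Proof. by exists 1, 1 => N; rewrite mul1n expn1. Qed.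

Lemma poly_boundedD f g :
  poly_bounded f -> poly_bounded g -> poly_bounded (fun N => f N + g N).
Proof.
move=> [a [d h]] [b [d' h']]; exists (a + b), (d + d') => N.
rewrite mulnDl; apply: leq_add.
  by apply: (leq_trans (h N)); rewrite leq_mul2l leq_pexp2l ?leq_addr ?orbT.
by apply: (leq_trans (h' N)); rewrite leq_mul2l leq_pexp2l ?leq_addl ?orbT.
Qed.

Lemma poly_boundedM f g :
  poly_bounded f -> poly_bounded g -> poly_bounded (fun N => f N * g N).
Proof.
move=> [a [d h]] [b [d' h']]; exists (a * b), (d + d') => N.
by rewrite expnD mulnACA leq_mul.
Qed.

Lemma poly_bounded_le f g :
  poly_bounded g -> (forall N, f N <= g N) -> poly_bounded f.
Proof. by move=> [a [d h]] fg; exists a, d => N; apply: leq_trans (fg N) (h N). Qed.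

Lemma poly_bounded_max f g :
  poly_bounded f -> poly_bounded g -> poly_bounded (fun N => maxn (f N) (g N)).
Proof.
by move=> hf hg; apply: poly_bounded_le (poly_boundedD hf hg) _ => N; lia.
Qed.

Lemma comp_poly :
  (forall e, poly_bounded (ncost^~ e)) /\ (forall b, poly_bounded (tcost^~ b)).
Proof.
have pS f : poly_bounded f -> poly_bounded (fun N => (f N).+1).
  move=> h; apply: poly_bounded_le (poly_boundedD h (poly_boundedC 1)) _ => N.
  by rewrite addn1.
by apply: nexp_test_mutind => *; rewrite /=;
  do ?[exact: poly_boundedC|exact: poly_bounded_id|assumption|apply: poly_boundedD
      |apply: poly_boundedM|apply: pS|apply: poly_bounded_max].
Qed.

Lemma scost_poly c : poly_bounded (scost^~ c).
Proof.
have [np tp] := comp_poly.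
have pS f : poly_bounded f -> poly_bounded (fun N => (f N).+1).
  move=> h; apply: poly_bounded_le (poly_boundedD h (poly_boundedC 1)) _ => N.
  by rewrite addn1.
by elim: c => *; rewrite /=;
  do ?[exact: poly_boundedC|exact: poly_bounded_id|exact: np|exact: tp|assumption
      |apply: poly_boundedD|apply: poly_boundedM|apply: pS|apply: poly_bounded_max].
Qed.

Lemma compile_program (c : stmt) : exists D : nat,
  forall (R : realType) (inp : input R) (r : nat),
    4 <= #|in_job inp| -> 1 <= r ->
    exists k s, [/\ exec inp (scomp 0 c) (store0 R) k s,
      k <= #|in_job inp| ^ (D * r) &
      forall j : in_job inp, output s j = run inp [::] (fun _ _ => 0) c 0 (job_num j)].
Proof.
have [a [d h]] := scost_poly c.
(* The cost a (n + 1)^d is at most n^a (n^2)^d, since n >= 4; the level enters only through r >=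
   1. *)
exists (a + d.*2) => R inp r n4 r1.
have ok : env_ok [::] (store0 R) by [].
have [k [s [e l [u _]]]] := scomp_ok inp c ok.
exists k, s; split; [exact: e| |].
- apply: (leq_trans l); apply: (leq_trans (h _)).
  move: n4; set n := #|in_job inp| => n4.
  apply: (@leq_trans (n ^ (a + d.*2))); last first.
    by rewrite leq_pexp2l ?leq_pmulr //; lia.
  rewrite expnD leq_mul //.
    by apply/ltnW/ltn_expl; lia.
  rewrite -mul2n expnM; case: (d) => [|d']; first by rewrite !expn0.
  by rewrite leq_exp2r //; nia.
- by move=> j; rewrite /output -[LHS]/(umem s 0 (job_num j)) u.
Qed.

Fixpoint writes (c : stmt) : seq nat :=
  match c with
  | SSet a _ _ => [:: a]
  | SSeq c1 c2 => writes c1 ++ writes c2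
  | SIf _ c => writes c
  | SFor c => writes c
  end.

(** Reduces the preservation of an array to a computation on the program text. *)
Lemma run_frame (R : realType) (inp : input R) a c env U :
  a \notin writes c -> run inp env U c a = U a.
Proof.
elim: c env U => [b e1 e2|c1 IH1 c2 IH2|b c IH|c IH] env U /=.
- by rewrite inE => ab; rewrite upd_neq.
- by rewrite mem_cat negb_or => /andP[h1 h2]; rewrite IH2 // IH1.
- by move=> h; case: teval => //; exact: IH.
- by move=> h; elim: (iota 0 _) U => //= i s IHs U; rewrite IHs IH.
Qed.

End Programs.
Arguments run : simpl never.
Arguments neval : simpl never.
Arguments teval : simpl never.

(** * Counts and maxima over job numbers *)

Section Counting.
Local Open Scope nat_scope.
Implicit Types (n : nat) (p q : nat -> bool).

Definition cnt n p := \sum_(0 <= i < n | p i) 1.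
Definition maxof n p (F : nat -> nat) := \max_(0 <= i < n | p i) F i.

Lemma cntS n p : cnt n.+1 p = cnt n p + p n.
Proof. by rewrite /cnt big_mkcond big_nat_recr //= -big_mkcond; case: (p n). Qed.

Lemma cnt_le n p q : (forall i, i < n -> p i -> q i) -> cnt n p <= cnt n q.
Proof.
elim: n => [|n IH] pq; first by rewrite /cnt !big_geq.
rewrite !cntS leq_add ?IH // => [i il|]; first by apply: pq; rewrite ltnW.
by have := pq n (ltnSn n); case: (p n) => // ->.
Qed.

Lemma cnt_eq n p q : (forall i, i < n -> p i = q i) -> cnt n p = cnt n q.
Proof.
by move=> pq; apply/eqP; rewrite eqn_leq !cnt_le // => i il; rewrite pq.
Qed.

Lemma cnt_max n p : cnt n p <= n.
Proof.
elim: n => [|n IH]; first by rewrite /cnt !big_geq.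
by rewrite cntS -[n.+1]addn1 leq_add //; case: (p n).
Qed.

Lemma cntT n : cnt n xpredT = n.
Proof. by rewrite /cnt sum_nat_const_nat subn0 muln1. Qed.

Lemma cnt_gt0 n p i : i < n -> p i -> 0 < cnt n p.
Proof.
elim: n => [|n IH] //; rewrite ltnS leq_eqVlt cntS => /orP[/eqP-> ->|il pi].
  by rewrite addn1.
by rewrite addn_gt0 IH.
Qed.

Lemma cnt_gt0P n p : reflect (exists2 i, i < n & p i) (0 < cnt n p).
Proof.
apply: (iffP idP) => [|[i il pi]]; last exact: cnt_gt0 pi.
elim: n => [|n IH]; first by rewrite /cnt big_geq.
rewrite cntS addn_gt0 => /orP[/IH[i il pi]|]; first by exists i => //; exact: ltnW.
by rewrite lt0b => pn; exists n.
Qed.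

Lemma cnt_eq0 n p : (forall i, i < n -> ~~ p i) -> cnt n p = 0.
Proof.
move=> h; apply/eqP; rewrite eqn0Ngt; apply/negP => /cnt_gt0P[i il].
by apply/negP/h.
Qed.

Lemma cntU n p q : cnt n (fun i => p i || q i) <= cnt n p + cnt n q.
Proof.
elim: n => [|n IH]; first by rewrite /cnt !big_geq.
by rewrite !cntS; case: (p n) (q n) => [] []; lia.
Qed.

Lemma cnt_disj n p q (r : nat -> bool) : (forall i, i < n -> p i -> ~~ q i) ->
  (forall i, i < n -> p i || q i -> r i) -> cnt n p + cnt n q <= cnt n r.
Proof.
elim: n => [|n IH] pq pqr; first by rewrite /cnt !big_geq.
have {}IH : cnt n p + cnt n q <= cnt n r.
  by apply: IH => i il; [apply: pq|apply: pqr]; exact: ltnW.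
have := pq n (ltnSn n); have := pqr n (ltnSn n); rewrite !cntS.
by case: (p n) (q n) (r n) => [] [] []; lia.
Qed.

Lemma cntID n p q :
  cnt n p = cnt n (fun i => p i && q i) + cnt n (fun i => p i && ~~ q i).
Proof.
elim: n => [|n IH]; first by rewrite /cnt !big_geq.
by rewrite !cntS IH; case: (p n) (q n) => [] []; lia.
Qed.

Lemma cnt_lt n p q i : i < n -> q i -> ~~ p i ->
  (forall i, i < n -> p i -> q i) -> cnt n p < cnt n q.
Proof.
move=> il qi pi pq.
have := @cnt_disj n p (fun j => j == i) q; have := @cnt_gt0 n (fun j => j == i) i il (eqxx i).
move=> h1 h2; apply: leq_trans (h2 _ _) => [|j jl pj|j jl /orP[|/eqP->//]].
- by rewrite -[X in X < _]addn0 ltn_add2l.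
- by apply: contra pi => /eqP <-.
- exact: pq.
Qed.

Lemma sum_cnt n a b p (S : nat -> nat) :
  \sum_(a <= t < b) cnt n (fun i => p i && (S i == t)) =
  cnt n (fun i => p i && (a <= S i < b)).
Proof.
elim: n => [|n IH].
  by rewrite big1 => [|t _]; rewrite /cnt big_geq.
under eq_bigr do rewrite cntS.
rewrite big_split /= IH cntS; congr (_ + _); case: (p n) => /=; last by rewrite big1.
case: (boolP (a <= S n < b)) => h.
  rewrite (bigD1_seq (S n)) ?mem_index_iota ?iota_uniq //= eqxx big1 // => t tn.
  by rewrite eq_sym (negbTE tn).
rewrite big_nat_cond big1 // => t; rewrite andbT => tab.
by case: eqP => // e; move: h; rewrite e tab.
Qed.

Lemma maxof_le n p F i : i < n -> p i -> F i <= maxof n p F.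
Proof.
elim: n => // n IH; rewrite ltnS leq_eqVlt /maxof big_mkcond big_nat_recr //=.
rewrite -big_mkcond leq_max => /orP[/eqP-> ->|il pi]; first by rewrite leqnn orbT.
by rewrite IH.
Qed.

Lemma maxof_leq n p F N : (forall i, i < n -> p i -> F i <= N) -> maxof n p F <= N.
Proof.
elim: n => [|n IH] h; first by rewrite /maxof big_geq.
rewrite /maxof big_mkcond big_nat_recr //= -big_mkcond geq_max IH => [|i il].
  by case: ifP => // pn; apply: h.
by apply: h; exact: ltnW.
Qed.

Lemma maxofP n p F : 0 < maxof n p F -> exists i, [/\ i < n, p i & maxof n p F = F i].
Proof.
elim: n => [|n IH]; first by rewrite /maxof big_geq.
rewrite /maxof big_mkcond big_nat_recr //= -big_mkcond -/(maxof n p F).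
case: (leqP (if p n then F n else 0) (maxof n p F)) => h.
  by move=> /IH[i [il pi e]]; exists i; split=> //; exact: ltnW.
by move: h; case: ifP => // pn _ _; exists n.
Qed.

Lemma maxof_ex n p F i : i < n -> p i ->
  exists i, [/\ i < n, p i & maxof n p F = F i].
Proof.
move=> il pi; case: (posnP (maxof n p F)) => [e|]; last exact: maxofP.
by exists i; split=> //; have := @maxof_le n p F i il pi; rewrite e leqn0 => /eqP->.
Qed.

(** The minimum is n - v for the largest v with n - v in the set. Since T < n, all times are within
    the range of the big operators. *)
Lemma window_ends n T (p : nat -> bool) k0 :
  T < n -> (forall k, p k -> 0 < k <= T) -> p k0 ->
  [/\ p (n - maxof n (fun v => p (n - v)) id), p (maxof n p id) &
    forall k, p k -> n - maxof n (fun v => p (n - v)) id <= k <= maxof n p id].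
Proof.
move=> Tn hp p0; have k0T := hp k0 p0.
have [| |v [vn pv ev]] := @maxof_ex n (fun v => p (n - v)) id (n - k0); first lia.
  by rewrite subKn //; lia.
have [| |d [dn pd ed]] := @maxof_ex n p id k0; [by lia|by []|].
rewrite ev ed /=; split=> // k pk; have kT := hp k pk.
have h1 := @maxof_le n p id k _ pk.
have h2 := @maxof_le n (fun v => p (n - v)) id (n - k).
rewrite /= subKn in h2; last by lia.
by rewrite ed in h1; rewrite ev in h2; have := h1 ltac:(lia); have := h2 ltac:(lia) pk; lia.
Qed.

Lemma foldl_inv (A : Type) (f : A -> nat -> A) (I : nat -> A -> Prop) n z :
  I 0 z -> (forall i z, i < n -> I i z -> I i.+1 (f z i)) ->
  I n (foldl f z (iota 0 n)).
Proof.
move=> I0 Is; suff h k : k <= n -> I k (foldl f z (iota 0 k)) by exact: h.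
elim: k => // k IH kn; rewrite -[in foldl _ _ _]addn1 iotaD foldl_cat /=.
by apply: Is => //; apply: IH; exact: ltnW.
Qed.

Definition upd1 (f : nat -> nat) (j v : nat) := fun i => if i == j then v else f i.

Lemma cnt_pred1 n j : j < n -> cnt n (fun i => i == j) = 1.
Proof.
by move=> jn; rewrite /cnt sum1_count count_uniq_mem ?iota_uniq // mem_index_iota jn.
Qed.

Lemma cnt_upd1 n (p : nat -> bool) f j v : j < n -> ~~ p (f j) -> p v ->
  cnt n (fun i => p (upd1 f j v i)) = (cnt n (fun i => p (f i))).+1.
Proof.
move=> jn pj pv; rewrite (cntID n _ (fun i => i == j)) addnC -addn1; congr (_ + _).
  apply: cnt_eq => i il; rewrite /upd1; case: (eqVneq i j) => [->|_]; last by rewrite andbT.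
  by rewrite andbF (negbTE pj).
rewrite -(cnt_pred1 jn); apply: cnt_eq => i il; rewrite /upd1.
by case: (eqVneq i j) => [_|_]; rewrite ?pv // andbF.
Qed.

Definition supp n (f : nat -> nat) := cnt n (fun i => f i != 0).

End Counting.

(** * Greedy scheduling *)

Section Greedy.
Local Open Scope nat_scope.
Variables (n m : nat) (P : nat -> nat -> bool) (G R D : nat -> nat).
Implicit Types (S : nat -> nat) (g t d i j : nat).

(** Precedence is tested against every job placed so far, of whatever group, so the result is
    feasible for arbitrary tables. In addition an unplaced predecessor of the same group is awaited
    until its deadline has passed; after that it is left to the insertion. *)
Definition placeable S g t d j :=
  [&& G j == g, 0 < g, R j < t, ~~ (d < t), D j == d, S j == 0,
      cnt n (fun i => S i == t) < m,
      ~~ (0 < cnt n (fun i => P i j && ((0 < S i) && ~~ (S i < t)))),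
      ~~ (0 < cnt n (fun i => P i j && ((S i == 0) && ((G i == g) && ~~ (D i < t)))))
    & ~~ (0 < cnt n (fun i => P j i && ((0 < S i) && ~~ (t < S i))))].

Definition place S g t d j :=
  if placeable S g t d j then upd1 S j t else S.

Definition greedy S :=
  foldl (fun S g => foldl (fun S t => foldl (fun S d => foldl (fun S j =>
    place S g t d j) S (iota 0 n)) S (iota 0 n)) S (iota 0 n)) S (iota 0 n).

(* Unscheduled jobs have S i = 0. *)
Definition pfeasible S :=
  (forall i j, i < n -> j < n -> P i j -> 0 < S i -> 0 < S j -> S i < S j) /\
  (forall t, 0 < t -> cnt n (fun i => S i == t) <= m).

(** Jobs of later groups, or of the same group with later deadlines, are tried at slot t afterwards
    and so cannot take it away. *)
Definition full S g d t :=
  m <= cnt n (fun i => (S i == t) && ((G i < g) || (G i == g) && (D i <= d))).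

Definition blocked S j t :=
  exists i, [/\ i < n, P i j, G i = G j, t <= D i & (S i == 0) || (t <= S i)].

(** The lexicographic order in which the four nested loops visit their indices. *)
Definition before (g t d j g' t' d' j' : nat) :=
  (g < g') || (g == g') && ((t < t') || (t == t') && ((d < d') || (d == d') && (j < j'))).

(** The first three alternatives are the wanted ones. The other two, a late predecessor of another
    group and an early successor, are only removed once the tables are [compatible]. *)
Definition outcome S j t :=
  [\/ 0 < S j <= t, full S (G j) (D j) t | blocked S j t] \/
  (exists i, [/\ i < n, P i j, G i <> G j & t <= S i]) \/
  (exists i, [/\ i < n, P j i, 0 < S i & S i <= t]).

Record greedy_inv g t d j S : Prop := GreedyInv {
  inv_feas : pfeasible S;
  inv_win : forall i, i < n -> 0 < S i ->
    [/\ 0 < G i < n, R i < S i <= D i, D i < n & before (G i) (S i) (D i) i g t d j];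
  inv_pred : forall i k, i < n -> k < n -> P i k -> G i = G k -> 0 < S k ->
    S i = 0 -> D i < S k;
  inv_out : forall k u, k < n -> 0 < G k < n -> D k < n -> R k < u <= D k ->
    before (G k) u (D k) k g t d j -> outcome S k u }.

(** Passes from the end of an inner loop to the next round of the outer one: for coordinates below
    n, the positions (g, t, d, n) and (g, t, d + 1, 0) have the same past. *)
Lemma greedy_inv_eq g t d j g' t' d' j' S :
  (forall k u, k < n -> u < n -> G k < n -> D k < n ->
    before (G k) u (D k) k g t d j = before (G k) u (D k) k g' t' d' j') ->
  greedy_inv g t d j S -> greedy_inv g' t' d' j' S.
Proof.
move=> e [h1 h2 h3 h4]; split=> // [i il Si|k u kn gk dk ruk bk].
  by have [gi ri di bi] := h2 i il Si; split=> //; rewrite -e //; lia.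
by apply: h4 => //; rewrite e //; lia.
Qed.

Hypothesis Pirr : forall i, ~~ P i i.

Lemma before_last g t d j k u : G k < n -> 
  before (G k) u (D k) k g t d j.+1 ->
  before (G k) u (D k) k g t d j \/ [/\ G k = g, u = t, D k = d & k = j].
Proof.
move=> gk; rewrite /before => h.
case: (boolP ((G k == g) && (u == t) && (D k == d) && (k == j))) => e.
  by right; split; lia.
by left; lia.
Qed.

(** Every failed test of [placeable] is one of the outcomes for job j and slot t. Outcomes recorded
    earlier persist, because a job placed now gets a slot that is compatible with them in the
    visiting order. *)
Lemma place_inv g t d j S : j < n -> g < n -> t < n -> d < n ->
  greedy_inv g t d j S -> greedy_inv g t d j.+1 (place S g t d j).
Proof.
move=> jn gn tn dn [ [fp fc] hw hp ho].
have bS a b c e : before a b c e g t d j -> before a b c e g t d j.+1.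
  by rewrite /before; lia.
rewrite /place; case: ifP => [|nplace].
  case/and5P=> /eqP Gj g0 Rt tD /and5P[/eqP Dj /eqP Sj cap c1 /andP[c2 c3]].
  have t0 : 0 < t by lia.
  have nc1 i : i < n -> P i j -> 0 < S i -> S i < t.
    move=> il Pij Si; apply: contraR c1 => h; apply: (cnt_gt0 il).
    by rewrite Pij Si h.
  have nc2 i : i < n -> P i j -> S i = 0 -> G i = g -> D i < t.
    move=> il Pij Si Gi; apply: contraR c2 => h; apply: (cnt_gt0 il).
    by rewrite Pij Si Gi !eqxx h.
  have nc3 i : i < n -> P j i -> 0 < S i -> t < S i.
    move=> il Pij Si; apply: contraR c3 => h; apply: (cnt_gt0 il).
    by rewrite Pij Si h.
  have nbj : forall i, i < n -> 0 < S i -> G i = g -> S i <= t.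
    by move=> i il Si Gi; have [_ _ _] := hw i il Si; rewrite /before Gi; lia.
  split.
  - split=> [i k il kl Pik|u u0].
      rewrite /upd1; case: (eqVneq i j) => [ei|_]; case: (eqVneq k j) => [ek|_].
      + by move: Pik; rewrite ei ek (negbTE (Pirr j)).
      + by move=> _; apply: nc3; rewrite -?ei.
      + by move=> + _; apply: nc1; rewrite -?ek.
      + exact: fp.
    case: (eqVneq u t) => [->|ut]; first by rewrite (cnt_upd1 (p := fun s => s == t)) ?Sj //; lia.
    apply: leq_trans (fc u u0); apply: cnt_le => i il; rewrite /upd1.
    by case: (eqVneq i j) => // _ /eqP e; rewrite e eqxx in ut.
  - move=> i il; rewrite /upd1; case: (eqVneq i j) => [-> _|_ /(hw _ il)[? ? ? /bS //]].
    split; [lia|lia|lia|rewrite /before; lia].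
  - move=> i k il kl Pik Gik; rewrite /upd1; case: (eqVneq i j) => [|_]; first by lia.
    case: (eqVneq k j) => [ek _ Si|_]; last exact: hp.
    by apply: nc2 => //; rewrite -?ek // Gik ek.
  - move=> k u kn gk dk ru /before_last[]; first (by lia); last first.
      by move=> [ek eu _ ->]; left; apply: Or31; rewrite /upd1 eqxx eu; lia.
    move=> bk; case: (ho k u kn gk dk ru bk) => [ [ o|o|o]|[ o|o]].
    + left; apply: Or31; rewrite /upd1; case: (eqVneq k j) => // e.
      by move: o; rewrite e; lia.
    + left; apply: Or32; apply: leq_trans o _; apply: cnt_le => i il.
      rewrite /upd1; case: (eqVneq i j) => // ->; rewrite Sj; lia.
    + left; apply: Or33; case: o => i [il Pik Gik Di Si]; exists i; split=> //.
      rewrite /upd1; case: (eqVneq i j) => // e; apply/orP; right.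
      move: bk; rewrite /before -Gik e; lia.
    + right; left; case: o => i [il Pik Gik Si]; exists i; split=> //.
      rewrite /upd1; case: (eqVneq i j) => // e; move: Si; rewrite e; lia.
    + right; right; case: o => i [il Pik Si1 Si2]; exists i; rewrite /upd1.
      by case: (eqVneq i j) => // e; move: Si1; rewrite e; lia.
split=> //.
  by move=> i il /(hw _ il)[? ? ? /bS].
move=> k u kn gk dk ru /before_last[]; first (by lia); first exact: ho.
move=> [Gk eu Dk ek].
have [Sk|Sk] := posnP (S k); last first.
  have [? ? _ bk] := hw k kn Sk; left; apply: Or31; rewrite Sk /=.
  by move: bk; rewrite /before; lia.
move: nplace; rewrite /placeable -ek Gk Dk -eu Sk !eqxx /=.
have -> : 0 < g by lia.
have -> : R k < u by lia.
have -> : ~~ (d < u) by lia.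
move=> /= /negbT; rewrite !negb_and !negbK -leqNgt => /or4P[cap|c1|c2|c3].
(* The occupants of the slot were visited earlier at this very slot or in an earlier group, so each
   has a smaller group, or the same group and no later deadline. *)
- left; apply: Or32; rewrite /full; apply: leq_trans cap _; apply: cnt_le => i il /eqP e.
  have Si : 0 < S i by lia.
  by have [? ? ? ] := hw i il Si; rewrite e eqxx /before; lia.
- case/cnt_gt0P: c1 => i il /and3P[Pik Si Siu].
  case: (eqVneq (G i) (G k)) => Gik.
    left; apply: Or33; exists i; split=> //; last by apply/orP; right; lia.
    by have [? ? ? _] := hw i il Si; lia.
  by right; left; exists i; split=> //; [exact/eqP|lia].
- case/cnt_gt0P: c2 => i il /and4P[Pik Si /eqP Gi Di].
  by left; apply: Or33; exists i; rewrite Gi Gk Si; split=> //; lia.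
- case/cnt_gt0P: c3 => i il /and3P[Pik Si Siu].
  by right; right; exists i; split=> //; lia.
Qed.

Lemma greedy_invP : greedy_inv n 0 0 0 (greedy (fun=> 0)).
Proof.
apply: (foldl_inv (I := fun g => greedy_inv g 0 0 0)) => [|g S gn Ig].
  split=> //; first split=> //.
  - by move=> t t0; rewrite cnt_eq0 // => i _; lia.
  - by move=> k u kn _ _ _; rewrite /before; lia.
apply: (@greedy_inv_eq g n 0 0); first by move=> k u *; rewrite /before; lia.
apply: (foldl_inv (I := fun t => greedy_inv g t 0 0)) => // t {Ig}S tn It.
apply: (@greedy_inv_eq g t n 0); first by move=> k u *; rewrite /before; lia.
apply: (foldl_inv (I := fun d => greedy_inv g t d 0)) => // d {It}S dn Id.
apply: (@greedy_inv_eq g t d n); first by move=> k u *; rewrite /before; lia.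
apply: (foldl_inv (I := fun j => greedy_inv g t d j)) => // j {Id}S jn Ij.
exact: place_inv.
Qed.

(* Windows of jobs of different nodes are ordered like the jobs, those of jobs
   of the same node are ordered weakly. *)
Definition compatible := forall i j, i < n -> j < n -> P i j ->
  0 < G i -> 0 < G j -> D i <= R j \/ [/\ G i = G j, R i <= R j & D i <= D j].

Record greedy_spec S : Prop := GreedySpec {
  gr_feas : pfeasible S;
  gr_win : forall i, i < n -> 0 < S i -> 0 < G i /\ R i < S i <= D i;
  gr_fill : forall k u, k < n -> 0 < G k < n -> D k < n -> R k < u <= D k ->
    [\/ 0 < S k <= u, full S (G k) (D k) u | blocked S k u] }.

(** A predecessor of another group has its deadline before the release of k, so it cannot sit at u
    or later. A successor placed by time u must share the group of k, and then k itself was placed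
    before it: an unplaced k would have expired by [inv_pred]. *)
Lemma greedyP : compatible -> greedy_spec (greedy (fun=> 0)).
Proof.
move=> X; case: greedy_invP => fS hw hp ho; split=> //.
  by move=> i il /(hw _ il)[? ? _ _]; split=> //; lia.
set S := greedy _ in fS hw hp ho *.
move=> k u kn gk dk ruk; case: (ho k u kn gk dk ruk) => [|//|[]].
- by rewrite /before; lia.
- move=> [i [il Pik Gik Siu]]; have [gi rdi _ _] := hw i il ltac:(lia).
  by case: (X i k il kn Pik) => [| |?|[]]; lia.
- move=> [i [il Pki Si Siu]]; have [gi rdi _ _] := hw i il Si.
  case: (X k i kn il Pki) => [| |?|[Gki Rki Dki]]; try lia.
  case: (posnP (S k)) => Sk; first by have := hp k i kn il Pki Gki Si Sk; lia.
  by apply: Or31; have := fS.1 k i kn il Pki Sk Si; lia.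
Qed.

End Greedy.

(** * Few jobs served in an interval miss their deadlines *)

Section GreedyLoss.
Local Open Scope nat_scope.
Variables (n m : nat) (P : nat -> nat -> bool) (G R D S : nat -> nat).
Hypothesis Pirr : forall i, ~~ P i i.
Hypothesis Ptrans : forall i j k, P i j -> P j k -> P i k.
Hypothesis Sspec : greedy_spec n m P G R D S.

Definition nonfull g Y u := ~~ (m <= cnt n (fun i =>
  (S i == u) && ((G i < g) || (G i == g) && (D i <= Y)))).

(* Every slot that is not full is blocked for a pending job by a pending
   predecessor, so that the non-full slots yield a chain. *)
Lemma nonfull_chain (A : nat -> bool) (phi : nat -> nat) g s0 Y :
  (forall j, A j -> [/\ j < n, G j = g, 0 < g < n, D j < n & R j <= s0 /\ D j <= Y]) ->
  (forall i j, i < n -> A j -> P i j -> G i = g -> s0 < D i -> A i /\ phi i < phi j) ->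
  forall k j, A j -> s0 + k <= D j -> (S j == 0) || (s0 + k < S j) ->
    \sum_(s0.+1 <= u < (s0 + k).+1) nonfull g Y u <= phi j.
Proof.
move=> hA hphi; elim=> [|k IH] j Aj kD Sj.
  by rewrite addn0 big_geq.
rewrite addnS big_nat_recr /=; last by lia.
have [jn Gj g0 Dj [Rj DY]] := hA j Aj.
have IHj : \sum_(s0.+1 <= u < (s0 + k).+1) nonfull g Y u <= phi j.
  by apply: IH => //; lia.
case nf: (nonfull g Y (s0 + k).+1); last by rewrite addn0.
case: (gr_fill Sspec (k := j) (u := (s0 + k).+1)) => //; try lia.
- move=> h; move: nf; rewrite /nonfull (leq_trans h) //.
  by apply: cnt_le => i _ /andP[-> h2] /=; move: h2; rewrite Gj; lia.
move=> [i [il Pij Gij uD Si]].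
have [Ai lt] := hphi i j il Aj Pij ltac:(lia) ltac:(lia).
apply: leq_trans lt; rewrite addn1 ltnS; apply: IH => //; lia.
Qed.

(** One interval, starting at st, with grid spacing B. The windows of the hierarchy are [r] and [d],
    their inward roundings [R] and [D]; [A] holds the jobs served here, each crossing a point of the
    coarse grid of spacing K B; [lam] bounds the predecessors crossing the same grid point. *)
Variables (g st B M K lam w : nat) (r d : nat -> nat) (A : nat -> bool).
Notation y c := (st + c * B).
Hypotheses (B0 : 0 < B) (K0 : 0 < K) (g0 : 0 < g < n) (lamB : K * lam <= B).
Hypothesis packing : forall a b, a <= b ->
  cnt n (fun j => (a < r j) && (d j <= b)) <= m * (b - a).
Hypothesis Awin : forall j, j < n -> A j ->
  [/\ G j = g, D j < n, st < r j, d j <= y M & d j <= st + w].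
Hypothesis Around : forall j, j < n -> A j ->
  [/\ exists a, R j = y a, exists b, D j = y b, r j <= R j < r j + B
    & D j < d j <= D j + B].
Hypothesis Across : forall j, j < n -> A j ->
  exists c, [/\ K %| c, r j <= y c & y c < d j].
Hypothesis compat : compatible n P G R D.
Hypothesis Achain : forall j c, j < n -> A j -> r j <= y c < d j ->
  cnt n (fun i => P i j && (A i && (r i <= y c < d i))) < lam.
(* Only jobs of this node or of its cells get slots of this node up to now. *)
Hypothesis local : forall i u, i < n -> st < u <= y M -> R i < u <= D i ->
  0 < G i <= g ->
  (G i = g -> A i) /\
  (G i < g -> forall c, y c < u <= y c.+1 -> y c < r i /\ d i <= y c.+1).

Let F j := A j && (S j == 0).

Lemma grid_le a b : (y a <= y b) = (a <= b).
Proof. by rewrite leq_add2l leq_pmul2r. Qed.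

Lemma grid_lt a b : (y a < y b) = (a < b).
Proof. by rewrite ltn_add2l ltn_pmul2r. Qed.

Lemma gridS a : y a.+1 = y a + B.
Proof. by rewrite mulSn; lia. Qed.

(** As j is pending throughout the cell, the non-full slots yield a chain of predecessors in [A]
    that all cross the left end of the cell. The number of predecessors crossing that point drops
    along the chain and starts below [lam]. *)
Lemma cell_nonfull Y c j : j < n -> A j -> D j <= Y -> R j <= y c ->
  y c.+1 <= D j -> (S j == 0) || (y c.+1 < S j) ->
  \sum_((y c).+1 <= u < (y c.+1).+1) nonfull g Y u < lam.
Proof.
move=> jn Aj DY Rc cD Sj.
pose Ac j := [&& j < n, A j, D j <= Y, R j <= y c & y c < D j].
pose phi j := cnt n (fun i => P i j && (A i && (r i <= y c < d i))).
have cr i : Ac i -> r i <= y c < d i.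
  by case/and5P=> il Ai _ Ri Di; have [_ _] := Around il Ai; lia.
have Acj : Ac j by rewrite /Ac jn Aj DY Rc; move: cD; rewrite gridS; lia.
apply: (@leq_ltn_trans (phi j)); last by apply: Achain => //; exact: cr.
rewrite gridS; apply: (@nonfull_chain Ac phi) => //; rewrite -?gridS //.
- move=> i /and5P[il Ai DiY Ri Di]; have [? ? _ _ _] := Awin il Ai.
  by split=> //.
- move=> i k il Ack Pik Gi Di; have /and5P[kn Ak DkY Rk Dk] := Ack.
  have [Gk _ _ dk _] := Awin kn Ak; have [_ _ _ Dkd] := Around kn Ak.
  have [Rik Dik] : R i <= R k /\ D i <= D k.
    by case: (compat il kn Pik) => [| |?|[]]; lia.
  have Ai : A i.
    have h : st < (y c).+1 <= y M by lia.
    by case: (local (i := i) il h) => //; lia.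
  have Aci : Ac i by rewrite /Ac il Ai /=; lia.
  split=> //; apply: (cnt_lt il); first by rewrite Pik Ai; exact: cr.
    by rewrite negb_and Pirr.
  by move=> l ll /and3P[Pli -> ->]; rewrite (Ptrans Pli Pik).
Qed.

(** Such a job may fail, or use a slot after y a, although its window starts far to the left; it
    would spoil a packing argument for the span from y a to y b. *)
Definition viol a b j := [&& A j, D j <= y b, y a <= D j, R j < y a
  & (S j == 0) || (y a < S j)].

(** Descend from b: a violating job is pending throughout the cell to the left, so moving the point
    over this cell adds fewer than [lam] non-full slots. At 0 no job can violate, as all releases
    come later. *)
Lemma settled b : exists a, [/\ a <= b,
  \sum_((y a).+1 <= u < (y b).+1) nonfull g (y b) u <= lam * (b - a)
  & forall j, j < n -> ~~ viol a b j].
Proof.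
suff h a : a <= b -> \sum_((y a).+1 <= u < (y b).+1) nonfull g (y b) u <= lam * (b - a) ->
  exists a', [/\ a' <= b,
    \sum_((y a').+1 <= u < (y b).+1) nonfull g (y b) u <= lam * (b - a')
  & forall j, j < n -> ~~ viol a' b j].
  by apply: (h b) => //; rewrite big_geq.
elim: a => [|a IH] ab hs.
  exists 0; split=> // j jn; apply/negP => /and5P[Aj _ _ Rj _].
  have [_ _ hr _] := Around jn Aj; have [_ _ hst _ _] := Awin jn Aj; lia.
case: (boolP (0 < cnt n (viol a.+1 b))) => [/cnt_gt0P[j jn]|/negP nv]; last first.
  exists a.+1; split=> // j jn; apply/negP => v; apply: nv; exact: cnt_gt0 v.
move=> /and5P[Aj Db aD Ra pj].
apply: IH; first by lia.
have [ [c Rc] _ _ _] := Around jn Aj.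
have Rca : R j <= y a.
  by move: Ra; rewrite Rc grid_lt grid_le; lia.
have h := cell_nonfull jn Aj Db Rca aD pj.
rewrite (@big_cat_nat _ _ _ (y a.+1).+1) ?ltnS ?grid_le //=.
have -> : b - a = (b - a.+1).+1 by lia.
rewrite mulnS; lia.
Qed.

(** All but lam (b - a) slots between y a and y b are full. Their occupants and the failed jobs due
    in the span all have windows inside the span widened by B on both sides, so packing leaves room
    for few failures. The job j0 supplies a coarse grid point in the span, to which the term 2 B is
    charged. *)
Lemma loss_step b j0 : j0 < n -> F j0 -> D j0 = y b ->
  exists a, [/\ a <= b, exists c, [/\ K %| c, 0 < c & a <= c <= b] &
    cnt n (fun j => F j && (D j <= y b)) <=
    cnt n (fun j => F j && (D j < y a)) + m * (2 * B + lam * (b - a))].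
Proof.
have [a [ab nf sett]] := settled b.
move=> j0n /andP[Aj0 /eqP S0] D0.
have relR j : j < n -> A j -> D j <= y b -> y a <= D j ->
    (S j == 0) || (y a < S j) -> y a <= R j.
  by move=> jn Aj Db aD Sj; apply: contraR (sett j jn) => h; apply/and5P; split=> //; lia.
exists a; split=> //.
  have [ [a0 Ra0] _ hr hd] := Around j0n Aj0.
  have [c [Kc rc dc]] := Across j0n Aj0; have [_ _ hst hM _] := Awin j0n Aj0.
  have aR : y a <= R j0 by apply: relR; rewrite ?D0 ?S0 ?grid_le.
  exists c; split=> //; first by case: (posnP c) => // c0; move: rc; rewrite c0; lia.
  have h1 : R j0 < y c.+1 by rewrite gridS; lia.
  have h2 : y c < y b.+1 by rewrite gridS; lia.
  move: h1 h2; rewrite Ra0 !grid_lt !ltnS => h1 h2; rewrite h2 andbT.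
  by move: aR; rewrite Ra0 grid_le; lia.
pose X1 j := F j && ((y a <= R j) && (D j <= y b)).
pose X2 i := ((G i < g) || (G i == g) && (D i <= y b)) && ((y a).+1 <= S i < (y b).+1).
have le1 : cnt n (fun j => F j && (D j <= y b)) <=
    cnt n (fun j => F j && (D j < y a)) + cnt n X1.
  apply: leq_trans (cntU _ _ _); apply: cnt_le => j jn /andP[Fj Dj].
  case: (ltnP (D j) (y a)) => h; rewrite Fj /X1 ?Fj //=.
  have /andP[Aj Sj] := Fj.
  by rewrite relR ?Sj.
apply: leq_trans le1 _; rewrite leq_add2l.
have yb : b <= M.
  have [_ _ _ dM _] := Awin j0n Aj0; have [_ _ _ hd] := Around j0n Aj0.
  by rewrite -grid_le; lia.
(* Undoing the inward rounding moves either end by at most B. For a = 0 the predecessor is 0 again,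
   which is right because no window starts before st. *)
have win : cnt n X1 + cnt n X2 <= m * (y b + B - y a.-1).
  apply: leq_trans (packing (a := y a.-1) (b := y b + B) _); last first.
    by rewrite -gridS grid_le; lia.
  have lowR j : j < n -> A j -> y a <= R j -> y a.-1 < r j.
    move=> jn Aj aR; have [_ _ hr _] := Around jn Aj; have [_ _ hst _ _] := Awin jn Aj.
    by case: (a) aR => [|a'] /=; rewrite ?gridS; lia.
  apply: cnt_disj => j jn.
    by move=> /andP[/andP[_ Sj] _]; apply/negP => /andP[_]; rewrite (eqP Sj); lia.
  case/orP => [/andP[/andP[Aj Sj] /andP[aR Db]]|/andP[Gj Sj]].
    by rewrite lowR //=; have [_ _ _ hd] := Around jn Aj; lia.
  have Sj0 : 0 < S j by lia.
  have [Gj0 hw] := gr_win Sspec jn Sj0.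
  have yaM : st < S j <= y M.
    have : y b <= y M by rewrite grid_le.
    by have := leq_addr (a * B) st; lia.
  have [loc1 loc2] := local jn yaM hw ltac:(lia).
  case/orP: Gj => [Gj|/andP[/eqP Gj Dj]].
    (* The cell around the slot of j. A job of a deeper group has its whole window in this cell, and
       the cell lies in the span. *)
    pose c := (S j - st).-1 %/ B.
    have hc : y c < S j <= y c.+1.
      have := divn_eq (S j - st).-1 B; have := ltn_pmod (S j - st).-1 B0.
      by rewrite -/c gridS; lia.
    have [h1 h2] := loc2 Gj c hc.
    have ac : y a.-1 <= y c.
      have : y a < y c.+1 by lia.
      by rewrite grid_le grid_lt; lia.
    have cb : y c.+1 <= y b.+1.
      have : y c < y b by lia.
      by rewrite grid_le grid_lt; lia.
    by move: cb; rewrite gridS; lia.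
  have Aj := loc1 Gj.
  have aR : y a <= R j by apply: relR => //; lia.
  by rewrite lowR //=; have [_ _ _ hd] := Around jn Aj; lia.
have cap : m * (y b - y a) <= cnt n X2 + m * (lam * (b - a)).
  apply: (@leq_trans (cnt n X2 +
     m * \sum_((y a).+1 <= u < (y b).+1) nonfull g (y b) u)); last first.
    by rewrite leq_add2l leq_mul2l nf orbT.
  rewrite -sum_cnt big_distrr /= -big_split /=.
  have -> : m * (y b - y a) = \sum_((y a).+1 <= u < (y b).+1) m.
    by rewrite sum_nat_const_nat mulnC subSS.
  apply: leq_sum => u _; rewrite /nonfull.
  case: (boolP (m <= cnt n (fun i => (S i == u) &&
    ((G i < g) || (G i == g) && (D i <= y b))))) => h /=.
    rewrite muln0 addn0; apply: leq_trans h _.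
    by apply: cnt_le => i _; rewrite andbC.
  by rewrite muln1 leq_addl.
have := win; have := cap.
have e1 : y b + B - y a.-1 <= (y b - y a) + 2 * B.
  by case: (a) => [|a'] /=; rewrite ?gridS; lia.
have := leq_mul (leqnn m) e1.
rewrite !mulnDr; lia.
Qed.

(** Repeated application of [loss_step] gives disjoint spans, each with its own positive multiple of
    K, so 2 B is paid at most once per coarse grid point. *)
Lemma loss_prefix b : cnt n (fun j => F j && (D j < y b)) <=
  m * (2 * B * (b.-1 %/ K) + lam * b.-1).
Proof.
have [N] := ubnP b; elim: N b => // N IH [|b] bN.
  rewrite cnt_eq0 // => j jn; apply/negP => /andP[/andP[Aj _]].
  by have [_ [c ->] _ _] := Around jn Aj; rewrite mul0n addn0; lia.
have eb : cnt n (fun j => F j && (D j < y b.+1)) =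
    cnt n (fun j => F j && (D j <= y b)).
  apply: cnt_eq => j jn; case: (boolP (F j)) => //= /andP[Aj _].
  by have [_ [c ->] _ _] := Around jn Aj; rewrite grid_lt grid_le ltnS.
rewrite eb /=.
case: (boolP (0 < cnt n (fun j => F j && (D j == y b)))) => [/cnt_gt0P[j jn]|nz].
  move=> /andP[Fj /eqP Dj]; have [a [ab [c [Kc c0 acb]] le]] := loss_step jn Fj Dj.
  apply: leq_trans le _.
  have /IH le2 : a < N by lia.
  apply: leq_trans (leq_add le2 (leqnn _)) _.
  rewrite -mulnDr leq_mul2l; apply/orP; right.
  have [c' ec] := dvdnP Kc; have c'0 : 0 < c' by lia.
  have d1 : a.-1 %/ K < c' by rewrite ltn_divLR //; lia.
  have d2 : c' <= b %/ K by rewrite leq_divRL //; lia.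
  have : 2 * B * (a.-1 %/ K).+1 <= 2 * B * (b %/ K) by rewrite leq_mul2l; lia.
  have : lam * (a.-1 + (b - a)) <= lam * b by rewrite leq_mul2l; lia.
  rewrite mulnS mulnDr; lia.
have : cnt n (fun j => F j && (D j <= y b)) <= cnt n (fun j => F j && (D j < y b)).
  apply: cnt_le => j jn /andP[Fj]; rewrite Fj leq_eqVlt => /orP[e|//].
  by case/negP: nz; apply: (cnt_gt0 jn); rewrite Fj.
have /IH h : b < N by lia.
move=> h2; apply: leq_trans h2 (leq_trans h _).
by rewrite leq_mul2l leq_add ?orbT ?leq_mul2l ?leq_div2r ?leq_pred ?orbT.
Qed.

(** Of the 3, two come from paying 2 B for every K B slots, and one from K lam <= B. *)
Lemma node_loss : K * cnt n F <= 3 * m * w.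
Proof.
pose b := w.-1 %/ B.
have -> : cnt n F = cnt n (fun j => F j && (D j < y b.+1)).
  apply: cnt_eq => j jn; case: (boolP (F j)) => //= /andP[Aj _]; symmetry.
  have [_ [c ec] _ hd] := Around jn Aj; have [_ _ hst _ hw] := Awin jn Aj.
  by rewrite ec grid_lt ltnS /b leq_divRL //; lia.
have := leq_mul (leqnn K) (loss_prefix b.+1); rewrite /= => h; apply: leq_trans h _.
rewrite mulnCA [3 * m]mulnC -[m * 3 * w]mulnA leq_mul2l; apply/orP; right.
have h1 : b * B <= w by apply: leq_trans (leq_trunc_div _ _) (leq_pred _).
have h2 : b %/ K * K <= b by exact: leq_trunc_div.
have h3 : K * (2 * B * (b %/ K)) <= 2 * w.
  by have := leq_mul h2 (leqnn B); lia.
have h4 : K * (lam * b) <= w.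
  by have := leq_mul lamB (leqnn b); lia.
by rewrite mulnDr; lia.
Qed.

End GreedyLoss.

(** * The recursion over nested intervals *)

Section Path.
Local Open Scope nat_scope.
Variables (n m : nat) (P : nat -> nat -> bool) (le : nat -> nat -> bool).
Variable sup : (nat -> nat) -> nat -> nat -> bool.
Variables (pw : nat -> nat) (k L : nat).
Implicit Types (f IN : nat -> nat) (st h B i j y : nat).

(** The product for a <= n; the machine only adds. *)
Definition mul a B := \sum_(0 <= v < n | v < a) B.

Lemma mulE a B : a <= n -> mul a B = a * B.
Proof.
move=> an; rewrite /mul (big_cat_nat (n := a)) //= [X in _ + X]big1_seq => [|i]; last first.
  by rewrite mem_index_iota; lia.
rewrite addn0 big_nat_cond (eq_bigl (fun i => 0 <= i < a)); last by move=> i; lia.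
by rewrite -big_nat sum_nat_const_nat subn0.
Qed.

(* The minimum of the window, as a maximum: the programs have no minima. *)
Definition rw f j := n - maxof n (fun v => sup f j (n - v)) id.
Definition dw f j := maxof n (fun v => sup f j v) id.

(* The window of j contains the slots y and y + 1. *)
Definition crs f y j := ~~ (y < rw f j) && (y < dw f j).

(** For h <= k the bound on chains is 0: there every member crossing the grid is bad. *)
Definition bad f IN st h j c :=
  crs f (st + mul c (pw (h - k))) j &&
  ~~ ((k < h) && (cnt n (fun i => P i j &&
        ((0 < IN i) && crs f (st + mul c (pw (h - k))) i)) < pw (h - k.+1))).

(** Shifted by one, so that 0 says that there is no bad job. *)
Definition badjob f IN st h :=
  maxof n (fun j => (0 < IN j) && (0 < cnt n (fun c => bad f IN st h j c))) succn.

Definition cstep IN st h f :=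
  if 0 < badjob f IN st h
  then upd1 f (badjob f IN st h - 1) (rw f (badjob f IN st h - 1)) else f.

(** n rounds suffice, as each effective one assigns another job. *)
Definition cond IN st h f := foldl (fun f _ => cstep IN st h f) f (iota 0 n).

Definition cross f st B j := 0 < cnt n (fun c => crs f (st + mul c B) j).

Definition m8 := m + m + (m + m) + (m + m + (m + m)).

(** With A jobs served and N members, at most eps (L A + N) / (8 m L) jobs are discarded; the
    inequality is cleared of denominators. *)
Definition crit f IN st h i := le
  (\sum_(0 <= j < n | (0 < IN j) && (cross f st (pw (h - i.+1)) j &&
      ~~ cross f st (pw (h - i)) j)) mul L m8)
  (\sum_(0 <= j < n | (0 < IN j) && cross f st (pw (h - i)) j) L +
   cnt n (fun j => 0 < IN j)).

Definition sel f IN st h :=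
  maxof n (fun i => (i < k) && ((i < h) && crit f IN st h i)) id.

(** Left end of the cell containing x; cells are open on the left and closed on the right. *)
Definition cell st B x :=
  st + maxof n (fun c => st + mul c B < x) (fun c => mul c B).

Definition restrict f st B IN := fun i =>
  if (st < rw f i) && ~~ (st + B < dw f i) then IN i else 0.

(* The triple of group, release time and deadline for job j, found on its way
   down from the interval of length K^h after st; (0, 0, 0) means discarded.
   Smaller groups are scheduled first. *)
Fixpoint out fuel f IN st h j : nat * nat * nat :=
  if fuel is fuel'.+1 then
    if h == 0 then (1, st, st + 1) else
    let f' := cond IN st h f in
    let i := sel f' IN st h in
    let B := pw (h - i.+1) in
    if cross f' st (pw (h - i)) j then
      (h + 1, cell st B (rw f' j) + B, cell st B (dw f' j))
    else if cross f' st B j then (0, 0, 0)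
    else let st' := cell st B (rw f' j) in
      out fuel' f' (restrict f' st' B IN) st' (h - i.+1) j
  else (0, 0, 0).

End Path.

(** * Conditioning, choice of the grid, and losses summed over the tree of intervals *)

Section Tree.
Local Open Scope nat_scope.
Variables (F : realFieldType) (eps : F).
Variables (n m T r K k L : nat) (P : nat -> nat -> bool).
Variables (sup : (nat -> nat) -> nat -> nat -> bool) (live : (nat -> nat) -> Prop).
Variable pw : nat -> nat.
Notation rw := (rw n sup).
Notation dw := (dw n sup).
Notation mul := (mul n).
Notation crs := (crs n sup).
Notation badjob := (badjob n P sup pw k).
Notation cstep := (cstep n P sup pw k).
Notation cond := (cond n P sup pw k).
Notation cross := (cross n sup).
Definition le a b := (a%:R <= eps * b%:R :> F)%R.
Notation crit := (crit n m le sup pw L).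
Notation sel := (sel n m le sup pw k L).
Notation cell := (cell n).
Notation restrict := (restrict n sup).
Notation out := (out n m P le sup pw k L).
Notation supp := (supp n).

Hypothesis Pirr : forall i, ~~ P i i.
Hypothesis Ptrans : forall i j l, P i j -> P j l -> P i l.
Hypotheses (Tn : T < n) (m0 : 0 < m) (K1 : 1 < K) (k0 : 0 < k) (Ln : L.+1 < n).
Hypothesis pwE : forall i, i <= n -> pw i = K ^ i.
Hypothesis win : forall f j, live f -> j < n ->
  [/\ 0 < rw f j, rw f j <= dw f j & dw f j <= T].
Hypothesis winP : forall f i j, live f -> i < n -> j < n -> P i j ->
  rw f i < rw f j /\ dw f i < dw f j.
Hypothesis packing : forall f a b, live f -> a <= b ->
  cnt n (fun j => (a < rw f j) && (dw f j <= b)) <= m * (b - a).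
Hypothesis fixed : forall f j, live f -> j < n -> f j != 0 ->
  rw f j = f j /\ dw f j = f j.
Hypothesis condition : forall f j, live f -> j < n -> f j = 0 -> supp f < r ->
  live (upd1 f j (rw f j)) /\ (forall i, i < n ->
    rw f i <= rw (upd1 f j (rw f j)) i /\ dw (upd1 f j (rw f j)) i <= dw f i).

Hypothesis eps0 : (0 < eps)%R.
Definition eta : F := (eps / (8 * m)%:R)%R.
Hypothesis Hgrow : L <= k \/ (L.+1%:R <= (1 + eta) ^+ k)%R.

(** Steps of conditioning in one interval: there are K^k grid points, each crossed by at most m K^h
    members, and every step removes more than K^(h-k-1) of these crossings. *)
Definition budget := m * K ^ (2 * k + 1).
Hypothesis Hr : n <= r \/ L * budget <= r.

Lemma crs_grid f st B j y : live f -> j < n -> 0 < B -> crs f (st + y * B) j -> y < n.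
Proof.
move=> lf jn B0; have [_ _ dT] := win lf jn; rewrite /crs => /andP[_ yd].
have : y <= y * B by rewrite leq_pmulr.
lia.
Qed.

Lemma crossP f st B j : live f -> j < n -> 0 < B ->
  reflect (exists c, crs f (st + c * B) j) (cross f st B j).
Proof.
move=> lf jn B0; apply: (iffP (cnt_gt0P _ _)) => [ [c cn h]|[c h]].
  by exists c; rewrite mulE in h => //; exact: ltnW.
have cn := crs_grid lf jn B0 h; exists c => //; rewrite mulE //; exact: ltnW.
Qed.

Section Conditioning.
Variables (IN : nat -> nat) (st h : nat).
Hypotheses (h0 : 0 < h) (hL : h <= L).
Notation Bk := (K ^ (h - k)).
Definition lam := if k < h then K ^ (h - k.+1) else 0.
Definition inside f := forall i, i < n -> 0 < IN i -> st < rw f i /\ dw f i <= st + K ^ h.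

Lemma Bk_gt0 : 0 < Bk. Proof. by rewrite expn_gt0; lia. Qed.

Definition gridcnt f := \sum_(0 <= c < n) cnt n (fun j => (0 < IN j) && crs f (st + c * Bk) j).

Definition calm f := forall j c, j < n -> 0 < IN j -> crs f (st + c * Bk) j ->
  cnt n (fun i => P i j && ((0 < IN i) && crs f (st + c * Bk) i)) < lam.

Lemma badE f j c : c < n -> bad n P sup pw k f IN st h j c =
  crs f (st + c * Bk) j &&
  (lam <= cnt n (fun i => P i j && ((0 < IN i) && crs f (st + c * Bk) i))).
Proof.
move=> cn; rewrite /bad !pwE ?mulE; try lia; congr (_ && _); rewrite /lam.
by case: ltnP => //= kh; rewrite -leqNgt.
Qed.

Lemma cstep_calm f : live f -> badjob f IN st h = 0 -> calm f.
Proof.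
move=> lf b0 j c jn Ij cj; rewrite ltnNge; apply/negP => h1.
have cn := crs_grid lf jn Bk_gt0 cj.
suff : 0 < badjob f IN st h by rewrite b0.
apply: (leq_trans (ltn0Sn j)); apply: (maxof_le succn (i := j)) => //=.
by rewrite Ij /=; apply: (cnt_gt0 (i := c)) => //; rewrite badE // cj.
Qed.

Lemma cstep_bad f : live f -> 0 < badjob f IN st h -> exists j c,
  [/\ j < n, badjob f IN st h = j.+1, 0 < IN j, c < n & crs f (st + c * Bk) j /\
   lam <= cnt n (fun i => P i j && ((0 < IN i) && crs f (st + c * Bk) i))].
Proof.
move=> lf /maxofP[j [jn /andP[Ij /cnt_gt0P[c cn]]]]; rewrite badE // => /andP[h1 h2] e.
by exists j, c; split.
Qed.

(** [gridcnt] serves as potential. Fixing j at its left end forces its predecessors to end before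
    that, hence before the grid point: j and at least [lam] of them stop crossing it, and shrinking
    windows create no new crossings. *)
Lemma cstep_step f : live f -> 0 < badjob f IN st h -> 
  ((supp f).+1 <= n -> gridcnt f >= lam.+1 -> (supp f).+1 <= r) ->
  let f' := cstep IN st h f in
  [/\ live f', forall i, i < n -> rw f i <= rw f' i /\ dw f' i <= dw f i,
      supp f' = (supp f).+1 & lam.+1 + gridcnt f' <= gridcnt f].
Proof.
move=> lf bp hr; have [j [c [jn bj Ij cn [cj cl]]]] := cstep_bad lf bp.
(* An assigned job has a window of one slot and crosses nothing. *)
have fj : f j = 0.
  apply/eqP; apply: contraT => /(fixed lf jn)[e1 e2].
  by move: cj; rewrite /crs e1 e2; case: ltnP.
pose q f := cnt n (fun i => (0 < IN i) && crs f (st + c * Bk) i).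
have lamq : lam.+1 <= q f.
  apply: leq_ltn_trans cl _; apply: (cnt_lt (i := j)) => //.
  - by rewrite Ij cj.
  - by rewrite negb_and Pirr.
  - by move=> i il /andP[].
have sf : (supp f).+1 <= n.
  rewrite -[X in _ <= X](cntT n); apply: (cnt_lt (i := j)) => //; by rewrite fj.
have qg : q f <= gridcnt f.
  by rewrite /gridcnt (bigD1_seq c) ?iota_uniq ?mem_index_iota //= leq_addr.
have [live' sh] := condition lf jn fj (hr sf (leq_trans lamq qg)).
rewrite /cstep bj /= subn1 /=; set f' := upd1 f j (rw f j) in live' sh *.
have [r0 _ _] := win lf jn.
split=> //; first by apply: (cnt_upd1 (p := fun s => s != 0)); rewrite ?fj //; lia.
have [e1 e2] : rw f' j = rw f j /\ dw f' j = rw f j.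
  have f'j : f' j = rw f j by rewrite /f' /upd1 eqxx.
  by rewrite -f'j; apply: fixed => //; rewrite f'j; lia.
have mono c' i : i < n -> crs f' (st + c' * Bk) i -> crs f (st + c' * Bk) i.
  by move=> il; rewrite /crs; have [] := sh i il; lia.
rewrite /gridcnt (bigD1_seq c) ?iota_uniq ?mem_index_iota //=.
rewrite [X in _ <= X](bigD1_seq c) ?iota_uniq ?mem_index_iota //= addnA.
apply: leq_add; last first.
  apply: leq_sum => c' _; apply: cnt_le => i il /andP[-> /=]; exact: mono.
have h1 : ((cnt n (fun i => P i j && ((0 < IN i) && crs f (st + c * Bk) i))) +
    cnt n (fun i => i == j)) + cnt n (fun i => (0 < IN i) && crs f' (st + c * Bk) i) <= q f.
  apply: leq_trans (_ : _ <= cnt n (fun i => (P i j && ((0 < IN i) && crs f (st + c * Bk) i))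
     || (i == j)) + cnt n (fun i => (0 < IN i) && crs f' (st + c * Bk) i)) _.
    rewrite leq_add2r; apply: cnt_disj => [i il /andP[Pij _]|//].
    by apply: contraL Pij => /eqP->.
  apply: cnt_disj => i il.
    case/orP => [/andP[Pij _]|/eqP->].
      have [_] := winP live' il jn Pij; rewrite e2; move: cj; rewrite /crs; lia.
    by rewrite /crs e2; move: cj; rewrite /crs; lia.
  case/orP => [/orP[/andP[_ //]|/eqP->]|/andP[-> /=]]; last exact: mono.
  by rewrite Ij cj.
apply: leq_trans h1; rewrite leq_add2r -addn1; apply: leq_add => //.
exact: (cnt_gt0 (i := j)).
Qed.

Lemma gridcnt_max f : live f -> inside f -> gridcnt f <= K ^ minn k h * (m * K ^ h).
Proof.
move=> lf ins.
have one c : cnt n (fun j => (0 < IN j) && crs f (st + c * Bk) j) <=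
    if c < K ^ minn k h then m * K ^ h else 0.
  case: ifP => [_|/negbT nc].
    apply: leq_trans (_ : cnt n (fun j => (st < rw f j) && (dw f j <= st + K ^ h)) <= _).
      by apply: cnt_le => i il /andP[Ii _]; have [-> ->] := ins i il Ii.
    by have := packing (a := st) (b := st + K ^ h) lf (leq_addr _ _); rewrite addKn.
  rewrite cnt_eq0 // => i il; apply/negP => /andP[Ii /andP[_ ci]].
  have [_ di] := ins i il Ii.
  have : c * Bk < K ^ minn k h * Bk.
    have -> : K ^ minn k h * Bk = K ^ h by rewrite -expnD; congr (_ ^ _); lia.
    lia.
  by rewrite ltn_pmul2r ?Bk_gt0 // (negbTE nc).
apply: (@leq_trans (\sum_(0 <= c < n) if c < K ^ minn k h then m * K ^ h else 0)).
  by apply: leq_sum => c _; exact: one.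
rewrite -big_mkcond /=.
case: (leqP n (K ^ minn k h)) => hn.
  rewrite big_nat_cond (eq_bigl (fun i => (0 <= i < n))); last by move=> i; lia.
  by rewrite -big_nat sum_nat_const_nat subn0 leq_mul2r hn orbT.
rewrite (big_cat_nat (n := K ^ minn k h)) ?(ltnW hn) //= [X in _ + X]big1_seq => [|i]; last first.
  by rewrite mem_index_iota; lia.
rewrite addn0 big_nat_cond (eq_bigl (fun i => (0 <= i < K ^ minn k h))); last by move=> i; lia.
by rewrite -big_nat sum_nat_const_nat subn0.
Qed.

Lemma budget_step x : x * lam.+1 <= K ^ minn k h * (m * K ^ h) -> x <= budget.
Proof.
rewrite /budget /lam; case: ltnP => kh hx.
  have e : K ^ k * (m * K ^ h) = m * K ^ (2 * k + 1) * K ^ (h - k.+1).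
    rewrite mulnCA -mulnA -!expnD; congr (_ * _ ^ _); lia.
  have p0 : 0 < K ^ (h - k.+1) by rewrite expn_gt0; lia.
  rewrite -(leq_pmul2r p0) -e; apply: (leq_trans _ hx); rewrite leq_mul2l.
  by rewrite leqnSn orbT.
move: hx; rewrite muln1 mulnCA -expnD => hx; apply: leq_trans hx _.
rewrite leq_mul2l leq_pexp2l ?orbT; lia.
Qed.

(** Heights drop by at least one per interval, so at most L - h budgets have been spent above; with
    this one, the support stays within L * budget. If n <= r, supports are never too large. *)
Lemma condP f : live f -> inside f -> supp f <= (L - h) * budget ->
  let f' := cond IN st h f in
  [/\ live f', forall i, i < n -> rw f i <= rw f' i /\ dw f' i <= dw f i,
      supp f' <= (L - h).+1 * budget & calm f'].
Proof.
move=> lf ins sf.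
pose I q f' := [/\ live f', forall i, i < n -> rw f i <= rw f' i /\ dw f' i <= dw f i,
  supp f <= supp f', (supp f' - supp f) * lam.+1 + gridcnt f' <= gridcnt f
  & badjob f' IN st h = 0 \/ supp f' = supp f + q].
have In : I n (cond IN st h f).
  apply: (foldl_inv (I := I)) => [|q g qn [lg shg sfg gg bg]].
    by split=> //; [rewrite subnn mul0n|right; rewrite addn0].
  have [b0|bp] := posnP (badjob g IN st h).
    by rewrite /cstep b0 /=; split=> //; left.
  have [|lg' shg' sg' gg'] := cstep_step lg bp.
    move=> sn gl; case: Hr => [nr|br]; first exact: leq_trans sn nr.
    apply: (leq_trans _ br); have : (supp g).+1 - supp f <= budget.
      apply: budget_step; apply: leq_trans (gridcnt_max lf ins).
      by rewrite subSn // mulSn; lia.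
    have -> : L * budget = (L - h) * budget + 1 * budget + (h - 1) * budget.
      by rewrite -!mulnDl; congr (_ * _); lia.
    move: sf; rewrite mul1n; set a := (L - h) * budget; set b := (h - 1) * budget; lia.
  split=> //.
  - move=> i il; have [? ?] := shg i il; have [? ?] := shg' i il.
    by split; lia.
  - by rewrite sg'; exact: leqW.
  - by rewrite sg' subSn // mulSn; lia.
  - by right; case: bg => [bg|->] in sg' *; [rewrite bg in bp|rewrite sg' addnS].
case: In => lf' sh ss gg bg; split=> //.
  have : supp (cond IN st h f) - supp f <= budget.
    by apply: budget_step; apply: leq_trans (gridcnt_max lf ins); lia.
  by rewrite mulSn; lia.
(* After n effective rounds all jobs would be assigned, whereas a bad job is unassigned. *)
apply: cstep_calm => //; case: bg => // sn; apply/eqP; rewrite -leqn0 leqNgt.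
apply/negP => /(cstep_bad lf')[j [c [jn _ _ _ [cj _]]]].
have fj : cond IN st h f j == 0.
  apply: contraT => /(fixed lf' jn)[e1 e2].
  by move: cj; rewrite /crs e1 e2; case: ltnP.
have : supp (cond IN st h f) < n.
  by rewrite -[X in _ < X](cntT n); apply: (cnt_lt (i := j)); rewrite // fj.
by rewrite sn; lia.
Qed.

End Conditioning.

Lemma m8E : m8 m = 8 * m. Proof. by rewrite /m8; lia. Qed.

Lemma sum_cntE (p : nat -> bool) a : \sum_(0 <= j < n | p j) a = cnt n p * a.
Proof. by rewrite /cnt big_distrl /=; apply: eq_bigr => j _; rewrite mul1n. Qed.

(** Here K^(h-k) is 1 by truncation and [lam] is 0, so calmness forbids every crossing. Low
    intervals thus lose nothing. *)
Lemma calm_small IN st h f : live f -> h <= k -> calm IN st h f ->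
  forall j B, j < n -> 0 < IN j -> 0 < B -> ~~ cross f st B j.
Proof.
move=> lf hk cf j B jn Ij B0; apply/negP => /(crossP st lf jn B0)[c cj].
have e : K ^ (h - k) = 1 by rewrite (eqP hk).
have := cf j (c * B) jn Ij; rewrite e muln1 => /(_ cj).
by rewrite /lam [k < h]ltnNge hk.
Qed.

Lemma cross_fine st h f i : live f -> i < h -> forall j, j < n ->
  cross f st (K ^ (h - i)) j -> cross f st (K ^ (h - i.+1)) j.
Proof.
have p0 a : 0 < K ^ a by rewrite expn_gt0; lia.
move=> lf ih j jn /(crossP st lf jn (p0 _))[c cj]; apply/(crossP st lf jn (p0 _)).
by exists (c * K); rewrite -mulnA -expnS; have -> : (h - i.+1).+1 = h - i by lia.
Qed.

(** If the criterion failed for every i < k, then L C i + N, with C i the members crossing the i-th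
    grid, would grow by more than the factor 1 + eta at each refinement, from at least N to at most
    (L + 1) N. *)
Lemma selP IN st h f : 0 < h <= L -> live f -> inside IN st h f -> calm IN st h f ->
  [/\ sel f IN st h < k, sel f IN st h < h & crit f IN st h (sel f IN st h)].
Proof.
move=> /andP[h0 hL] lf ins cf.
have p0 a : 0 < K ^ a by rewrite expn_gt0; lia.
suff [i [ik ih ci]] : exists i, [/\ i < k, i < h & crit f IN st h i].
  have iN : i < n by lia.
  have [|i' [i'n /and3P[h1 h2 h3] e]] := maxof_ex id (p := fun i => (i < k) && ((i < h) && crit f IN st h i)) iN.
    by rewrite ik ih.
  by rewrite /sel e.
case: (leqP h k) => hk.
  exists 0; split=> //; rewrite /crit /le big1_seq; last first.
    move=> j; rewrite mem_index_iota => /andP[/and3P[Ij cj _] jn].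
    rewrite pwE in cj; last by lia.
    by have := calm_small lf hk cf jn Ij (p0 (h - 1)); rewrite cj.
  by rewrite mulr_ge0 ?ler0n // ltW.
pose C i := cnt n (fun j => (0 < IN j) && cross f st (K ^ (h - i)) j).
pose N := cnt n (fun j => 0 < IN j).
pose a i : F := (L * C i + N)%:R%R.
have mid i : i < h -> cnt n (fun j => (0 < IN j) && (cross f st (pw (h - i.+1)) j &&
      ~~ cross f st (pw (h - i)) j)) + C i = C i.+1.
  move=> ih; rewrite /C [RHS](cntID n _ (fun j => cross f st (K ^ (h - i)) j)) addnC.
  have e1 : pw (h - i.+1) = K ^ (h - i.+1) by apply: pwE; lia.
  have e2 : pw (h - i) = K ^ (h - i) by apply: pwE; lia.
  rewrite e1 e2; congr (_ + _); apply: cnt_eq => j jn; last by rewrite andbA.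
  case: (boolP (cross f st (K ^ (h - i)) j)) => cj; last by rewrite !andbF.
  by rewrite (cross_fine lf ih jn cj) !andbT.
case: (boolP [exists i : 'I_k, crit f IN st h i]) => [/existsP[i ci]|/existsPn nc].
  by exists i; split=> //; exact: ltn_trans (ltn_ord i) hk.
have step i : i < k -> ((1 + eta) * a i < a i.+1)%R.
  move=> ik; have ih : i < h by lia.
  have := nc (Ordinal ik); rewrite /crit /le -ltNge /= !sum_cntE mulE; last by lia.
  have eC : cnt n (fun j => (0 < IN j) && cross f st (pw (h - i)) j) = C i.
    by apply: cnt_eq => j jn; rewrite pwE //; lia.
  have := mid i ih; set d := cnt n _; rewrite eC -/N /a => <-.
  have m8 : (0 < (8 * m)%:R :> F)%R by rewrite ltr0n; lia.
  move: m8; rewrite /eta -m8E; move: (m8 m) => q q0.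
  rewrite !natrD !natrM mulrDl mul1r => hlt.
  have : (eps / q%:R * (L%:R * (C i)%:R + N%:R) < L%:R * d%:R)%R.
    rewrite mulrAC ltr_pdivrMr //.
    have -> : (L%:R * d%:R * q%:R = d%:R * (L%:R * q%:R) :> F)%R by ring.
    by rewrite (mulrC L%:R (C i)%:R)%R.
  rewrite mulrDr; set u := (_ * _ + _)%R; lra.
have grow i : i <= k -> ((1 + eta) ^+ i * a 0%N <= a i)%R.
  elim: i => [|i IH] ik; first by rewrite expr0 mul1r.
  rewrite exprS -mulrA; apply: le_trans (ltW (step i ik)).
  rewrite ler_pM2l; first by apply: IH; lia.
  by rewrite addr_gt0 // divr_gt0 // ltr0n; lia.
exfalso; have e0 : (0 < 1 + eta :> F)%R.
  by rewrite addr_gt0 // divr_gt0 // ltr0n; lia.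
(* Strictness of one step is what gives the contradiction; it also covers N = 0. *)
have h1 : ((1 + eta) ^+ k * a 0%N < a k)%R.
  case: (k) k0 step grow => // k' _ step grow; rewrite exprS -mulrA.
  apply: le_lt_trans (step k' (ltnSn _)); rewrite ler_pM2l // grow //; exact: leqnSn.
case: Hgrow => [Lk|hg]; first by lia.
have h2 : (a k <= L.+1%:R * N%:R)%R.
  rewrite /a -natrM ler_nat mulSn addnC leq_add2l leq_mul2l; apply/orP; right.
  by apply: cnt_le => j _ /andP[].
have h3 : (L.+1%:R * N%:R <= (1 + eta) ^+ k * a 0%N)%R.
  apply: le_trans (_ : (_ <= (1 + eta) ^+ k * N%:R)%R) _; first by rewrite ler_wpM2r.
  by rewrite ler_wpM2l ?exprn_ge0 ?(ltW e0) // ler_nat leq_addl.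
by have := lt_le_trans h1 (le_trans h2 h3); rewrite ltxx.
Qed.

Definition valid f IN st h :=
  [/\ live f, inside IN st h f, supp f <= (L - h) * budget & h <= L].

Notation nxt f IN st h := (cond IN st h f).
Notation idx f IN st h := (sel (nxt f IN st h) IN st h).
Notation wid f IN st h := (K ^ (h - (idx f IN st h).+1)).

Lemma nodeP f IN st h : valid f IN st h -> 0 < h ->
  let f' := nxt f IN st h in let i := idx f IN st h in
  [/\ live f', inside IN st h f', supp f' <= (L - h).+1 * budget, calm IN st h f'
    & [/\ i < k, i < h & crit f' IN st h i]].
Proof.
move=> [lf ins sf hL] h0 /=; have [lf' sh sf' cf'] := condP h0 hL lf ins sf.
have ins' : inside IN st h (nxt f IN st h).
  move=> i il Ii; have [? ?] := ins i il Ii; have [? ?] := sh i il; split; lia.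
split=> //; apply: selP => //; lia.
Qed.

Lemma cellP st B x : 0 < B -> st < x <= T ->
  exists c, [/\ cell st B x = st + c * B, st + c * B < x & x <= st + c.+1 * B].
Proof.
move=> B0 /andP[sx xT].
pose p c := st + mul c B < x.
have [|c [cn pc e]] := maxof_ex (fun c => mul c B) (p := p) (i := 0) (leq_ltn_trans (leq0n T) Tn).
  by rewrite /p mulE // mul0n addn0.
exists c; rewrite /cell e; move: pc; rewrite /p !mulE; try lia.
move=> cx; split=> //; rewrite leqNgt; apply/negP => h.
have cB : c.+1 <= c.+1 * B by rewrite leq_pmulr.
have c1 : c.+1 < n by lia.
have := maxof_le (fun c => mul c B) (p := p) c1.
by rewrite e !mulE; rewrite /p ?mulE; try lia; move=> /(_ h); rewrite leq_pmul2r // ltnn.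
Qed.

Lemma wid_gt0 a : 0 < K ^ a. Proof. by rewrite expn_gt0; lia. Qed.

(** The branches of [out], with the cells of the window ends given by their indices. *)
Inductive out_view fuel f IN st h j : nat * nat * nat -> Prop :=
| OutLeaf of h = 0 : out_view fuel f IN st h j (1, st, st + 1)
| OutTop a b c of 0 < h & crs (nxt f IN st h) (st + c * (K * wid f IN st h)) j
    & st + a * wid f IN st h < rw (nxt f IN st h) j <= st + a.+1 * wid f IN st h
    & st + b * wid f IN st h < dw (nxt f IN st h) j <= st + b.+1 * wid f IN st h :
    out_view fuel f IN st h j (h + 1, st + a.+1 * wid f IN st h, st + b * wid f IN st h)
| OutMid of 0 < h & ~~ cross (nxt f IN st h) st (K * wid f IN st h) j
    & cross (nxt f IN st h) st (wid f IN st h) j :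
    out_view fuel f IN st h j (0, 0, 0)
| OutCell c of 0 < h & ~~ cross (nxt f IN st h) st (K * wid f IN st h) j
    & ~~ cross (nxt f IN st h) st (wid f IN st h) j
    & st + c * wid f IN st h < rw (nxt f IN st h) j
    & dw (nxt f IN st h) j <= st + c.+1 * wid f IN st h :
    out_view fuel f IN st h j
      (out fuel (nxt f IN st h) (restrict (nxt f IN st h) (st + c * wid f IN st h)
         (wid f IN st h) IN) (st + c * wid f IN st h)
         (h - (idx f IN st h).+1) j).

Lemma outP fuel f IN st h j : valid f IN st h -> j < n -> 0 < IN j ->
  out_view fuel f IN st h j (out fuel.+1 f IN st h j).
Proof.
move=> vf jn Ij; rewrite /=; case: eqP => [->|/eqP h0']; first exact: OutLeaf.
have h0 : 0 < h by lia.
have [lf' ins' _ _ [ik ih _]] := nodeP vf h0.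
have [_ _ _ hL] := vf.
rewrite !pwE; try lia.
have KB : K ^ (h - idx f IN st h) = K * wid f IN st h.
  by rewrite -expnS; congr (_ ^ _); lia.
have [r0 rd dT] := win lf' jn; have [sr de] := ins' j jn Ij.
have B0 := wid_gt0 (h - (idx f IN st h).+1).
have hr : st < rw (nxt f IN st h) j <= T by lia.
have hd : st < dw (nxt f IN st h) j <= T by lia.
have [a [ea a1 a2]] := cellP B0 hr; have [b [eb b1 b2]] := cellP B0 hd.
rewrite KB ea eb.
case: ifP => [/(crossP st lf' jn)[|c cj]|/negbT nc1]; first by rewrite muln_gt0 B0; lia.
  have -> : st + a * wid f IN st h + wid f IN st h = st + a.+1 * wid f IN st h.
    by rewrite mulSn; lia.
  by apply: (@OutTop _ _ _ _ _ _ a b c) => //; rewrite ?a1 ?b1.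
case: ifP => [c2|/negbT nc2]; first exact: OutMid.
apply: OutCell => //; rewrite leqNgt; apply/negP => da.
by case/(crossP st lf' jn B0): nc2; exists a.+1; rewrite /crs da andbT -leqNgt.
Qed.

Lemma child_valid f IN st h c : valid f IN st h -> 0 < h ->
  valid (nxt f IN st h) (restrict (nxt f IN st h) (st + c * wid f IN st h)
    (wid f IN st h) IN) (st + c * wid f IN st h) (h - (idx f IN st h).+1).
Proof.
move=> vf h0; have [lf' ins' sf' _ [ik ih _]] := nodeP vf h0.
have [_ _ _ hL] := vf; split=> //; last by lia.
  by move=> i il; rewrite /restrict; case: ifP => // /andP[? ?] _; split; lia.
apply: leq_trans sf' _; rewrite leq_mul2r; apply/orP; right; lia.
Qed.

Lemma restrictE f st B IN i : (0 < restrict f st B IN i) =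
  [&& 0 < IN i, st < rw f i & dw f i <= st + B].
Proof. by rewrite /restrict -leqNgt; case: ifP; rewrite ?andbT ?andbF //= ltnn. Qed.

Lemma cell_top f IN st h j c : valid f IN st h -> 0 < h -> j < n -> 0 < IN j ->
  st + c * wid f IN st h < rw (nxt f IN st h) j -> c.+1 * wid f IN st h <= K ^ h.
Proof.
move=> vf h0 jn Ij cr; have [lf' ins' _ _ [ik ih _]] := nodeP vf h0.
have [sr dK] := ins' j jn Ij; have [_ rd _] := win lf' jn.
have B0 := wid_gt0 (h - (idx f IN st h).+1).
have e : K ^ h = K ^ (idx f IN st h).+1 * wid f IN st h.
  by rewrite -expnD; congr (_ ^ _); lia.
rewrite e leq_pmul2r //; have : c * wid f IN st h < K ^ h by lia.
by rewrite e ltn_pmul2r.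
Qed.

Lemma out_bounds fuel f IN st h j g R D : valid f IN st h -> j < n -> 0 < IN j ->
  h < fuel -> out fuel f IN st h j = (g, R, D) ->
  g <= h + 1 /\ (0 < g -> [/\ st <= R, D <= st + K ^ h & D <= T]).
Proof.
elim: fuel f IN st h => // fuel IH f IN st h vf jn Ij hf.
have [lf ins _ hL] := vf.
case: (outP fuel vf jn Ij) => [h0 [<- <- <-]|a b c h0 cj ra db [<- <- <-]|h0 _ _ [<- _ _]|c h0 _ _ cr cd].
- split=> [|_]; first lia; have [? ?] := ins j jn Ij; have [_ ? ?] := win lf jn.
  by rewrite h0 expn0; split; lia.
- have [lf' ins' _ _ _] := nodeP vf h0; have [? ?] := ins' j jn Ij.
  by have [_ _ ?] := win lf' jn; split=> // _; split; lia.
- by split=> //; lia.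
have [lf' _ _ _ [ik ih _]] := nodeP vf h0.
move=> /(IH _ _ _ _ (child_valid c vf h0) jn); rewrite restrictE Ij cr.
have -> : dw (nxt f IN st h) j <= st + c * wid f IN st h + wid f IN st h.
  by move: cd; rewrite mulSn; lia.
move=> /(_ isT) [|gh gR]; first by lia.
split; first by lia.
move=> /gR[? dd ?]; split=> //; first by lia.
apply: leq_trans dd _; rewrite -addnA leq_add2l addnC -mulSn.
exact: cell_top vf h0 jn Ij cr.
Qed.

(** Rounding is monotone, which settles two jobs served in the same interval. Against a job inside a
    cell, inward rounding makes a served job end at or before the start of the cell, or start at or
    after its end. Two jobs in the same cell are compared by recursion. *)
Lemma out_compat fuel f IN st h i j gi Ri Di gj Rj Dj :
  valid f IN st h -> h < fuel -> i < n -> j < n -> 0 < IN i -> 0 < IN j -> P i j ->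
  out fuel f IN st h i = (gi, Ri, Di) -> out fuel f IN st h j = (gj, Rj, Dj) ->
  0 < gi -> 0 < gj -> Di <= Rj \/ [/\ gi = gj, Ri <= Rj & Di <= Dj].
Proof.
elim: fuel f IN st h => // fuel IH f IN st h vf hf il jn Ii Ij Pij.
have [h0|h0] := posnP h.
  have [lf ins _ _] := vf; have [? ?] := winP lf il jn Pij.
  have [_ ? _] := win lf il; have [_ ? _] := win lf jn.
  by have [] := ins i il Ii; have [] := ins j jn Ij; rewrite h0 expn0; lia.
have [lf' ins' _ _ [ik ih _]] := nodeP vf h0.
have [rij dij] := winP lf' il jn Pij.
have [si ei] := ins' i il Ii; have [sj ej] := ins' j jn Ij.
have [_ wi _] := win lf' il; have [_ wj _] := win lf' jn.
set B := wid f IN st h.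
have B0 : 0 < B by exact: wid_gt0.
have gl a b : (st + a * B < st + b * B) = (a < b) by rewrite ltn_add2l ltn_pmul2r.
have ge a b : (st + a * B <= st + b * B) = (a <= b) by rewrite leq_add2l leq_pmul2r.
have childB c l g R D : l < n -> 0 < IN l -> st + c * B < rw (nxt f IN st h) l ->
    dw (nxt f IN st h) l <= st + c.+1 * B ->
    out fuel (nxt f IN st h) (restrict (nxt f IN st h) (st + c * B) B IN) (st + c * B)
      (h - (idx f IN st h).+1) l = (g, R, D) -> 0 < g ->
    [/\ 0 < restrict (nxt f IN st h) (st + c * B) B IN l, st + c * B <= R & D <= st + c.+1 * B].
  move=> ll Il cl dl ol g0.
  have Ic : 0 < restrict (nxt f IN st h) (st + c * B) B IN l.
    by rewrite restrictE Il cl; move: dl; rewrite mulSn; lia.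
  have hf' : h - (idx f IN st h).+1 < fuel by lia.
  have [_ /(_ g0)[h1 h2 _]] := out_bounds (child_valid c vf h0) ll Ic hf' ol.
  by split=> //; move: h2; rewrite -/B mulSn; lia.
case: (outP fuel vf il Ii) => [|a b c _ ci ra db [<- <- <-]|_ _ _ [<-]|c _ _ _ ri di oi]; [by lia| |by []|];
case: (outP fuel vf jn Ij) => [|a' b' c' _ cj ra' db' [<- <- <-]|_ _ _ [<-]|c' _ _ _ rj dj oj];
  try (by lia); try by [].
- move=> _ _; right; split=> //.
    rewrite ge; have : st + a * B < st + a'.+1 * B by lia.
    by rewrite gl.
  rewrite ge; have : st + b * B < st + b'.+1 * B by lia.
  by rewrite gl ltnS.
- move=> _ gj0; left; have [_ cR _] := childB c' j _ _ _ jn Ij rj dj oj gj0.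
  apply: leq_trans cR; rewrite ge; have : st + b * B < st + c'.+1 * B by lia.
  by rewrite gl ltnS.
- move=> gi0 _; left; have [_ _ cD] := childB c i _ _ _ il Ii ri di oi gi0.
  apply: leq_trans cD _; rewrite ge; have : st + c * B < st + a'.+1 * B by lia.
  by rewrite gl ltnS.
- move=> gi0 gj0; have [Ici cR cD] := childB c i _ _ _ il Ii ri di oi gi0.
  have [Icj cR' cD'] := childB c' j _ _ _ jn Ij rj dj oj gj0.
  case: (ltngtP c c') => cc.
  + left; apply: leq_trans cD (leq_trans _ cR'); by rewrite ge.
  + have : st + c * B < st + c'.+1 * B by lia.
    by rewrite gl ltnS leqNgt cc.
  + subst c'; apply: IH oi oj gi0 gj0 => //; [exact: child_valid|lia].
Qed.

Section Root.
Variables (IN G R D : nat -> nat).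
Hypotheses (live0 : live (fun=> 0)) (TK : T <= K ^ L).
Hypothesis INn : forall j, j < n -> 0 < IN j.
Hypothesis outE : forall j, j < n -> out n (fun=> 0) IN 0 L j = (G j, R j, D j).

Lemma root_valid : valid (fun=> 0) IN 0 L.
Proof.
split=> //; last by rewrite /supp cnt_eq0.
by move=> i il _; have [? ? ?] := win live0 il; rewrite add0n; split; lia.
Qed.

Lemma root_compat : compatible n P G R D.
Proof.
have Ln' : L < n by lia.
move=> i j il jn Pij.
exact: (out_compat root_valid Ln' il jn (INn il) (INn jn) Pij (outE il) (outE jn)).
Qed.

Lemma root_deadline j : j < n -> 0 < G j -> D j <= T.
Proof.
have Ln' : L < n by lia.
by move=> jn Gj; have [_ /(_ Gj)[]] := out_bounds root_valid jn (INn jn) Ln' (outE jn).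
Qed.

End Root.

Variables (G R D S : nat -> nat).
Hypothesis Sspec : greedy_spec n m P G R D S.
Hypothesis compat : compatible n P G R D.

(** [cx_local] isolates the interval within the single greedy run: jobs of enclosing intervals have
    larger groups, and jobs of other intervals have no slots here. *)
Record context fuel f IN st h : Prop := Context {
  cx_valid : valid f IN st h;
  cx_fuel : h < fuel;
  cx_out : forall j, j < n -> 0 < IN j -> out fuel f IN st h j = (G j, R j, D j);
  cx_local : forall i u, i < n -> st < u <= st + K ^ h -> R i < u <= D i ->
    0 < G i <= h + 1 -> 0 < IN i }.

Notation sub f IN st h c := (restrict (nxt f IN st h) (st + c * wid f IN st h)
  (wid f IN st h) IN).

Lemma cell_eq B st c c' u v : st + c * B < u <= st + c.+1 * B ->
  st + c' * B < v <= st + c'.+1 * B -> u <= st + c'.+1 * B -> v <= st + c.+1 * B -> c = c'.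
Proof.
move=> h1 h2 h3 h4; have e a b : (st + a * B < st + b * B) -> a < b.
  by rewrite ltn_add2l ltn_mul2r => /andP[].
have := e c c'.+1 ltac:(lia); have := e c' c.+1 ltac:(lia); lia.
Qed.

Lemma cell_context fuel f IN st h c : context fuel.+1 f IN st h -> 0 < h ->
  c.+1 * wid f IN st h <= K ^ h ->
  context fuel (nxt f IN st h) (sub f IN st h c) (st + c * wid f IN st h)
    (h - (idx f IN st h).+1).
Proof.
move=> [vf hf ho hl] h0 cM.
have [lf' ins' _ _ [ik ih _]] := nodeP vf h0.
have B0 := wid_gt0 (h - (idx f IN st h).+1).
have childR c' j : j < n -> 0 < IN j -> st + c' * wid f IN st h < rw (nxt f IN st h) j ->
    dw (nxt f IN st h) j <= st + c'.+1 * wid f IN st h -> 0 < sub f IN st h c' j.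
  by move=> jn Ij cr cd; rewrite restrictE Ij cr; move: cd; rewrite mulSn; lia.
split; [exact: child_valid|lia| |].
- move=> j jn; rewrite restrictE => /and3P[Ij cr cd].
  have {}cd : dw (nxt f IN st h) j <= st + c.+1 * wid f IN st h by rewrite mulSn; lia.
  have [_ wj _] := win lf' jn.
  have nc B' e : 0 < B' -> B' = e * wid f IN st h -> ~~ cross (nxt f IN st h) st B' j.
    move=> B'0 eB; apply/negP => /(crossP st lf' jn B'0)[c']; rewrite /crs -leqNgt eB mulnA.
    move=> /andP[h1 h2].
    have h3 : st + c * wid f IN st h < st + c' * e * wid f IN st h by lia.
    have h4 : st + c' * e * wid f IN st h < st + c.+1 * wid f IN st h by lia.
    by move: h3 h4; rewrite !ltn_add2l !ltn_pmul2r //; lia.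
  rewrite -(ho j jn Ij).
  case: (outP fuel vf jn Ij) => [|a b c' _ cj|_ _ cj|c' _ _ _ cr' cd']; first by lia.
  + have /negP[] := nc (K * wid f IN st h) K ltac:(by rewrite muln_gt0 B0; lia) erefl.
    by apply/(crossP st lf' jn); [rewrite muln_gt0 B0; lia|exists c'].
  + by have /negP[] := nc (wid f IN st h) 1 B0 ltac:(by rewrite mul1n).
  by have -> : c' = c by apply: (cell_eq (B := wid f IN st h) (st := st)
    (u := rw (nxt f IN st h) j) (v := rw (nxt f IN st h) j)); lia.
move=> i u il uc Ru Gi.
have Ii : 0 < IN i by apply: (hl i u) => //; [move: cM; rewrite mulSn; lia|lia].
have := ho i il Ii.
case: (outP fuel vf il Ii) => [|a b c' _ cj _ _ [e _ _]|_ _ _ [e _ _]|c' _ _ _ cr' cd' oi].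
- by lia.
- by lia.
- by lia.
have Ic' := childR c' i il Ii cr' cd'.
have hf' : h - (idx f IN st h).+1 < fuel by lia.
have g0 : 0 < G i by lia.
have [_ /(_ g0)[h1 h2 _]] := out_bounds (child_valid c' vf h0) il Ic' hf' oi.
suff -> : c = c' by [].
have e1 : st + c.+1 * wid f IN st h = st + c * wid f IN st h + wid f IN st h by rewrite mulSn; lia.
have e2 : st + c'.+1 * wid f IN st h = st + c' * wid f IN st h + wid f IN st h by rewrite mulSn; lia.
by apply: (cell_eq (B := wid f IN st h) (st := st) (u := u) (v := u)); lia.
Qed.

(** All members have the same one-slot window, so by packing there are at most m of them and j is
    not crowded out. Nor is it blocked, since precedence strictly separates left ends. *)
Lemma leaf_placed fuel f IN st j : context fuel.+1 f IN st 0 -> j < n -> 0 < IN j ->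
  0 < S j.
Proof.
move=> [vf hf ho hl] jn Ij; have [lf ins _ _] := vf.
have lo i : i < n -> 0 < IN i -> [/\ G i = 1, R i = st, D i = st + 1, rw f i = st + 1
    & dw f i = st + 1].
  move=> il Ii; have := ho i il Ii => -[<- <- <-].
  by have [] := ins i il Ii; have [] := win lf il; rewrite expn0; split; lia.
have [Gj Rj Dj rj dj] := lo j jn Ij.
have [_ _ dT] := win lf jn.
have loc i : i < n -> st < st + 1 <= D i -> R i <= st -> 0 < G i <= 1 -> 0 < IN i.
  by move=> il Di Ri Gi; apply: (hl i (st + 1)) => //; rewrite ?expn0; lia.
case: (gr_fill Sspec (k := j) (u := st + 1)) => //; try lia.
- rewrite /full Gj Dj => fl; rewrite lt0n; apply/negP => /eqP Sj.
  have := packing (a := st) (b := st + 1) lf (leq_addr _ _).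
  rewrite addKn muln1 leqNgt => /negP[]; apply: leq_ltn_trans fl _.
  apply: (cnt_lt (i := j)) => //; first by rewrite rj dj; lia.
    by rewrite Sj; lia.
  move=> i il /andP[/eqP Si Gi].
  have [g0 rd] := gr_win Sspec il ltac:(lia).
  have Ii : 0 < IN i by apply: loc => //; lia.
  by have [_ _ _ -> ->] := lo i il Ii; lia.
- move=> [i [il Pij Gij uD _]].
  case: (compat il jn Pij) => [| |h|[_ h _]]; try lia.
  have Ii : 0 < IN i by apply: loc => //; lia.
  have [_ _ _ ri _] := lo i il Ii; have [] := winP lf il jn Pij; lia.
Qed.

Notation topjob f IN st h j := ((0 < IN j) && cross (nxt f IN st h) st (K * wid f IN st h) j).

Lemma top_group fuel f IN st h j : context fuel.+1 f IN st h -> 0 < h -> j < n ->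
  topjob f IN st h j -> G j = h + 1.
Proof.
move=> [vf hf ho hl] h0 jn /andP[Ij cj].
have := ho j jn Ij; case: (outP fuel vf jn Ij) => [|a b c _ _ _ _ [<-] //|_ nc|c _ nc];
  by [lia|rewrite cj in nc].
Qed.

(** As i < k, the points of the grid of spacing K^(h-i-1) lie on the conditioning grid of spacing
    K^(h-k). So calmness bounds the chains through them by K^(h-k-1), and K times this is at most
    the spacing. No window exceeds T, which gives the minimum. *)
Lemma top_loss fuel f IN st h : context fuel.+1 f IN st h -> k < h ->
  K * cnt n (fun j => topjob f IN st h j && (S j == 0)) <= 3 * m * minn (K ^ h) (T - st).
Proof.
move=> cx kh; have h0 : 0 < h by lia.
have [vf hf ho hl] := cx; have [_ _ _ hL] := vf.
have [lf' ins' _ cf [ik ih _]] := nodeP vf h0.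
set f' := nxt f IN st h in lf' ins' cf *; set ii := idx f IN st h in ik ih *.
set B := K ^ (h - ii.+1).
have B0 : 0 < B by exact: wid_gt0.
have KB0 : 0 < K * B by rewrite muln_gt0 B0; lia.
have hM : K ^ h = K ^ ii.+1 * B by rewrite -expnD; congr (_ ^ _); lia.
have topP j : j < n -> topjob f IN st h j -> exists a b c,
    [/\ G j = h + 1, R j = st + a.+1 * B, D j = st + b * B,
      crs f' (st + c * (K * B)) j &
      st + a * B < rw f' j <= st + a.+1 * B /\ st + b * B < dw f' j <= st + b.+1 * B].
  move=> jn /andP[Ij cj]; have := ho j jn Ij.
  case: (outP fuel vf jn Ij) => [|a b c _ cj' h1 h2 [<- <- <-]|_ nc|c _ nc];
    try (by [lia|rewrite cj in nc]).
  by exists a, b, c.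
apply: (@node_loss n m P G R D S Pirr Ptrans Sspec (h + 1) st B (K ^ ii.+1) K
  (lam h) _ (rw f') (dw f') (fun j => topjob f IN st h j)) => //; try lia.
- rewrite /lam kh -expnS; apply: leq_pexp2l; lia.
- by move=> a b ab; exact: packing.
- move=> j jn tj; have [a [b [c [Gj Rj Dj cj [h1 h2]]]]] := topP j jn tj.
  have /andP[Ij _] := tj; have [? ?] := ins' j jn Ij; have [_ _ ?] := win lf' jn.
  by rewrite -hM; split; lia.
- move=> j jn tj; have [a [b [c [Gj Rj Dj cj [h1 h2]]]]] := topP j jn tj.
  split; [by exists a.+1|by exists b|rewrite Rj; move: h1; rewrite mulSn; lia|].
  by rewrite Dj; move: h2; rewrite mulSn; lia.
- move=> j jn tj; have [a [b [c [Gj Rj Dj cj [h1 h2]]]]] := topP j jn tj.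
  exists (c * K); rewrite dvdn_mull //; move: cj; rewrite /crs -leqNgt mulnA.
  by move=> /andP[? ?]; split.
- move=> j c jn /andP[Ij _] cj.
  have e : c * B = c * K ^ (k - ii.+1) * K ^ (h - k).
    by rewrite -mulnA -expnD; congr (_ * _ ^ _); lia.
  have := cf j (c * K ^ (k - ii.+1)) jn Ij; rewrite -e /crs -leqNgt => /(_ cj).
  apply: leq_ltn_trans; apply: cnt_le => i il /and3P[-> /andP[-> _] ci] /=.
  by rewrite -leqNgt.
- move=> i u il uM Ru Gi; have Ii : 0 < IN i by apply: (hl i u) => //; rewrite hM.
  have := ho i il Ii.
  case: (outP fuel vf il Ii) => [|a b c _ cj _ _ [e _ _]|_ _ _ [e _ _]|c _ nc nc' cr cd oi].
  + by lia.
  + split; last by lia.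
    by move=> _; rewrite Ii /=; apply/(crossP st lf' il KB0); exists c.
  + by lia.
  have Ic : 0 < sub f IN st h c i.
    by rewrite restrictE Ii cr; move: cd; rewrite mulSn; lia.
  have hf' : h - (idx f IN st h).+1 < fuel by lia.
  have g0 : 0 < G i by lia.
  have [gle /(_ g0)[h1 h2 _]] := out_bounds (child_valid c vf h0) il Ic hf' oi.
  split; first by lia.
  move=> _ c' uc'.
  have e1 : st + c.+1 * B = st + c * B + B by rewrite mulSn; lia.
  suff -> : c' = c by [].
  by apply: (cell_eq (B := B) (st := st) (u := u) (v := u)); rewrite -/B in h1 h2 *; lia.
Qed.

(** Index of the cell of the left end; the predecessor is taken because cells are closed on the
    right. *)
Definition cidx st B (f : nat -> nat) j := (rw f j - st).-1 %/ B.

Lemma cell_split f IN st h j : valid f IN st h -> 0 < h -> j < n -> 0 < IN j ->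
  ~~ cross (nxt f IN st h) st (wid f IN st h) j ->
  cidx st (wid f IN st h) (nxt f IN st h) j < K ^ (idx f IN st h).+1 /\
  0 < sub f IN st h (cidx st (wid f IN st h) (nxt f IN st h) j) j.
Proof.
move=> vf h0 jn Ij nc; have [lf' ins' _ _ [ik ih _]] := nodeP vf h0.
have B0 := wid_gt0 (h - (idx f IN st h).+1).
have [sr dK] := ins' j jn Ij.
set c := cidx _ _ _ _.
have [c1 c2] : st + c * wid f IN st h < rw (nxt f IN st h) j /\
    rw (nxt f IN st h) j <= st + c.+1 * wid f IN st h.
  have := divn_eq (rw (nxt f IN st h) j - st).-1 (wid f IN st h).
  have := ltn_pmod (rw (nxt f IN st h) j - st).-1 B0.
  by rewrite -/(cidx st (wid f IN st h) (nxt f IN st h) j) -/c mulSn; lia.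
split.
  rewrite -(ltn_pmul2r B0) -expnD.
  have -> : (idx f IN st h).+1 + (h - (idx f IN st h).+1) = h by lia.
  by have := cell_top vf h0 jn Ij c1; rewrite mulSn; lia.
rewrite restrictE Ij c1 /= leqNgt; apply/negP => da; case/negP: nc.
by apply/(crossP st lf' jn B0); exists c.+1; rewrite /crs -leqNgt c2 mulSn; lia.
Qed.

Lemma sub_cidx f IN st h c j : 0 < sub f IN st h c j ->
  j < n -> live (nxt f IN st h) ->
  c = cidx st (wid f IN st h) (nxt f IN st h) j /\
  ~~ cross (nxt f IN st h) st (wid f IN st h) j /\ 0 < IN j.
Proof.
rewrite restrictE => /and3P[Ij c1 c2] jn lf'.
have B0 := wid_gt0 (h - (idx f IN st h).+1).
have [_ rd _] := win lf' jn.
split.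
  rewrite /cidx.
  have -> : (rw (nxt f IN st h) j - st).-1 = c * wid f IN st h +
     (rw (nxt f IN st h) j - (st + c * wid f IN st h)).-1 by lia.
  by rewrite divnMDl // divn_small ?addn0 //; lia.
split=> //; apply/negP => /(crossP st lf' jn B0)[a /andP[]]; rewrite -leqNgt => h1 h2.
have h3 : st + c * wid f IN st h < st + a * wid f IN st h by lia.
have h4 : st + a * wid f IN st h < st + c.+1 * wid f IN st h by rewrite mulSn; lia.
by move: h3 h4; rewrite !ltn_add2l !ltn_pmul2r //; lia.
Qed.

Lemma cells_count f IN st h (q : nat -> bool) : valid f IN st h -> 0 < h ->
  \sum_(0 <= c < K ^ (idx f IN st h).+1) cnt n (fun j => (0 < sub f IN st h c j) && q j) =
  cnt n (fun j => ((0 < IN j) && ~~ cross (nxt f IN st h) st (wid f IN st h) j) && q j).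
Proof.
move=> vf h0; have [lf' _ _ _ _] := nodeP vf h0.
pose p j := ((0 < IN j) && ~~ cross (nxt f IN st h) st (wid f IN st h) j) && q j.
transitivity (cnt n (fun j => p j && (0 <= cidx st (wid f IN st h) (nxt f IN st h) j
    < K ^ (idx f IN st h).+1))).
  rewrite -sum_cnt; apply: eq_bigr => c _; apply: cnt_eq => j jn.
  apply/andP/andP => [ [Ic qj]|[/andP[/andP[Ij nc] qj] /eqP <-]].
    by have [<- [nc Ij]] := sub_cidx Ic jn lf'; rewrite /p Ij nc.
  by have [] := cell_split vf h0 jn Ij nc.
apply: cnt_eq => j jn; rewrite /p; case: (boolP (0 < IN j)) => //= Ij.
case: (boolP (cross (nxt f IN st h) st (wid f IN st h) j)) => //= nc.
by have [-> _] := cell_split vf h0 jn Ij nc; rewrite andbT.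
Qed.

Lemma cells_width B M a : \sum_(0 <= c < M) minn B (a - c * B) = minn (M * B) a.
Proof.
elim: M => [|M IH]; first by rewrite big_geq // mul0n min0n.
by rewrite big_nat_recr //= IH mulSn; lia.
Qed.

Definition unplaced IN := cnt n (fun j => (0 < IN j) && (S j == 0)).
(** Group 1 marks the leaves and group 0 the discarded jobs, so these are the members served at some
    positive height. *)
Definition toplevel IN := cnt n (fun j => (0 < IN j) && (1 < G j)).
Definition members IN := cnt n (fun j : nat => 0 < IN j).

(** Only intervals of height above k lose jobs, and at most h - k of them are nested. A member is
    therefore charged at most h - k times for discarding, a served job once with weight L, and each
    slot up to T at most h - k times for missed deadlines. Cutting widths at T matters because K^L
    may far exceed T. *)
Lemma tree_loss fuel f IN st h : context fuel f IN st h ->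
  ((K * (8 * m * L) * unplaced IN)%:R <=
    eps * (K * (L * toplevel IN + (h - k) * members IN))%:R +
    (8 * m * L * (3 * m * ((h - k) * minn (K ^ h) (T - st))))%:R :> F)%R.
Proof.
elim: fuel f IN st h => [|fuel IH] f IN st h cx; first by have := cx_fuel cx.
have e0 := ltW eps0.
have [h0|h0] := posnP h.
  subst h; rewrite [unplaced IN]cnt_eq0 ?muln0 => [|j jn]; last first.
    apply/negP => /andP[Ij Sj]; have := leaf_placed cx jn Ij.
    by rewrite (eqP Sj).
  by rewrite addr_ge0 ?mulr_ge0.
have vf := cx_valid cx; have [lf' ins' _ cf [ik ih ci]] := nodeP vf h0.
have [_ _ _ hL] := vf.
set M := K ^ (idx f IN st h).+1; set B := wid f IN st h.
have B0 : 0 < B by exact: wid_gt0.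
have KB0 : 0 < K * B by rewrite muln_gt0 B0; lia.
have hM : K ^ h = M * B by rewrite -expnD; congr (_ ^ _); lia.
pose X := cnt n (fun j => topjob f IN st h j && (S j == 0)).
pose A := cnt n (fun j => topjob f IN st h j).
pose mid := cnt n (fun j => (0 < IN j) && (cross (nxt f IN st h) st B j &&
  ~~ cross (nxt f IN st h) st (K * B) j)).
pose s q := \sum_(0 <= c < M) q (sub f IN st h c) : nat.
have X1 : k < h -> K * X <= 3 * m * minn (K ^ h) (T - st) by exact: top_loss cx.
have X0 : h <= k -> X = 0 /\ mid = 0.
  move=> hk; split; apply: cnt_eq0 => j jn; apply/negP.
    by case/andP=> /andP[Ij cj] _; have := calm_small lf' hk cf jn Ij KB0; rewrite cj.
  by case/and3P=> Ij cj _; have := calm_small lf' hk cf jn Ij B0; rewrite cj.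
have hloss : unplaced IN <= X + mid + s unplaced.
  rewrite /s /unplaced cells_count //; set Z := cnt n (fun j => (_ && ~~ _) && _).
  apply: (@leq_trans (cnt n (fun j => (topjob f IN st h j && (S j == 0)) ||
     ((0 < IN j) && (cross (nxt f IN st h) st B j &&
        ~~ cross (nxt f IN st h) st (K * B) j))) + Z)).
    apply: leq_trans (cntU _ _ _); apply: cnt_le => j jn /andP[-> ->] /=.
    by rewrite !andbT; case: (cross _ _ _ _); case: (cross _ _ _ _).
  by rewrite leq_add2r; exact: cntU.
have htop : A + s toplevel <= toplevel IN.
  rewrite /s /toplevel cells_count //; apply: cnt_disj => j jn.
    move=> /andP[Ij /(crossP st lf' jn KB0)[c cj]]; rewrite negb_and; apply/orP; left.
    rewrite Ij /= negbK; apply/(crossP st lf' jn B0); exists (c * K).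
    by rewrite -mulnA.
  case/orP => [tj|/andP[/andP[-> _] -> //]].
  by rewrite (top_group cx h0 jn tj); case/andP: tj => -> _; lia.
have hmem : s members <= members IN.
  rewrite /s /members (eq_bigr (fun c => cnt n (fun j => (0 < sub f IN st h c j) &&
     xpredT j))) => [|c _]; last by apply: cnt_eq => j _; rewrite andbT.
  by rewrite cells_count //; apply: cnt_le => j _ /andP[/andP[]].
have hw : \sum_(0 <= c < M) minn B (T - (st + c * B)) = minn (K ^ h) (T - st).
  by rewrite hM -cells_width; apply: eq_bigr => c _; rewrite subnDA.
set W := minn (K ^ h) (T - st) in X1 hw *; set y := (h - (idx f IN st h).+1) - k.
set E := 8 * m * L.
have IHs : ((K * E * s unplaced)%:R <= eps * (K * (L * s toplevel + y * s members))%:R +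
    (E * (3 * m * (y * W)))%:R :> F)%R.
  have -> : K * E * s unplaced = \sum_(0 <= c < M) K * E * unplaced (sub f IN st h c).
    by rewrite big_distrr.
  have -> : K * (L * s toplevel + y * s members) = \sum_(0 <= c < M)
      K * (L * toplevel (sub f IN st h c) + y * members (sub f IN st h c)).
    by rewrite -big_distrr big_split -!big_distrr.
  have -> : E * (3 * m * (y * W)) = \sum_(0 <= c < M) E * (3 * m * (y * minn B (T - (st + c * B)))).
    by rewrite -!big_distrr hw.
  rewrite !natr_sum mulr_sumr -big_split /=; apply: ler_sum_nat => c cM.
  by apply: IH; apply: cell_context => //; rewrite hM leq_mul2r; lia.
have cmid : ((mid * (L * (8 * m)))%:R <= eps * (A * L + members IN)%:R :> F)%R.
  move: ci; rewrite /crit /le !sum_cntE m8E mulE; last by lia.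
  have pwB : pw (h - (idx f IN st h).+1) = B by apply: pwE; lia.
  have pwKB : pw (h - idx f IN st h) = K * B.
    by rewrite pwE; [rewrite -expnS; congr (_ ^ _); clear -ih; lia|lia].
  by rewrite pwB pwKB.
have l1 : K * E * unplaced IN <= K * E * X + K * (mid * (L * (8 * m))) + K * E * s unplaced.
  have := leq_mul (leqnn (K * E)) hloss; rewrite /E; lia.
have l2 : L * A + L * s toplevel <= L * toplevel IN by rewrite -mulnDr leq_mul2l htop orbT.
apply: le_trans (_ : _ <= (K * E * X + K * (mid * (L * (8 * m))) + K * E * s unplaced)%:R)%R _.
  by rewrite ler_nat.
case: (ltnP k h) => kh; last first.
  have [-> ->] := X0 kh; rewrite muln0 mul0n muln0 !add0n.
  have y0 : y = 0 by rewrite /y; clear -kh; lia.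
  have -> : h - k = 0 by clear -kh; lia.
  apply: le_trans IHs _; rewrite y0 !mul0n !muln0 !addn0 lerD2r ler_wpM2l // ler_nat.
  by rewrite leq_mul2l; apply/orP; right; clear -l2; lia.
have l3 : K * E * X <= E * (3 * m * W) by rewrite mulnAC mulnC leq_mul2l X1 ?orbT.
have yh : y.+1 <= h - k by rewrite /y; clear -ik kh; lia.
have l4 : L * A + members IN + (L * s toplevel + y * s members) <=
    L * toplevel IN + (h - k) * members IN.
  have : y * s members <= y * members IN by rewrite leq_mul2l hmem orbT.
  have : y.+1 * members IN <= (h - k) * members IN by rewrite leq_mul2r yh orbT.
  by rewrite mulSn; clear -l2; lia.
have l5 : E * (3 * m * W) + E * (3 * m * (y * W)) <= E * (3 * m * ((h - k) * W)).
  rewrite -!mulnDr !leq_mul2l -mulSn leq_mul2r yh !orbT //.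
rewrite !natrD.
have r3 : ((K * E * X)%:R <= (E * (3 * m * W))%:R :> F)%R by rewrite ler_nat.
have r5 : ((E * (3 * m * W))%:R + (E * (3 * m * (y * W)))%:R <=
    (E * (3 * m * ((h - k) * W)))%:R :> F)%R by rewrite -natrD ler_nat.
have r2 : ((K * (mid * (L * (8 * m))))%:R <= eps * (K * (L * A + members IN))%:R :> F)%R.
  rewrite (natrM _ K) (natrM _ K (L * A + _)) mulrCA ler_wpM2l ?ler0n //.
  by rewrite (mulnC L A).
have r4 : (eps * (K * (L * A + members IN))%:R +
    eps * (K * (L * s toplevel + y * s members))%:R <=
    eps * (K * (L * toplevel IN + (h - k) * members IN))%:R)%R.
  by rewrite -mulrDr ler_wpM2l // -natrD ler_nat -mulnDr leq_mul2l l4 orbT.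
move: IHs r2 r3 r4 r5.
set a1 := (K * E * X)%:R%R; set a2 := (K * _)%:R%R; set a3 := (_ * s unplaced)%:R%R.
set b1 := (eps * _)%R; set b2 := (eps * _)%R; set b3 := (eps * _)%R.
set c1 := (_ * (_ * (y * W)))%:R%R; set c2 := (E * (3 * m * W))%:R%R.
set c3 := (_ * (_ * (_ * W)))%:R%R.
lra.
Qed.

(** By packing n <= m T. Divided by 8 m L K, the two terms of [tree_loss] are at most eps T / 4
    each: the first as 2 L m T / (8 m L) = T / 4, the second as 3 m (L - k) / K <= eps / 4. *)
Lemma root_loss IN : live (fun=> 0) -> T <= K ^ L -> 0 < L ->
  (forall j, j < n -> 0 < IN j) ->
  (forall j, j < n -> out n (fun=> 0) IN 0 L j = (G j, R j, D j)) ->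
  ((12 * m * (L - k))%:R <= eps * K%:R :> F)%R ->
  ((cnt n (fun j => S j == 0))%:R <= eps * T%:R :> F)%R.
Proof.
move=> live0 TK L0 INn outE h12.
have cx : context n (fun=> 0) IN 0 L.
  by split=> [|||i u il _ _ _]; [exact: root_valid|lia|move=> j jn _; exact: outE|exact: INn].
have := tree_loss cx; rewrite subn0 (minn_idPr TK).
have -> : unplaced IN = cnt n (fun j => S j == 0).
  by apply: cnt_eq => j jn; rewrite INn.
set u := cnt n _ => h.
have nT : n <= m * T.
  rewrite -[leqLHS](cntT n) -[T in m * T]subn0.
  apply: leq_trans (packing live0 (leq0n T)); apply: cnt_le => i il _.
  by have [? ? ?] := win live0 il; lia.
have h1 : L * toplevel IN + (L - k) * members IN <= 2 * (L * (m * T)).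
  have a1 : L * toplevel IN <= L * (m * T).
    by rewrite leq_mul2l (leq_trans (cnt_max _ _) nT) orbT.
  have a2 : (L - k) * members IN <= L * (m * T).
    by apply: leq_mul; [exact: leq_subr|exact: leq_trans (cnt_max _ _) nT].
  by lia.
have c0 : (0 < (K * (8 * m * L))%:R :> F)%R by rewrite ltr0n !muln_gt0 m0 L0; lia.
rewrite -(ler_pM2l c0) -natrM; apply: le_trans h _.
have b1 : (eps * (K * (L * toplevel IN + (L - k) * members IN))%:R <=
    eps * (K * (2 * (L * (m * T))))%:R :> F)%R.
  by rewrite ler_wpM2l ?(ltW eps0) // ler_nat leq_mul2l h1 orbT.
have b2 : ((8 * m * L * (3 * m * ((L - k) * T)))%:R <=
    eps * (K * (2 * (L * (m * T))))%:R :> F)%R.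
  have -> : 8 * m * L * (3 * m * ((L - k) * T)) = 12 * m * (L - k) * (2 * (L * (m * T))).
    by lia.
  rewrite natrM (natrM _ K) mulrA ler_wpM2r //.
apply: le_trans (lerD b1 b2) _.
rewrite -mulrDr -natrD mulrCA ler_wpM2l ?(ltW eps0) // -natrM ler_nat.
by rewrite -!mulnA -mulnDr leq_mul2l; apply/orP; right; lia.
Qed.

End Tree.

(** * Insertion and list scheduling *)

Section Insertion.
Local Open Scope nat_scope.
Variables (n m : nat) (P : nat -> nat -> bool).
Implicit Types (S : nat -> nat) (tau : nat).

Definition bump_after tau S :=
  foldl (fun S i => if tau < S i then upd1 S i (S i + 1) else S) S (iota 0 n).

Definition insert S j :=
  if S j == 0
  then upd1 (bump_after (maxof n (fun i => P i j) S) S) j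
         (maxof n (fun i => P i j) S + 1)
  else S.

Definition insert_all S := foldl insert S (iota 0 n).

Lemma bump_afterE tau S i :
  bump_after tau S i = if (i < n) && (tau < S i) then (S i).+1 else S i.
Proof.
pose I k S' := forall i, S' i = if (i < k) && (tau < S i) then (S i).+1 else S i.
suff h : I n (bump_after tau S) by exact: h.
apply: foldl_inv => [//|k S' kn Ik] l.
have -> : S' k = S k by rewrite Ik ltnn.
case: ifP => tk; last first.
  by rewrite Ik ltnS [l <= k]leq_eqVlt; case: (eqVneq l k) => [->|_] /=; rewrite ?tk ?andbF.
rewrite /upd1; case: (eqVneq l k) => [->|lk]; first by rewrite ltnSn tk addn1.
by rewrite Ik ltnS [l <= k]leq_eqVlt (negbTE lk).
Qed.

Hypotheses (Pirr : forall i, ~~ P i i) (m0 : 0 < m).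
Hypothesis Ptrans : forall i j k, P i j -> P j k -> P i k.

(** The shift empties slot tau + 1, so j sits there alone. By transitivity the placed successors of
    j come after all its placed predecessors, hence after tau. *)
Lemma insert_feasible S j : j < n -> pfeasible n m P S -> pfeasible n m P (insert S j).
Proof.
move=> jn [fp fc]; rewrite /insert; case: eqP => // Sj.
set tau := maxof _ _ _.
have tauP i : i < n -> P i j -> S i <= tau by move=> il Pij; exact: maxof_le.
have tauS k : k < n -> P j k -> 0 < S k -> tau < S k.
  move=> kn Pjk Sk; case: (posnP tau) => [-> //|/maxofP[i [il Pij e]]].
  rewrite -/tau in e; rewrite e; case: (posnP (S i)) => [-> //|Si].
  by apply: fp => //; exact: Ptrans Pjk.
split=> [i k il kn Pik|t t0].
  rewrite /upd1; case: (eqVneq i j) => ij; case: (eqVneq k j) => kj;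
    rewrite ?bump_afterE ?il ?kn /=.
  - by move: Pik; rewrite ij kj (negbTE (Pirr j)).
  - move=> _; case: (ltnP tau (S k)) => h h2; first by lia.
    by rewrite ij in Pik; have := tauS k kn Pik h2; lia.
  - by rewrite kj in Pik; have := tauP i il Pik; case: (ltnP tau (S i)); lia.
  - by have := fp i k il kn Pik; case: (ltnP tau (S i)); case: (ltnP tau (S k)); lia.
case: (ltngtP t tau.+1) => ht.
- apply: leq_trans (fc t t0); apply: cnt_le => i il; rewrite /upd1.
  by case: (eqVneq i j) => _; rewrite ?bump_afterE ?il /=; [lia|case: (ltnP tau (S i)); lia].
- apply: leq_trans (fc t.-1 _); last by lia.
  apply: cnt_le => i il; rewrite /upd1.
  by case: (eqVneq i j) => _; rewrite ?bump_afterE ?il /=; [lia|case: (ltnP tau (S i)); lia].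
- apply: leq_trans m0; rewrite ht; apply: leq_trans (_ : _ <= cnt n (fun i => i == j)) _.
    apply: cnt_le => i il; rewrite /upd1; case: (eqVneq i j) => // _.
    by rewrite bump_afterE il /=; case: (ltnP tau (S i)); lia.
  by rewrite cnt_pred1.
Qed.

Lemma insert_allP S N : pfeasible n m P S -> (forall i, i < n -> S i <= N) ->
  pfeasible n m P (insert_all S) /\
  forall i, i < n -> 0 < insert_all S i <= N + cnt n (fun i => S i == 0).
Proof.
move=> fS SN.
pose I j S' := [/\ pfeasible n m P S',
  forall i, i < n -> S' i <= N + cnt j (fun i => S i == 0),
  forall i, i < j -> 0 < S' i & forall i, j <= i -> (S' i == 0) = (S i == 0)].
suff [h1 h2 h3 _] : I n (insert_all S) by split=> // i il; rewrite h3 // h2.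
apply: foldl_inv => [|j S' jn [h1 h2 h3 h4]].
  by split=> // i il; apply: leq_trans (SN i il) (leq_addr _ _).
have hz i : (insert S' j i == 0) = (i != j) && (S' i == 0).
  rewrite /insert; case: (eqVneq (S' j) 0) => Sj; last first.
    by case: (eqVneq i j) => [->|] //; rewrite (negbTE Sj).
  rewrite /upd1; case: (eqVneq i j) => _ /=; first by rewrite addn1.
  by rewrite bump_afterE; case: ifP => // /andP[_]; case: (S' i).
split.
- exact: insert_feasible.
- move=> i il; rewrite cntS -h4 // /insert; case: (eqVneq (S' j) 0) => Sj /=; last first.
    by rewrite addn0; exact: h2.
  rewrite /upd1; case: (eqVneq i j) => _.
    rewrite addnA leq_add2r; apply: maxof_leq => l ll _; exact: h2.
  by rewrite bump_afterE il /=; have := h2 i il; case: (_ < _); lia.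
- move=> i; rewrite lt0n hz ltnS leq_eqVlt negb_and negbK => /orP[->//|ij].
  by rewrite -lt0n h3 ?orbT.
- by move=> i ji; rewrite hz h4 ?(ltnW ji) //; move: ji; case: ltngtP.
Qed.

End Insertion.

(** * List scheduling within 2 T *)

Section ListScheduling.
Local Open Scope nat_scope.
Variables (n m T : nat) (P : nat -> nat -> bool) (r G R D S : nat -> nat).
Hypotheses (Pirr : forall i, ~~ P i i) (n1 : 1 < n) (m0 : 0 < m).
Hypothesis Ptrans : forall i j k, P i j -> P j k -> P i k.
Hypothesis Sspec : greedy_spec n m P G R D S.
Hypothesis tables : forall j, j < n -> [/\ G j = 1, R j = 0 & D j = n.-1].
Hypothesis r1 : forall j, j < n -> 0 < r j <= T.
Hypothesis rP : forall i j, i < n -> j < n -> P i j -> r i < r j.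
Hypotheses (nT : n <= m * T) (Tn : 2 * T < n).

(** If i were still pending after 2 T slots, the non-full ones among them would form a chain along
    which r decreases, hence number at most r i - 1 < T; the full ones hold at most n <= m T jobs.
    That is fewer than 2 T slots. *)
Lemma list_schedule j : j < n -> 0 < S j <= 2 * T.
Proof.
have key i : i < n -> (S i == 0) || (2 * T < S i) -> False.
  move=> il Si.
  have h : \sum_(1 <= u < (0 + 2 * T).+1) nonfull n m G D S 1 n.-1 u <= (r i).-1.
    apply: (@nonfull_chain n m P G R D S Sspec
      (fun j => j < n) (fun j => (r j).-1)) => //; last by have [_ _ ->] := tables il; lia.
      by move=> l ll; have [-> -> ->] := tables ll; split=> //; lia.
    move=> l k ll kn Plk _ _; split=> //.
    by have := rP ll kn Plk; have := r1 ll; lia.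
  have h2 : m * (2 * T) <= n + m * (r i).-1.
    apply: (@leq_trans (cnt n (fun i => true && (1 <= S i < (2 * T).+1)) + m *
      \sum_(1 <= u < (2 * T).+1) nonfull n m G D S 1 n.-1 u)); last first.
      by rewrite leq_add ?cnt_max // leq_mul2l h orbT.
    rewrite -sum_cnt big_distrr -big_split /=.
    have -> : m * (2 * T) = \sum_(1 <= u < (2 * T).+1) m.
      by rewrite sum_nat_const_nat subSS subn0 mulnC.
    apply: leq_sum => u _; rewrite /nonfull.
    case: (boolP (m <= cnt n _)) => h1 /=; last by rewrite muln1 leq_addl.
    rewrite muln0 addn0; apply: leq_trans h1 _; apply: cnt_le => l _ /andP[//].
  have := r1 il => r1i.
  have h3 : m + m * (r i).-1 <= m * T by rewrite -mulnS leq_mul2l; lia.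
  by move: nT h2 h3; rewrite mulnCA; lia.
move=> jn; case: (posnP (S j)) => Sj; first by case: (key j jn); rewrite Sj.
by rewrite /= leqNgt; apply/negP => h; apply: (key j jn); rewrite h orbT.
Qed.

End ListScheduling.

(** * Windows of the hierarchy *)

Section LPWindows.
Variables (R : realType) (J : finType) (prec : rel J) (m T r : nat) (eps : R).
Variable x : passign J T -> lpvec R J T.
Hypothesis xSA : SA (lpK prec m T) r x.
Notation n := #|J|.
Notation inp := (@Input R J prec m T eps r x).
Notation sup := (suppq inp).
Notation P := (prec_num inp).
Notation rw := (rw n sup).
Notation dw := (dw n sup).
Hypothesis Tn : (T < n)%N.
Hypothesis pirr : irreflexive prec.
Hypothesis ptrans : transitive prec.
Implicit Types (f : nat -> nat) (v : lpvec R J T).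

Lemma map_job_num : map (@job_num J) (enum J) = iota 0 n.
Proof.
apply: (@eq_from_nth _ 0%N); rewrite size_map -cardE ?size_iota // => i il.
rewrite nth_iota // add0n; have [j0] : exists j0 : J, true.
  by move: il => /(leq_ltn_trans (leq0n i))/card_gt0P[j]; exists j.
by rewrite (nth_map j0) -?cardE // /job_num index_uniq -?cardE ?enum_uniq.
Qed.

Lemma cnt_card (p : nat -> bool) : cnt n p = #|[set j : J | p (job_num j)]%SET|.
Proof.
rewrite /cnt sum1_count /index_iota subn0 -map_job_num count_map cardsE cardE.
by rewrite {2}/enum_mem size_filter -enumT.
Qed.

Lemma job_num_lt (j : J) : (job_num j < n)%N.
Proof. by rewrite /job_num cardE index_mem mem_enum. Qed.

Lemma job_ofK (j : J) : job_of J (job_num j) = Some j.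
Proof.
rewrite /job_of /job_num onthE (nth_map j) ?index_mem ?mem_enum //.
by rewrite nth_index ?mem_enum.
Qed.

Lemma job_numP i : (i < n)%N -> exists j : J, i = job_num j.
Proof.
rewrite -[(i < n)%N]/((0 <= i < 0 + n)%N) -mem_iota -map_job_num => /mapP[j _ ->].
by exists j.
Qed.

Lemma job_num_inj : injective (@job_num J).
Proof. by move=> i j e; have := job_ofK i; rewrite e job_ofK => -[]. Qed.

Lemma prec_numE i j : P (job_num i) (job_num j) = prec i j.
Proof. by rewrite /prec_num !job_ofK. Qed.

Lemma prec_num_irr i : ~~ P i i.
Proof. by rewrite /prec_num; case: job_of => // a; rewrite /= pirr. Qed.

Lemma prec_num_trans i j k : P i j -> P j k -> P i k.
Proof.
rewrite /prec_num /=; case: (job_of J i) => [a|]; last by [].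
case: (job_of J j) => [b|]; last by [].
by case: (job_of J k) => [c|] //; exact: ptrans.
Qed.

Definition sigma f : passign J T := [ffun j => slot_of T (f (job_num j))].

Lemma slot_of_S (t : 'I_T) : slot_of T t.+1 = Some t.
Proof. by rewrite /= insubT //= => lt; congr Some; apply: val_inj. Qed.

Lemma slot_ofP k t : slot_of T k = Some t -> k = t.+1.
Proof. by case: k => //= k; case: insubP => // u _ <- [->]. Qed.

Lemma supP f j k : reflect
  (exists2 t : 'I_T, k = t.+1 &
     (#|psupp (sigma f)| <= r)%N /\ 0 < coor (x (sigma f)) j t)
  (sup f (job_num j) k).
Proof.
rewrite /suppq /query -/(sigma f) /=; case: ifP => hr; last first.
  rewrite ltxx; apply: ReflectF => -[t _ [h _]].
  by move/negP: hr; apply.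
rewrite job_ofK; case e : (slot_of T k) => [t|]; last first.
  rewrite ltxx; apply: ReflectF => -[t kt _].
  by rewrite kt slot_of_S in e.
apply: (iffP idP) => [h|[t' kt [_ h]]]; first by exists t; [exact: slot_ofP|].
by move: e; rewrite kt slot_of_S => -[<-].
Qed.

(* The points of cone(K) of total mass c. *)
Definition massed (c : R) v := [/\ forall j, \sum_(t < T) coor v j t = c,
  forall t, \sum_(j : J) coor v j t <= c * m%:R,
  forall i j (t : 'I_T), prec i j ->
    \sum_(t' < T | (t' <= t)%N) coor v j t' <= \sum_(t' < T | (t' < t)%N) coor v i t'
  & forall j t, 0 <= coor v j t].

Lemma cone_massed (s : passign J T) v :
  cone (lpK prec m T `&` [set y | forall j t, s j = Some t -> coor y j t = 1])%classic v ->
  exists c, [/\ 0 <= c, massed c v & forall j t, s j = Some t -> coor v j t = c].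
Proof.
move=> [k [l [y [l0 yK ev]]]].
have vE j t : coor v j t = \sum_(i < k) l i * coor (y i) j t.
  rewrite /coor ev sum_ffunE; apply: eq_bigr => i _; by rewrite ffunE.
exists (\sum_(i < k) l i); split; first by apply: sumr_ge0.
  split.
  - move=> j; under eq_bigr do rewrite vE.
    rewrite exchange_big /=; apply: eq_bigr => i _; rewrite -mulr_sumr.
    by have [ [-> _ _ _] _] := yK i; rewrite mulr1.
  - move=> t; under eq_bigr do rewrite vE.
    rewrite exchange_big /= mulr_suml; apply: ler_sum => i _; rewrite -mulr_sumr.
    by have [ [_ h _ _] _] := yK i; rewrite ler_wpM2l ?l0 ?h.
  - move=> i j t ij; under eq_bigr do rewrite vE.
    rewrite exchange_big /=; under [leRHS]eq_bigr do rewrite vE.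
    rewrite [leRHS]exchange_big /=; apply: ler_sum => a _; rewrite -!mulr_sumr.
    by have [ [_ _ h _] _] := yK a; rewrite ler_wpM2l ?l0 ?h.
  - move=> j t; rewrite vE sumr_ge0 // => i _; rewrite mulr_ge0 //.
    by have [ [_ _ _ /(_ j t)/andP[h _]] _] := yK i.
move=> j t st; rewrite vE; apply: eq_bigr => i _.
by have [_ /(_ j t st) ->] := yK i; rewrite mulr1.
Qed.

(** Positive mass makes all windows nonempty. A value above T would count in [supp] but be ignored
    by [slot_of]. *)
Definition live f := [/\ (#|psupp (sigma f)| <= r)%N,
  forall i, (i < n)%N -> (f i <= T)%N &
  exists c, [/\ 0 < c, massed c (x (sigma f)) &
    forall j t, sigma f j = Some t -> coor (x (sigma f)) j t = c]].

Lemma massed_pos c v j : 0 < c -> massed c v -> exists t, 0 < coor v j t.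
Proof.
move=> c0 [hs _ _ v0]; apply/existsP; apply: contraT; rewrite negb_exists => /forallP h.
suff e : c = 0 by move: c0; rewrite e ltxx.
rewrite -(hs j) big1 // => t _; apply/eqP; rewrite eq_le v0 andbT leNgt.
exact: h.
Qed.

Lemma sum_pos (I : finType) (p : pred I) (F : I -> R) : (forall i, 0 <= F i) ->
  0 < \sum_(i | p i) F i -> exists2 i, p i & 0 < F i.
Proof.
move=> F0 s0; apply/exists_inP; apply: contraT.
rewrite negb_exists_in => /forall_inP h; move: s0; rewrite big1 ?ltxx // => i pi.
by apply/eqP; rewrite eq_le F0 andbT leNgt h.
Qed.

Lemma sup_range f i k : (i < n)%N -> sup f i k -> (0 < k <= T)%N.
Proof. by move=> /job_numP[j ->] /supP[t -> _]; rewrite ltn_ord. Qed.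

Lemma live_window f i : live f -> (i < n)%N ->
  [/\ sup f i (rw f i), sup f i (dw f i)
    & forall k, sup f i k -> (rw f i <= k <= dw f i)%N].
Proof.
move=> [hr _ [c [c0 cm _]]] il; have [j ej] := job_numP il.
have [t ht] := massed_pos j c0 cm.
have st : sup f i t.+1 by rewrite ej; apply/supP; exists t.
exact: (window_ends Tn (fun k => @sup_range f i k il) st).
Qed.

Lemma window_sub f f' i : live f -> live f' -> (i < n)%N ->
  (forall k, sup f' i k -> sup f i k) -> (rw f i <= rw f' i)%N /\ (dw f' i <= dw f i)%N.
Proof.
move=> lf lf' il h; have [_ _ h1] := live_window lf il.
have [a b _] := live_window lf' il.
by have := h1 _ (h _ a); have := h1 _ (h _ b); split; lia.
Qed.

Lemma lpx_win f j : live f -> (j < n)%N ->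
  [/\ (0 < rw f j)%N, (rw f j <= dw f j)%N & (dw f j <= T)%N].
Proof.
move=> lf jn; have [h1 h2 h3] := live_window lf jn.
have := sup_range jn h1; have := sup_range jn h2; have := h3 _ h1; split; lia.
Qed.

(** When j first has mass, i has mass strictly earlier. When i has its last mass, at that time j
    cannot have received all of its own, since i had not done so before. *)
Lemma lpx_prec f i j : live f -> (i < n)%N -> (j < n)%N -> P i j ->
  (rw f i < rw f j)%N /\ (dw f i < dw f j)%N.
Proof.
move=> lf il jl Pij; have [_ dwi hi] := live_window lf il.
have [rwj _ hj] := live_window lf jl.
move: il jl Pij dwi rwj hi hj => /job_numP[a ->] /job_numP[b ->]; rewrite prec_numE => ab.
move=> /supP[ti eti [hr posi]] /supP[tj etj [_ posj]] hi hj.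
have [_ _ [c [c0 [hs _ hp v0] _]]] := lf.
split.
  have h : 0 < \sum_(t' < T | (t' < tj)%N) coor (x (sigma f)) a t'.
    apply: lt_le_trans (hp _ _ tj ab); rewrite (bigD1 tj) //=.
    by apply: ltr_wpDr => //; apply: sumr_ge0.
  have [t tt ht] := sum_pos (v0 a) h.
  have st : sup f (job_num a) t.+1 by apply/supP; exists t.
  by have := hi _ st; rewrite etj; lia.
have h : 0 < \sum_(t' < T | ~~ (t' <= ti)%N) coor (x (sigma f)) b t'.
  have := hs b; rewrite (bigID (fun t' : 'I_T => (t' <= ti)%N)) /=.
  have := hp _ _ ti ab; have := hs a.
  rewrite (bigID (fun t' : 'I_T => (t' < ti)%N)) /= => ea hab.
  have : 0 < \sum_(t' < T | ~~ (t' < ti)%N) coor (x (sigma f)) a t'.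
    rewrite (bigD1 ti) ?ltnn //=; apply: ltr_wpDr => //; exact: sumr_ge0.
  set u := \sum_(t' < T | ~~ (t' <= ti)%N) _; lra.
have [t tt ht] := sum_pos (v0 b) h.
have st : sup f (job_num b) t.+1 by apply/supP; exists t.
by have := hj _ st; rewrite eti; lia.
Qed.

Lemma card_slots a b : (#|[set t : 'I_T | a <= t < b]%SET| <= b - a)%N.
Proof.
rewrite cardE -(size_map val) -(size_iota a (b - a)); apply: uniq_leq_size.
  by rewrite map_inj_uniq ?enum_uniq //; exact: val_inj.
move=> k /mapP[t]; rewrite mem_enum inE => h ->.
by rewrite mem_iota -[val t]/(nat_of_ord t); lia.
Qed.

(** Each of these jobs puts its whole mass c into b - a slots, and a slot takes at most c m. *)
Lemma lpx_packing f a b : live f -> (a <= b)%N ->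
  (cnt n (fun j => (a < rw f j) && (dw f j <= b)) <= m * (b - a))%N.
Proof.
move=> lf ab; rewrite cnt_card; set A := [set j | _]%SET.
have [hr _ [c [c0 [hs hm hp v0] _]]] := lf.
rewrite -(ler_nat R) -(ler_pM2l c0) mulr_natr -sumr_const.
have e j : j \in A -> c = \sum_(t < T | (a <= t < b)%N) coor (x (sigma f)) j t.
  rewrite inE => /andP[ra db]; rewrite -(hs j) [LHS](bigID (fun t : 'I_T => (a <= t < b)%N)) /=.
  rewrite [X in _ + X]big1 ?addr0 // => t nt; apply/eqP; rewrite eq_le v0 andbT leNgt.
  apply/negP => h; have st : sup f (job_num j) t.+1 by apply/supP; exists t.
  have [_ _ /(_ _ st)] := live_window lf (job_num_lt j); lia.
rewrite (eq_bigr _ e) exchange_big /=.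
apply: le_trans (_ : _ <= \sum_(t < T | (a <= t < b)%N) c * m%:R) _.
  apply: ler_sum => t _; apply: le_trans (hm t).
  by rewrite [leRHS](bigID (fun j => j \in A)) /= lerDl sumr_ge0.
rewrite sumr_const -[leLHS]mulr_natr -[leLHS]mulrA ler_pM2l // natrM ler_wpM2l // ler_nat.
apply: leq_trans (card_slots a b); rewrite cardsE; exact: leqnn.
Qed.

Lemma lpx_fixed f j : live f -> (j < n)%N -> f j != 0%N ->
  rw f j = f j /\ dw f j = f j.
Proof.
move=> lf jn fj; have [h1 h2 _] := live_window lf jn.
have [hr fT [c [c0 [hs _ _ v0] hc]]] := lf.
suff h k : sup f j k -> k = f j by split; apply: h.
have fjT := fT j jn; have [a ea] := job_numP jn; rewrite ea in fj fjT *.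
have tl : ((f (job_num a)).-1 < T)%N by lia.
pose t := Ordinal tl; have et : f (job_num a) = t.+1 by rewrite /=; lia.
have st : sigma f a = Some t by rewrite ffunE et slot_of_S.
move=> /supP[t' -> [_ pos]]; rewrite et; congr (_.+1).
have := hs a; rewrite (bigD1 t) //= (hc _ _ st) => e0.
apply/eqP; apply: contraT => tt'; move: e0; rewrite (bigD1 t') //= => e0.
have : 0 <= \sum_(i < T | (i != t) && (i != t')) coor (x (sigma f)) a i by exact: sumr_ge0.
by set u := \sum_(i < T | _) _ in e0 *; lra.
Qed.

Lemma sigma_upd f a (t : 'I_T) : sigma (upd1 f (job_num a) t.+1) = pext (sigma f) a t.
Proof.
apply/ffunP => j; rewrite !ffunE /upd1; case: (eqVneq j a) => [->|ja].
  by rewrite eqxx slot_of_S.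
by rewrite (inj_eq job_num_inj) (negbTE ja).
Qed.

Lemma sigma_supp f : (forall i, (i < n)%N -> (f i <= T)%N) ->
  #|psupp (sigma f)| = supp n f.
Proof.
move=> fT; rewrite /supp cnt_card; congr #|pred_of_set _|; apply/setP => j.
rewrite !inE ffunE; have := fT _ (job_num_lt j).
by case: (f (job_num j)) => //= k kT; rewrite insubT.
Qed.

(** x^sigma is the sum of its extensions by j, all nonnegative, so windows shrink. Only the
    extension by t gives j weight at t; its mass is thus the weight of j at t in x^sigma, positive
    as t is an end of the window. *)
Lemma lpx_condition f j : live f -> (j < n)%N -> f j = 0%N -> (supp n f < r)%N ->
  live (upd1 f j (rw f j)) /\ (forall i, (i < n)%N ->
    (rw f i <= rw (upd1 f j (rw f j)) i)%N /\ (dw (upd1 f j (rw f j)) i <= dw f i)%N).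
Proof.
move=> lf jn fj sr; have [hrw _ _] := live_window lf jn.
have [hr fT [c [c0 [hs hm hp v0] hc]]] := lf.
have [a ea] := job_numP jn; rewrite {j jn}ea in fj hrw *.
move: hrw => /supP[t et [_ pos]]; rewrite et.
have aN : a \notin psupp (sigma f) by rewrite inE ffunE fj eqxx.
have sl : (#|psupp (sigma f)| < r)%N by rewrite sigma_supp.
have [hI hII _] := xSA; have eI := hI _ _ sl aN.
have sle s : (#|psupp (pext (sigma f) a s)| <= r)%N.
  rewrite -sigma_upd sigma_supp => [|i il].
    rewrite /supp (cnt_upd1 (p := fun s => s != 0%N)) ?fj //; exact: job_num_lt.
  by rewrite /upd1; case: ifP => // _; exact: fT.
have mass s : exists c', [/\ 0 <= c', massed c' (x (pext (sigma f) a s))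
    & forall j t', pext (sigma f) a s j = Some t' -> coor (x (pext (sigma f) a s)) j t' = c'].
  by apply: cone_massed; exact: hII.
have vI j t' : coor (x (sigma f)) j t' = \sum_(s < T) coor (x (pext (sigma f) a s)) j t'.
  by rewrite {1}/coor eI sum_ffunE.
have xs0 s j t' : 0 <= coor (x (pext (sigma f) a s)) j t'.
  by have [c' [_ [_ _ _ h] _]] := mass s.
have off s t' : s != t' -> coor (x (pext (sigma f) a s)) a t' = 0.
  have [c' [c'0 [h1 _ _ h4] h5]] := mass s; move=> st'.
  have e1 : coor (x (pext (sigma f) a s)) a s = c' by apply: h5; rewrite ffunE eqxx.
  have := h1 a; rewrite (bigD1 s) //= e1 (bigD1 t') 1?eq_sym //= => e2.
  have : 0 <= \sum_(i < T | (i != s) && (i != t')) coor (x (pext (sigma f) a s)) a i by exact: sumr_ge0.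
  have := h4 a t'; set u := \sum_(i < T | _) _ in e2 *; lra.
have lf' : live (upd1 f (job_num a) t.+1).
  split; [by rewrite sigma_upd|by move=> i il; rewrite /upd1; case: ifP => // _; exact: fT|].
  rewrite sigma_upd; have [c' [c'0 hc' hs']] := mass t; exists c'; split=> //.
  rewrite lt_neqAle c'0 andbT eq_sym; apply: contraTneq pos => e0.
  rewrite -leNgt vI (bigD1 t) //= big1 => [|s st]; last exact: off.
  by rewrite addr0 (hs' a t) ?e0 // ffunE eqxx.
split=> // i il; apply: window_sub => // k.
have [b ->] := job_numP il; move=> /supP[t' -> [_ pos']]; apply/supP; exists t' => //.
split=> //; rewrite vI (bigD1 t) //= -sigma_upd; apply: ltr_wpDr => //.
exact: sumr_ge0.
Qed.

Lemma lpx_empty : live (fun=> 0%N).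
Proof.
have e : sigma (fun=> 0%N) = pempty J T by apply/ffunP => j; rewrite !ffunE.
have s0 : #|psupp (sigma (fun=> 0%N))| = 0%N.
  by rewrite e; apply/eqP; rewrite cards_eq0; apply/eqP/setP => j; rewrite !inE ffunE.
have [_ _] := xSA; rewrite -e => -[h1 h2 h3 h4].
split; [by rewrite s0|by []|exists 1; split=> //].
  split=> //; first by move=> t; rewrite mul1r.
  by move=> j t; have /andP[] := h4 j t.
by move=> j t; rewrite e ffunE.
Qed.

End LPWindows.

(** * The program *)

Section Algorithm.
Local Open Scope nat_scope.

(* aF holds the partial assignment, aPW the powers of K, aS the schedule, and
   aG, aR, aD the table of triples.  On the way of a job down the recursion,
   aIN marks the members of the current interval, aST and aH are its start and
   height, and aACT is 0 once the triple of the job is known. *)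
Notation sc a := (XLoad a (XCst 0)).
Notation aOUT := 0.
Notation aF := 1.
Notation aPW := 2.
Notation aS := 3.
Notation aG := 4.
Notation aR := 5.
Notation aD := 6.
Notation aIN := 7.
Notation aST := 8.
Notation aH := 9.
Notation aACT := 10.
Notation aBJ := 11.
Notation aII := 12.
Notation aTAU := 13.
Notation aDONE := 14.
Notation vK := (XVar 0).
Notation vk := (XVar 1).
Notation vL := (XVar 2).
Notation vj := (XVar 3).

Definition xpos e := XLt (XCst 0) e.
Definition xS e := XAdd (XCst 1) e.
Definition xcnt b := XBig false b (XCst 1).
(* l is the level of the next free binder. *)
Definition xmul l a b := XBig false (XLt (XVar l) a) b.
Definition xrw l j := XSub XJobs (XBig true (XPos j (XSub XJobs (XVar l))) (XVar l)).
Definition xdw l j := XBig true (XPos j (XVar l)) (XVar l).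
Definition xcrs l y j := XAnd (XNot (XLt y (xrw l j))) (XLt y (xdw l j)).
Definition xgrid l c B := XAdd (sc aST) (xmul l c B).
Definition xin j := xpos (XLoad aIN j).
Definition xpw e := XLoad aPW e.

Definition xbad l j c :=
  XAnd (xcrs l (xgrid l c (xpw (XSub (sc aH) vk))) j)
    (XNot (XAnd (XLt vk (sc aH))
      (XLt (xcnt (XAnd (XPrec (XVar l) j) (XAnd (xin (XVar l))
              (xcrs l.+1 (xgrid l.+1 c (xpw (XSub (sc aH) vk))) (XVar l)))))
         (xpw (XSub (sc aH) (xS vk)))))).

Definition xbadjob l := XBig true (XAnd (xin (XVar l))
    (xpos (xcnt (xbad l.+2 (XVar l) (XVar l.+1))))) (xS (XVar l)).

Definition xcross l B j := xpos (xcnt (xcrs l.+1 (xgrid l.+1 (XVar l) B) j)).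

Definition xm8 := XAdd (XAdd (XAdd XMach XMach) (XAdd XMach XMach))
                       (XAdd (XAdd XMach XMach) (XAdd XMach XMach)).

Definition xcrit l i := XEps
  (XBig false (XAnd (xin (XVar l))
      (XAnd (xcross l.+1 (xpw (XSub (sc aH) (xS i))) (XVar l))
        (XNot (xcross l.+1 (xpw (XSub (sc aH) i)) (XVar l))))) (xmul l.+1 vL xm8))
  (XAdd (XBig false (XAnd (xin (XVar l)) (xcross l.+1 (xpw (XSub (sc aH) i)) (XVar l))) vL)
     (xcnt (xin (XVar l)))).

Definition xsel l := XBig true (XAnd (XLt (XVar l) vk)
  (XAnd (XLt (XVar l) (sc aH)) (xcrit l.+1 (XVar l)))) (XVar l).

Definition xcell l B e := XAdd (sc aST)
  (XBig true (XLt (xgrid l.+1 (XVar l) B) e) (xmul l.+1 (XVar l) B)).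

Definition sset a e := SSet a (XCst 0) e.

Definition s_leaf := SSeq (SSet aG vj (XCst 1)) (SSeq (SSet aR vj (sc aST))
  (SSeq (SSet aD vj (XAdd (sc aST) (XCst 1))) (sset aACT (XCst 0)))).

Definition s_cond := SFor (SSeq (sset aBJ (xbadjob 6)) (SIf (xpos (sc aBJ))
  (SSet aF (XSub (sc aBJ) (XCst 1)) (xrw 6 (XSub (sc aBJ) (XCst 1)))))).

Definition xB := xpw (XSub (sc aH) (xS (sc aII))).

Definition s_top := SSeq (SSet aG vj (XAdd (sc aH) (XCst 1)))
  (SSeq (SSet aR vj (XAdd (xcell 5 xB (xrw 6 vj)) xB))
    (SSeq (SSet aD vj (xcell 5 xB (xdw 6 vj))) (sset aACT (XCst 0)))).

Definition s_restrict := SFor (SIf (XNot (XAnd (XLt (sc aST) (xrw 6 (XVar 5)))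
  (XNot (XLt (XAdd (sc aST) (xpw (sc aH))) (xdw 6 (XVar 5))))))
  (SSet aIN (XVar 5) (XCst 0))).

Definition s_down := SSeq (sset aST (xcell 5 xB (xrw 6 vj)))
  (SSeq (sset aH (XSub (sc aH) (xS (sc aII)))) s_restrict).

(** There is no else: each later case tests [aACT], because an earlier one may have finished the
    job. *)
Definition s_node := SSeq s_cond (SSeq (sset aII (xsel 5))
  (SSeq (SIf (xcross 5 (xpw (XSub (sc aH) (sc aII))) vj) s_top)
    (SSeq (SIf (XAnd (xpos (sc aACT)) (xcross 5 xB vj)) (sset aACT (XCst 0)))
       (SIf (xpos (sc aACT)) s_down)))).

Definition s_step := SSeq
  (SIf (XAnd (xpos (sc aACT)) (XEq (sc aH) (XCst 0))) s_leaf)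
  (SIf (XAnd (xpos (sc aACT)) (XNot (XEq (sc aH) (XCst 0)))) s_node).

Definition s_path := SSeq
  (SFor (SSeq (SSet aF (XVar 4) (XCst 0)) (SSet aIN (XVar 4) (XCst 1))))
  (SSeq (sset aST (XCst 0)) (SSeq (sset aH vL) (SSeq (sset aACT (XCst 1)) (SFor s_step)))).

Definition s_powers := SSeq (sset aPW (XCst 1))
  (SFor (SSet aPW (xS vj) (xmul 4 vK (xpw vj)))).

Definition s_reset := SFor (SSeq (SSet aG vj (XCst 0)) (SSeq (SSet aR vj (XCst 0))
  (SSeq (SSet aD vj (XCst 0)) (SSet aS vj (XCst 0))))).

Definition s_tables := SSeq s_reset
  (SSeq (SIf (XEq vK (XCst 1)) (SFor (SSeq (SSet aG vj (XCst 1))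
          (SSet aD vj (XSub XJobs (XCst 1))))))
    (SIf (XLt (XCst 1) vK) (SSeq s_powers (SFor s_path)))).

Definition xnone b := XNot (xpos (xcnt b)).

Definition xplaceable (g t d j : nexp) :=
  let s := XLoad aS (XVar 7) in
  let c1 := XLt (xcnt (XEq s t)) XMach in
  let c2 := xnone (XAnd (XPrec (XVar 7) j) (XAnd (xpos s) (XNot (XLt s t)))) in
  let c3 := xnone (XAnd (XPrec (XVar 7) j) (XAnd (XEq s (XCst 0))
    (XAnd (XEq (XLoad aG (XVar 7)) g) (XNot (XLt (XLoad aD (XVar 7)) t))))) in
  let c4 := xnone (XAnd (XPrec j (XVar 7)) (XAnd (xpos s) (XNot (XLt t s)))) in
  XAnd (XEq (XLoad aG j) g) (XAnd (xpos g) (XAnd (XLt (XLoad aR j) t)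
    (XAnd (XNot (XLt d t)) (XAnd (XEq (XLoad aD j) d) (XAnd (XEq (XLoad aS j) (XCst 0))
      (XAnd c1 (XAnd c2 (XAnd c3 c4)))))))).

Definition s_greedy := SFor (SFor (SFor (SFor
  (SIf (xplaceable (XVar 3) (XVar 4) (XVar 5) (XVar 6)) (SSet aS (XVar 6) (XVar 4)))))).

Definition s_insert := SFor (SIf (XEq (XLoad aS vj) (XCst 0))
  (SSeq (sset aTAU (XBig true (XPrec (XVar 4) vj) (XLoad aS (XVar 4))))
    (SSeq (SFor (SIf (XLt (sc aTAU) (XLoad aS (XVar 4)))
                   (SSet aS (XVar 4) (XAdd (XLoad aS (XVar 4)) (XCst 1)))))
       (SSet aS vj (XAdd (sc aTAU) (XCst 1)))))).

Definition s_accept := SIf (XAnd (XEq (sc aDONE) (XCst 0))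
    (xnone (XNot (XEps (XSub (XLoad aS vj) XHor) XHor))))
  (SSeq (SFor (SSet aOUT vj (XLoad aS vj))) (sset aDONE (XCst 1))).

Definition s_main := SFor (SFor (SFor
  (SSeq s_tables (SSeq s_greedy (SSeq s_insert s_accept))))).

(** * Agreement of the programs with the functions of the combinatorial part *)

Section Run.
Context (R : realType) (inp : input R).
Notation n := #|in_job inp|.
Notation m := (in_m inp).
Notation P := (prec_num inp).
Notation sup := (suppq inp).
Notation le := (epsle inp).
Notation run := (run inp).
Implicit Types (U : nat -> nat -> nat) (env : seq nat).

Lemma upd_same U a i v : upd U a i v a = upd1 (U a) i v.
Proof. by apply/funext => i'; rewrite /upd eqxx. Qed.

Lemma foldl_sim (A B : Type) (I : A -> Prop) (phi : A -> B) F f z N : I z ->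
  (forall z i, i < N -> I z -> I (F z i) /\ phi (F z i) = f (phi z) i) ->
  I (foldl F z (iota 0 N)) /\ phi (foldl F z (iota 0 N)) = foldl f (phi z) (iota 0 N).
Proof.
move=> I0 hs; suff h k : k <= N -> I (foldl F z (iota 0 k)) /\
    phi (foldl F z (iota 0 k)) = foldl f (phi z) (iota 0 k) by exact: h.
elim: k => // k IH kN; have [Ik ek] := IH (ltnW kN).
by rewrite iota_rcons !foldl_rcons -ek; apply: hs.
Qed.

(** [I] keeps the arrays that the body reads, while [f] describes the one array of interest. *)
Lemma run_for_sim (I : (nat -> nat -> nat) -> Prop) env c a (f : (nat -> nat) -> nat -> nat -> nat) U :
  I U -> (forall U i, i < n -> I U -> I (run (rcons env i) U c) /\
    run (rcons env i) U c a = f (U a) i) ->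
  I (run env U (SFor c)) /\ run env U (SFor c) a = foldl f (U a) (iota 0 n).
Proof. by move=> IU h; apply: (foldl_sim (phi := fun U => U a) IU h). Qed.

Lemma run_greedy K k L U : run [:: K; k; L] U s_greedy aS =
  greedy n m P (U aG) (U aR) (U aD) (U aS).
Proof.
pose I U' := forall a, a \in [:: aG; aR; aD] -> U' a = U a.
have fr c env U' : I U' -> writes c = [:: aS] -> I (run env U' c).
  by move=> IU wc a aI; rewrite run_frame ?wc ?IU //; move: aI; rewrite !inE; lia.
have I0 : I U by [].
rewrite /s_greedy /greedy.
have sim env c (f : (nat -> nat) -> nat -> nat -> nat) U0 : writes c = [:: aS] -> I U0 ->
    (forall U i, i < n -> I U -> run (rcons env i) U c aS = f (U aS) i) ->
    run env U0 (SFor c) aS = foldl f (U0 aS) (iota 0 n).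
  move=> wc IU0 h; apply: (run_for_sim (I := I) _ _).2 => // U' i il IU'.
  by split; [exact: fr|exact: h].
apply: (sim) => // U1 g gn I1; apply: (sim) => // U2 t tn I2.
apply: (sim) => // U3 d dn I3; apply: (sim) => // U4 j jn I4.
rewrite /place -!I4 //.
(* Evaluating the program text is mere conversion; the other programs are treated likewise. *)
rewrite -[LHS]/((if placeable n m P (U4 aG) (U4 aR) (U4 aD) (U4 aS) g t d j
  then upd U4 aS j t else U4) aS).
by case: ifP => // _; rewrite upd_same.
Qed.

Lemma fill_if (c : nat -> bool) (v g : nat -> nat) N i :
  foldl (fun g i => if c i then upd1 g i (v i) else g) g (iota 0 N) i =
  if (i < N) && c i then v i else g i.
Proof.
elim: N => [|N IH] //; rewrite iota_rcons foldl_rcons.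
case: ifP => cN; rewrite ?/upd1 IH ltnS [i <= N]leq_eqVlt.
  by case: (eqVneq i N) => [->|] //=; rewrite cN.
by case: (eqVneq i N) => [->|] //=; rewrite cN andbF.
Qed.

Lemma fill (v g : nat -> nat) N i :
  foldl (fun g i => upd1 g i (v i)) g (iota 0 N) i = if i < N then v i else g i.
Proof. by have := fill_if xpredT v g N i; rewrite andbT. Qed.

Lemma run_insert K k L U : run [:: K; k; L] U s_insert aS = insert_all n P (U aS).
Proof.
apply: (run_for_sim (I := fun=> True) _ _).2 => // U1 j jn _; split=> //.
set tau := maxof n (fun i => P i j) (U1 aS).
pose U2 := upd U1 aTAU 0 tau.
set c := SFor (SIf (XLt (sc aTAU) (XLoad aS (XVar 4)))
  (SSet aS (XVar 4) (XAdd (XLoad aS (XVar 4)) (XCst 1)))).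
pose U3 := run [:: K; k; L; j] U2 c.
rewrite -[LHS]/((if U1 aS j == 0 then upd U3 aS j (U3 aTAU 0 + 1) else U1) aS).
rewrite /insert; case: eqP => // _; rewrite upd_same.
have [-> ->] // : U3 aTAU 0 = tau /\ U3 aS = bump_after n tau (U1 aS).
apply: (run_for_sim (I := fun U => U aTAU 0 = tau)) => // U4 i il t4; split.
  by rewrite run_frame.
rewrite -[LHS]/((if U4 aTAU 0 < U4 aS i then upd U4 aS i (U4 aS i + 1) else U4) aS) t4.
by case: ifP => // _; rewrite upd_same.
Qed.

(** With truncated subtraction, a makespan of at most (1 + eps) T becomes a comparison of a natural
    number with eps T. *)
Definition accepted (S : nat -> nat) :=
  ~~ (0 < cnt n (fun j => ~~ le (S j - in_T inp) (in_T inp))).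

Lemma run_accept K k L U : run [:: K; k; L] U s_accept =
  if (U aDONE 0 == 0) && accepted (U aS) then run [:: K; k; L] U
    (SSeq (SFor (SSet aOUT vj (XLoad aS vj))) (sset aDONE (XCst 1))) else U.
Proof. by []. Qed.

Lemma run_output K k L U : let U' := run [:: K; k; L] U
    (SSeq (SFor (SSet aOUT vj (XLoad aS vj))) (sset aDONE (XCst 1))) in
  U' aDONE 0 = 1 /\ forall j, j < n -> U' aOUT j = U aS j.
Proof.
move=> U'; split=> // j jn.
rewrite -[LHS]/(run [:: K; k; L] U (SFor (SSet aOUT vj (XLoad aS vj))) aOUT j).
have hs U1 i : i < n -> U1 aS = U aS ->
    run [:: K; k; L; i] U1 (SSet aOUT vj (XLoad aS vj)) aS = U aS /\
    run [:: K; k; L; i] U1 (SSet aOUT vj (XLoad aS vj)) aOUT = upd1 (U1 aOUT) i (U aS i).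
  move=> il e; split; first by rewrite run_frame.
  by rewrite -[LHS]/(upd U1 aOUT i (U1 aS i) aOUT) upd_same e.
have [_ ->] := run_for_sim (env := [:: K; k; L]) (I := fun U' => U' aS = U aS)
  (f := fun g i => upd1 g i (U aS i)) erefl hs.
by rewrite fill jn.
Qed.

Section Node.
Variables (K k L j it : nat) (U : nat -> nat -> nat).
Notation env := [:: K; k; L; j; it].
Notation pw := (U aPW).
Notation out := (out n m P le sup pw k L).
(** Loops reach job numbers only; vanishing beyond them lets arrays be equal, as functions, to those
    of the recursion. *)
Definition zero (g : nat -> nat) := forall i, n <= i -> g i = 0.
Hypotheses (jn : j < n) (zF : zero (U aF)) (zI : zero (U aIN)).

Lemma run_cond : run env U s_cond aF =
  cond n P sup pw k (U aIN) (U aST 0) (U aH 0) (U aF).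
Proof.
pose I U' := [/\ U' aPW = U aPW, U' aIN = U aIN, U' aST = U aST & U' aH = U aH].
apply: (run_for_sim (I := I) _ _).2 => // U1 i il [e1 e2 e3 e4].
split; first by split; rewrite run_frame.
rewrite /cstep -e1 -e2 -e3 -e4; set b := badjob _ _ _ _ _ _ _ _ _.
pose U2 := upd U1 aBJ 0 b.
rewrite -[LHS]/((if 0 < b then upd U2 aF (b - 1) (rw n sup (U2 aF) (b - 1)) else U2) aF).
by case: ifP => // _; rewrite upd_same.
Qed.

Lemma zero_cond : zero (run env U s_cond aF).
Proof.
rewrite run_cond; apply: (foldl_inv (I := fun _ g => zero g)) => // i g il zg a na.
rewrite /cstep /badjob; case: ifP => [/maxofP[b [bn _ ->]]|_]; last exact: zg.
by rewrite /upd1 subn1 /=; case: eqP => [e|_]; [move: na; rewrite e leqNgt bn|exact: zg].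
Qed.

(** One round unfolds [out] once: the triple is found, the job is dropped, or the arrays now
    describe the recursive call. *)
Inductive step_spec U' : Prop :=
| StepDone g r d of U' aACT 0 = 0 & U' aG = upd1 (U aG) j g & U' aR = upd1 (U aR) j r
    & U' aD = upd1 (U aD) j d
    & forall fuel, out fuel.+1 (U aF) (U aIN) (U aST 0) (U aH 0) j = (g, r, d)
| StepDrop of U' aACT 0 = 0 & U' aG = U aG & U' aR = U aR & U' aD = U aD
    & forall fuel, out fuel.+1 (U aF) (U aIN) (U aST 0) (U aH 0) j = (0, 0, 0)
| StepDown of U' aACT 0 = U aACT 0 & U' aG = U aG & U' aR = U aR & U' aD = U aD
    & forall fuel, out fuel.+1 (U aF) (U aIN) (U aST 0) (U aH 0) j =
        out fuel (U' aF) (U' aIN) (U' aST 0) (U' aH 0) j.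

Lemma run_step : 0 < U aACT 0 ->
  let U' := run env U s_step in [/\ step_spec U', zero (U' aF) & zero (U' aIN)].
Proof.
move=> act U'.
pose Ul := run env U s_leaf.
have e0 : U' = if U aH 0 == 0 then Ul else run env U s_node.
  rewrite /U'; rewrite -[LHS]/((fun V => if (0 < V aACT 0) && ~~ (V aH 0 == 0)
    then run env V s_node else V)
    (if (0 < U aACT 0) && (U aH 0 == 0) then Ul else U)).
  have aUl : Ul aACT 0 = 0 by [].
  by rewrite act /=; case h: (U aH 0 == 0); rewrite ?aUl ?act ?h.
rewrite {}e0 {U'}; case: (eqVneq (U aH 0) 0) => h0.
  split; [ |by rewrite /Ul run_frame|by rewrite /Ul run_frame].
  apply: (@StepDone _ 1 (U aST 0) (U aST 0 + 1)).
  - by [].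
  - exact: (upd_same U aG j 1).
  - exact: (upd_same U aR j (U aST 0)).
  - exact: (upd_same U aD j (U aST 0 + 1)).
  - by move=> fuel /=; rewrite h0.
set U1 := run env U s_cond.
have f1 a : a \notin [:: aBJ; aF] -> U1 a = U a by move=> h; rewrite /U1 run_frame.
set ii := sel n m le sup pw k L (U1 aF) (U aIN) (U aST 0) (U aH 0).
pose U2 := upd U1 aII 0 ii.
have e2 : run env U1 (sset aII (xsel 5)) = U2.
  rewrite -[LHS]/(upd U1 aII 0 (sel n m le sup (U1 aPW) k L (U1 aF) (U1 aIN)
    (U1 aST 0) (U1 aH 0))).
  by rewrite /U2 /ii (f1 aPW) // (f1 aIN) // (f1 aST) // (f1 aH).
have f2 a : a \notin [:: aBJ; aF; aII] -> U2 a = U a.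
  rewrite !inE !negb_or => /and3P[h1 h2 h3].
  by rewrite /U2 upd_neq // f1 // !inE negb_or h1 h2.
have fF : U2 aF = U1 aF by [].
have eii : U2 aII 0 = ii by [].
set B := pw (U aH 0 - ii.+1).
set h' := U aH 0 - ii.+1.
set st := U aST 0.
set c1 := cross n sup (U1 aF) st (pw (U aH 0 - ii)) j.
set c2 := cross n sup (U1 aF) st B j.
pose U3 := if c1 then run env U2 s_top else U2.
have e3 : run env U2 (SIf (xcross 5 (xpw (XSub (sc aH) (sc aII))) vj) s_top) = U3.
  rewrite -[LHS]/(if cross n sup (U2 aF) (U2 aST 0) (U2 aPW (U2 aH 0 - U2 aII 0)) j
    then run env U2 s_top else U2).
  by rewrite fF eii !f2.
pose V4 V := if (0 < V aACT 0) && cross n sup (V aF) (V aST 0)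
  (V aPW (V aH 0 - (V aII 0).+1)) j then upd V aACT 0 0 else V.
pose V5 V := if 0 < V aACT 0 then run env V s_down else V.
have -> : run env U s_node = V5 (V4 U3).
  by rewrite -e3 -e2.
have outE fuel : out fuel.+1 (U aF) (U aIN) st (U aH 0) j =
  if c1 then (U aH 0 + 1, cell n st B (rw n sup (U1 aF) j) + B,
              cell n st B (dw n sup (U1 aF) j))
  else if c2 then (0, 0, 0) else
    out fuel (U1 aF) (restrict n sup (U1 aF) (cell n st B (rw n sup (U1 aF) j)) (pw h') (U aIN))
      (cell n st B (rw n sup (U1 aF) j)) h' j.
  by rewrite /= (negbTE h0) /c1 /c2 /B /ii /h' /ii /U1 run_cond.
have zF1 : zero (U1 aF) by exact: zero_cond.
rewrite /U3; case: ifP => hc1.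
  have a0 : run env U2 s_top aACT 0 = 0 by [].
  have -> : V4 (run env U2 s_top) = run env U2 s_top by rewrite /V4 a0.
  have -> : V5 (run env U2 s_top) = run env U2 s_top by rewrite /V5 a0.
  split; [|by rewrite run_frame|by rewrite run_frame // f2].
  apply: (@StepDone _ (U aH 0 + 1) (cell n st B (rw n sup (U1 aF) j) + B)
              (cell n st B (dw n sup (U1 aF) j))) => //.
  - rewrite -[LHS]/(upd U2 aG j (U2 aH 0 + 1) aG) upd_same f2 //.
    by rewrite f2.
  - pose V := upd U2 aG j (U2 aH 0 + 1).
    rewrite -[LHS]/(upd V aR j (cell n (V aST 0) (V aPW (V aH 0 - (V aII 0).+1))
      (rw n sup (V aF) j) + V aPW (V aH 0 - (V aII 0).+1)) aR) upd_same /V !upd_neq //.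
    by rewrite fF eii (f2 aR) // (f2 aST) // (f2 aPW) // (f2 aH).
  - pose V0 := upd U2 aG j (U2 aH 0 + 1).
    pose V := upd V0 aR j (cell n (V0 aST 0) (V0 aPW (V0 aH 0 - (V0 aII 0).+1))
      (rw n sup (V0 aF) j) + V0 aPW (V0 aH 0 - (V0 aII 0).+1)).
    rewrite -[LHS]/(upd V aD j (cell n (V aST 0) (V aPW (V aH 0 - (V aII 0).+1))
      (dw n sup (V aF) j)) aD) upd_same /V /V0 !upd_neq //.
    by rewrite fF eii (f2 aD) // (f2 aST) // (f2 aPW) // (f2 aH).
  - by move=> fuel; rewrite outE hc1.
rewrite /V4 fF eii !f2 // act /= -/B -/st -/c2; case: ifP => hc2.
  have -> : V5 (upd U2 aACT 0 0) = upd U2 aACT 0 0 by rewrite /V5 upd_eq.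
  split; [ |by rewrite upd_neq // fF|by rewrite upd_neq // f2].
  apply: StepDrop; rewrite ?upd_eq // ?upd_neq ?f2 //.
  by move=> fuel; rewrite outE hc1 hc2.
rewrite /V5 f2 // act.
set st' := cell n st B (rw n sup (U1 aF) j).
pose U6 := upd (upd U2 aST 0 st') aH 0 h'.
have -> : run env U2 s_down = run env U6 s_restrict.
  rewrite -[LHS]/(run env (upd (upd U2 aST 0 (cell n (U2 aST 0)
    (U2 aPW (U2 aH 0 - (U2 aII 0).+1)) (rw n sup (U2 aF) j))) aH 0
      (U2 aH 0 - (U2 aII 0).+1)) s_restrict).
  by rewrite fF eii !f2.
have f6 a : a \notin [:: aBJ; aF; aII; aST; aH] -> U6 a = U a.
  rewrite !inE !negb_or => /and5P[h1 h2 h3 h4 h5].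
  by rewrite /U6 !upd_neq // f2 // !inE !negb_or h1 h2 h3.
have eI : run env U6 s_restrict aIN = restrict n sup (U1 aF) st' (pw h') (U aIN).
  pose cc i := ~~ ((st' < rw n sup (U1 aF) i) && ~~ (st' + pw h' < dw n sup (U1 aF) i)).
  pose I V := [/\ V aST 0 = st', V aH 0 = h', V aPW = pw & V aF = U1 aF].
  have I6 : I U6 by split=> //; rewrite f6.
  set c := SIf (XNot (XAnd (XLt (sc aST) (xrw 6 (XVar 5)))
    (XNot (XLt (XAdd (sc aST) (xpw (sc aH))) (xdw 6 (XVar 5)))))) (SSet aIN (XVar 5) (XCst 0)).
  have hs V i : i < n -> I V -> I (run (rcons env i) V c) /\
      run (rcons env i) V c aIN = if cc i then upd1 (V aIN) i 0 else V aIN.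
    move=> il [i1 i2 i3 i4]; split; first by split; rewrite run_frame.
    rewrite /cc -i1 -i2 -i3 -i4.
    rewrite -[LHS]/((if ~~ ((V aST 0 < rw n sup (V aF) i) &&
      ~~ (V aST 0 + V aPW (V aH 0) < dw n sup (V aF) i)) then upd V aIN i 0 else V) aIN).
    by case: ifP => // _; rewrite upd_same.
  have [_ ->] := run_for_sim (f := fun g i => if cc i then upd1 g i 0 else g) I6 hs.
  apply/funext => i; rewrite (fill_if cc (fun=> 0)) /restrict f6 // /cc.
  case: (ltnP i n) => il /=; first by case: ((_ < _) && _).
  by rewrite zI //; case: ifP.
split.
- apply: StepDown; try by rewrite run_frame // f6.
  by move=> fuel; rewrite outE hc1 hc2 eI !(run_frame _ _ _ (c := s_restrict)).
- by rewrite run_frame.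
- by rewrite eI => i ni; rewrite /restrict zI //; case: ifP.
Qed.

End Node.

Definition pwr (K i : nat) := if i <= n then K ^ i else 0.

Definition members0 (i : nat) : nat := i < n.

Lemma upd1_id g j v : g j = v -> upd1 g j v = g.
Proof. by move=> <-; apply/funext => i; rewrite /upd1; case: eqP => // ->. Qed.

(** The n rounds correspond to fuel n; a job already finished goes through the remaining rounds
    unchanged. *)
Lemma run_path K k L j U : j < n -> zero (U aF) -> zero (U aIN) ->
  U aG j = 0 -> U aR j = 0 -> U aD j = 0 ->
  let U' := run [:: K; k; L; j] U s_path in
  let o := out n m P le sup (U aPW) k L n (fun=> 0) members0 0 L j in
  [/\ zero (U' aF), zero (U' aIN), U' aG = upd1 (U aG) j o.1.1,
    U' aR = upd1 (U aR) j o.1.2 & U' aD = upd1 (U aD) j o.2].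
Proof.
move=> jn zF zI G0 R0 D0.
set env := [:: K; k; L; j].
set c0 := SFor (SSeq (SSet aF (XVar 4) (XCst 0)) (SSet aIN (XVar 4) (XCst 1))).
pose U1 := run env U c0.
have eF : U1 aF = fun=> 0.
  have hs V i : i < n -> True -> True /\ run (rcons env i) V
      (SSeq (SSet aF (XVar 4) (XCst 0)) (SSet aIN (XVar 4) (XCst 1))) aF = upd1 (V aF) i 0.
    by move=> il _; split=> //; rewrite -[LHS]/(upd V aF i 0 aF) upd_same.
  have [_ e] := run_for_sim (env := env) (U := U) (f := fun g i => upd1 g i 0) I hs.
  apply/funext => i; rewrite /U1 /c0 e (fill (fun=> 0)).
  by case: ltnP => // ni; rewrite zF.
have eI : U1 aIN = members0.
  have hs V i : i < n -> True -> True /\ run (rcons env i) V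
      (SSeq (SSet aF (XVar 4) (XCst 0)) (SSet aIN (XVar 4) (XCst 1))) aIN = upd1 (V aIN) i 1.
    by move=> il _; split.
  have [_ e] := run_for_sim (env := env) (U := U) (f := fun g i => upd1 g i 1) I hs.
  apply/funext => i; rewrite /U1 /c0 e (fill (fun=> 1)) /members0.
  by case: ltnP => // ni; rewrite zI.
pose U2 := upd (upd (upd U1 aST 0 0) aH 0 L) aACT 0 1.
move=> U' o; rewrite {}/U'.
rewrite -[run env U s_path]/(run env U2 (SFor s_step)).
have f1 a : a \notin [:: aF; aIN] -> U1 a = U a by move=> h; rewrite /U1 run_frame.
pose tabs V := V aG = upd1 (U aG) j o.1.1 /\ V aR = upd1 (U aR) j o.1.2 /\
  V aD = upd1 (U aD) j o.2.
pose I it V := [/\ zero (V aF), zero (V aIN), V aPW = U aPW &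
  (V aACT 0 = 0 /\ tabs V) \/
  [/\ 0 < V aACT 0, V aG = U aG, V aR = U aR, V aD = U aD &
   out n m P le sup (U aPW) k L (n - it) (V aF) (V aIN) (V aST 0) (V aH 0) j = o]].
have : I n (run env U2 (SFor s_step)).
  apply: foldl_inv => [|it V itn [zVF zVI ePW h]].
    have eF2 : U2 aF = fun=> 0 by rewrite -eF.
    have eI2 : U2 aIN = members0 by rewrite -eI.
    split; [by rewrite eF2|by rewrite eI2 => i ni; rewrite /members0 ltnNge ni| |].
      by rewrite -[LHS]/(U1 aPW) f1.
    right; rewrite eF2 eI2 subn0; split=> //.
    - by rewrite -[LHS]/(U1 aG) f1.
    - by rewrite -[LHS]/(U1 aR) f1.
    - by rewrite -[LHS]/(U1 aD) f1.
  change (I it.+1 (run (rcons env it) V s_step)).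
  case: h => [ [a0 tV]|[act eG eR eD eo]].
    have -> : run (rcons env it) V s_step = V.
      rewrite -[LHS]/((fun W => if (0 < W aACT 0) && ~~ (W aH 0 == 0)
        then run (rcons env it) W s_node else W)
        (if (0 < V aACT 0) && (V aH 0 == 0) then run (rcons env it) V s_leaf else V)).
      by rewrite a0 /= a0.
    by split=> //; left.
  have [sp zF' zI'] := @run_step K k L j it V zVF zVI act.
  rewrite -[rcons env it]/[:: K; k; L; j; it] in sp zF' zI' *.
  split=> //; first by rewrite run_frame.
  have ne : n - it = (n - it.+1).+1 by lia.
  rewrite ne in eo.
  case: sp => [g r d a1 eG1 eR1 eD1 o1|a1 eG1 eR1 eD1 o1|a1 eG1 eR1 eD1 o1]; rewrite ePW in o1.
  - by left; split=> //; rewrite /tabs eG1 eR1 eD1 eG eR eD -eo o1.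
  - by left; split=> //; rewrite /tabs eG1 eR1 eD1 eG eR eD -eo o1 !upd1_id.
  - by right; split; rewrite ?a1 ?eG1 ?eR1 ?eD1 // -eo o1.
move=> [zF' zI' _ [ [_ [t1 [t2 t3]]]|[_ eG eR eD eo]]]; first by split.
rewrite subnn /= in eo; rewrite -eo /=.
by split=> //; rewrite ?eG ?eR ?eD upd1_id.
Qed.

Lemma run_powers K k L U : K < n -> 1 < K -> (forall i, n < i -> U aPW i = 0) ->
  run [:: K; k; L] U s_powers aPW = pwr K.
Proof.
move=> Kn K1 z; set U1 := upd U aPW 0 1.
rewrite -[LHS]/(run [:: K; k; L] U1 (SFor (SSet aPW (xS vj) (xmul 4 vK (xpw vj)))) aPW).
pose I i (V : nat -> nat -> nat) := forall l, V aPW l = if l <= i then K ^ l else U1 aPW l.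
have : I n (run [:: K; k; L] U1 (SFor (SSet aPW (xS vj) (xmul 4 vK (xpw vj))))).
  apply: foldl_inv => [l|i V il Ii l].
    by rewrite leqn0; case: eqP => // ->.
  rewrite -[LHS]/(upd V aPW i.+1 (mul n K (V aPW i)) aPW l) upd_same /upd1.
  rewrite mulE ?(ltnW Kn) // !Ii leqnn -expnS [l <= i.+1]leq_eqVlt ltnS.
  by case: (eqVneq l i.+1) => [->|].
move=> h; apply/funext => l; rewrite h /pwr; case: leqP => // nl.
by rewrite /U1 upd_same /upd1; case: eqP => [e|_]; [rewrite e in nl|rewrite z].
Qed.

Definition table K k L j : nat * nat * nat :=
  if K == 1 then (1, 0, n - 1) else
  if 1 < K then out n m P le sup (pwr K) k L n (fun=> 0) members0 0 L j else (0, 0, 0).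

Definition tG K k L j := if j < n then (table K k L j).1.1 else 0.
Definition tR K k L j := if j < n then (table K k L j).1.2 else 0.
Definition tD K k L j := if j < n then (table K k L j).2 else 0.

(** What a trial must leave behind for the next one to start as if from empty arrays. *)
Definition clean U := (forall a, a \in [:: aF; aIN; aS; aG; aR; aD] -> zero (U a)) /\
  (forall i, n < i -> U aPW i = 0).

Lemma run_reset K k L U : clean U -> let U' := run [:: K; k; L] U s_reset in
  [/\ U' aG = fun=> 0, U' aR = fun=> 0, U' aD = fun=> 0 & U' aS = fun=> 0].
Proof.
move=> [z _] U'.
have key a : a \in [:: aG; aR; aD; aS] -> U' a = fun=> 0.
  move=> ha; have hs V i : i < n -> True -> True /\ run (rcons [:: K; k; L] i) V
      (SSeq (SSet aG vj (XCst 0)) (SSeq (SSet aR vj (XCst 0))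
       (SSeq (SSet aD vj (XCst 0)) (SSet aS vj (XCst 0))))) a = upd1 (V a) i 0.
    move=> il _; split=> //.
    rewrite -[LHS]/(upd (upd (upd (upd V aG i 0) aR i 0) aD i 0) aS i 0 a).
    by move: ha; rewrite !inE => /or4P[] /eqP->; rewrite /= -?(upd_same V);
      apply/funext => l; rewrite /upd /upd1 /=; case: eqP.
  have [_ e] := run_for_sim (env := [:: K; k; L]) (U := U) (f := fun g i => upd1 g i 0) I hs.
  apply/funext => i; rewrite /U' /s_reset e (fill (fun=> 0)); case: ltnP => // ni.
  by rewrite z //; move: ha; rewrite !inE; lia.
by split; apply: key.
Qed.

Lemma run_tables K k L U : 0 < n -> K < n -> clean U ->
  let U' := run [:: K; k; L] U s_tables in
  [/\ U' aG = tG K k L, U' aR = tR K k L, U' aD = tD K k L, U' aS = fun=> 0 & clean U'].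
Proof.
move=> n0 Kn cU; have [zU zP] := cU.
set U1 := run [:: K; k; L] U s_reset.
have [eG eR eD eS] := run_reset K k L cU.
have f1 a : a \notin [:: aG; aR; aD; aS] -> U1 a = U a by move=> h; rewrite /U1 run_frame.
pose c1 := SFor (SSeq (SSet aG vj (XCst 1)) (SSet aD vj (XSub XJobs (XCst 1)))).
pose c2 := SSeq s_powers (SFor s_path).
have -> : run [:: K; k; L] U s_tables =
    (fun V => if 1 < K then run [:: K; k; L] V c2 else V)
      (if K == 1 then run [:: K; k; L] U1 c1 else U1) by [].
have cl V : V aG = tG K k L -> V aR = tR K k L -> V aD = tD K k L -> V aS = (fun=> 0) ->
    zero (V aF) -> zero (V aIN) -> (forall i, n < i -> V aPW i = 0) -> clean V.
  move=> e1 e2 e3 e4 z1 z2 z3; split=> // a; rewrite !inE.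
  by case/or4P => [/eqP->|/eqP->|/eqP->|/or3P[] /eqP->] //; rewrite ?e1 ?e2 ?e3 ?e4 //
    => i ni; rewrite /tG /tR /tD ltnNge ni.
have zF1 : zero (U1 aF) by rewrite f1 //; apply: zU.
have zI1 : zero (U1 aIN) by rewrite f1 //; apply: zU.
have zP1 i : n < i -> U1 aPW i = 0 by move=> ni; rewrite f1 // zP.
case: (eqVneq K 1) => [K1|K1].
  rewrite {1}K1 /=; set V := run _ _ _.
  have eVG : V aG = tG K k L.
    have hs W i : i < n -> True -> True /\ run (rcons [:: K; k; L] i) W
      (SSeq (SSet aG vj (XCst 1)) (SSet aD vj (XSub XJobs (XCst 1)))) aG = upd1 (W aG) i 1.
      by move=> il _; split.
    have [_ e] := run_for_sim (env := [:: K; k; L]) (U := U1) (f := fun g i => upd1 g i 1) I hs.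
    apply/funext => i; rewrite /V /c1 e (fill (fun=> 1)) /tG /table K1 /=.
    by case: ifP => //; rewrite /U1 eG.
  have eVD : V aD = tD K k L.
    have hs W i : i < n -> True -> True /\ run (rcons [:: K; k; L] i) W
      (SSeq (SSet aG vj (XCst 1)) (SSet aD vj (XSub XJobs (XCst 1)))) aD = upd1 (W aD) i (n - 1).
      by move=> il _; split.
    have [_ e] := run_for_sim (env := [:: K; k; L]) (U := U1) (f := fun g i => upd1 g i (n - 1)) I hs.
    apply/funext => i; rewrite /V /c1 e (fill (fun=> n - 1)) /tD /table K1 /=.
    by case: ifP => //; rewrite /U1 eD.
  have eVR : V aR = tR K k L.
    rewrite /V run_frame // /U1 eR; apply/funext => i; rewrite /tR /table K1 /=.
    by case: ifP.
  have eVS : V aS = fun=> 0 by rewrite /V run_frame.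
  by split=> //; apply: cl => //; rewrite /V run_frame.
case: (ltnP 1 K) => K2; last first.
  have eT j : table K k L j = (0, 0, 0) by rewrite /table (negbTE K1) ltnNge K2.
  have e1 : U1 aG = tG K k L by rewrite /U1 eG; apply/funext => i; rewrite /tG eT; case: ifP.
  have e2 : U1 aR = tR K k L by rewrite /U1 eR; apply/funext => i; rewrite /tR eT; case: ifP.
  have e3 : U1 aD = tD K k L by rewrite /U1 eD; apply/funext => i; rewrite /tD eT; case: ifP.
  by split=> //; apply: cl.
pose U2 := run [:: K; k; L] U1 s_powers.
rewrite -[run _ U1 c2]/(run [:: K; k; L] U2 (SFor s_path)).
have f2 a : a != aPW -> U2 a = U1 a by move=> h; rewrite /U2 run_frame // !inE negb_or h.
have eP : U2 aPW = pwr K by apply: run_powers.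
have tE j : table K k L j = out n m P le sup (pwr K) k L n (fun=> 0) members0 0 L j.
  by rewrite /table (negbTE K1) K2.
set W := run _ _ _.
pose I j (V : nat -> nat -> nat) := [/\ zero (V aF), zero (V aIN), V aPW = pwr K &
  [/\ V aG = (fun i => if i < j then (table K k L i).1.1 else 0),
    V aR = (fun i => if i < j then (table K k L i).1.2 else 0) &
    V aD = (fun i => if i < j then (table K k L i).2 else 0)]].
have [zF zI eW [eWG eWR eWD]] : I n W.
  apply: foldl_inv => [|j V jn [zF zI eV [eVG eVR eVD]]].
    split; [by rewrite f2|by rewrite f2|exact: eP|].
    by split; rewrite f2 // /U1 ?eG ?eR ?eD.
  have [ | | |zF' zI' eG' eR' eD'] := @run_path K k L j V jn zF zI.
  - by rewrite eVG ltnn.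
  - by rewrite eVR ltnn.
  - by rewrite eVD ltnn.
  change (I j.+1 (run [:: K; k; L; j] V s_path)).
  split; [exact: zF'|exact: zI'|by rewrite run_frame|].
  rewrite eG' eR' eD' eV -!tE eVG eVR eVD.
  by split; apply/funext => i; rewrite /upd1 ltnS [i <= j]leq_eqVlt;
    case: (eqVneq i j) => [->|].
have eWS : W aS = fun=> 0 by rewrite /W run_frame // f2 // /U1 eS.
split=> //; apply: cl => // i ni; rewrite eW /pwr leqNgt ni //.
Qed.

Definition sched K k L := insert_all n P
  (greedy n m P (tG K k L) (tR K k L) (tD K k L) (fun=> 0)).

Lemma insert_all_zero S : zero S -> zero (insert_all n P S).
Proof.
move=> zS; apply: (foldl_inv (I := fun _ S => zero S)) => // j g jn zg i ni.
rewrite /insert; case: ifP => _; last exact: zg.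
rewrite /upd1; case: eqP => [e|_]; first by move: ni; rewrite e leqNgt jn.
by rewrite bump_afterE ltnNge ni /= zg.
Qed.

Lemma greedy_zero G T D S : zero S -> zero (greedy n m P G T D S).
Proof.
move=> zS; do 4 (apply: (foldl_inv (I := fun _ S => zero S)) => // ? {zS}S ? zS).
by rewrite /place; case: ifP => // _ i ni; rewrite /upd1; case: eqP => [e|_]; [lia|exact: zS].
Qed.

Definition s_body := SSeq s_tables (SSeq s_greedy (SSeq s_insert s_accept)).

Lemma run_body K k L U : 0 < n -> K < n -> clean U ->
  let U' := run [:: K; k; L] U s_body in clean U' /\
  if (U aDONE 0 == 0) && accepted (sched K k L)
  then U' aDONE 0 = 1 /\ forall j, j < n -> U' aOUT j = sched K k L j
  else U' aDONE = U aDONE /\ U' aOUT = U aOUT.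
Proof.
move=> n0 Kn cU U'.
pose U1 := run [:: K; k; L] U s_tables.
have [eG eR eD eS c1] := run_tables k L n0 Kn cU.
pose U2 := run [:: K; k; L] U1 s_greedy.
have e2 : U2 aS = greedy n m P (tG K k L) (tR K k L) (tD K k L) (fun=> 0).
  by rewrite /U2 run_greedy /U1 eG eR eD eS.
pose U3 := run [:: K; k; L] U2 s_insert.
have e3 : U3 aS = sched K k L by rewrite /U3 run_insert e2.
have f3 a : a \notin [:: aS; aTAU] -> U3 a = U1 a.
  rewrite !inE negb_or => /andP[h1 h2].
  by rewrite /U3 run_frame ?/U2 ?run_frame // !inE ?negb_or ?h1 ?h2.
have c3 : clean U3.
  case: c1 => z1 zp; split=> [a|i ni]; last by rewrite f3 //; exact: zp.
  case: (eqVneq a aS) => [->|aS' ha].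
    rewrite e3 => _; apply: insert_all_zero; exact: greedy_zero.
  by rewrite f3; [exact: z1|move: ha; rewrite !inE; lia].
have eD3 : U3 aDONE = U aDONE by rewrite f3 // /U1 run_frame.
have eO3 : U3 aOUT = U aOUT by rewrite f3 // /U1 run_frame.
have -> : U' = run [:: K; k; L] U3 s_accept by [].
rewrite run_accept eD3 e3.
have [d1 o1] := run_output K k L U3.
case: ifP => h; last by split.
split; last by rewrite d1; split=> // j jn; rewrite o1 // e3.
case: c3 => z3 zp; split=> [a ha|i ni]; last by rewrite run_frame //; exact: zp.
by rewrite run_frame; [exact: z3|move: ha; rewrite !inE; lia].
Qed.

Lemma foldl_hit (A : Type) (W Gd : A -> Prop) (F : A -> nat -> A) N i0 z : i0 < N ->
  (forall z i, i < N -> W z -> W (F z i)) ->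
  (forall z i, i < N -> W z -> Gd z -> Gd (F z i)) ->
  (forall z, W z -> Gd (F z i0)) -> W z -> Gd (foldl F z (iota 0 N)).
Proof.
move=> i0N hW hG h0 Wz.
pose I i z := W z /\ (i0 < i -> Gd z).
suff [_ h] : I N (foldl F z (iota 0 N)) by exact: h.
apply: foldl_inv => // i y iN [Wy Gy]; split; first exact: hW.
rewrite ltnS leq_eqVlt => /orP[/eqP <-|ii]; first exact: h0.
exact: hG (Gy ii).
Qed.

(** The triple found need not be the given one: the first success sets [aDONE], which protects the
    output from then on. *)
Lemma run_main K0 k0 L0 : K0 < n -> k0 < n -> L0 < n -> accepted (sched K0 k0 L0) ->
  exists K k L, [/\ K < n, accepted (sched K k L) &
    forall j, j < n -> run [::] (fun _ _ => 0) s_main aOUT j = sched K k L j].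
Proof.
move=> Kn kn Ln acc; have n0 : 0 < n by lia.
pose good U := U aDONE 0 != 0 /\ exists K k L, [/\ K < n, accepted (sched K k L) &
    forall j, j < n -> U aOUT j = sched K k L j].
pose W U := clean U /\ (U aDONE 0 = 0 \/ good U).
have body K k L U : K < n -> W U -> let U' := run [:: K; k; L] U s_body in
    [/\ W U', good U -> good U' & accepted (sched K k L) -> good U'].
  move=> Kn' [cU hU] U'; have [cU' h] := run_body k L n0 Kn' cU.
  rewrite -/U' in cU' h.
  case: eqP h => [d0|d0] /=; last first.
    move=> [h1 h2]; have gg : good U -> good U'.
      by move=> [g1 [K1 [k1 [L1 [? ? ?]]]]]; split; rewrite ?h1 //; exists K1, k1, L1; rewrite h2.
    have gU : good U by case: hU.
    by split=> //; [split=> //; right|]; move=> *; apply: gg.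
  have ng : ~ good U by move=> [/eqP].
  case: ifP => [ac [h1 h2]|_ [h1 h2]].
    have gU' : good U' by split; [rewrite h1|exists K, k, L].
    by split=> //; split=> //; right.
  by split=> //; split=> //; left; rewrite h1.
suff [_ //] : good (run [::] (fun _ _ => 0) s_main).
have W0 : W (fun _ _ => 0) by split; [split|left].
have w1 K k U : K < n -> W U -> W (run [:: K; k] U (SFor s_body)) /\ (good U -> good (run [:: K; k] U (SFor s_body))).
  move=> Kn' WU.
  pose I (i : nat) V := W V /\ (good U -> good V).
  apply: (foldl_inv (I := I)) => // i V il [WV gV].
  by have [h1 h2 _] := body K k i V Kn' WV; split=> // /gV.
have w2 K U : K < n -> W U -> W (run [:: K] U (SFor (SFor s_body))) /\
    (good U -> good (run [:: K] U (SFor (SFor s_body)))).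
  move=> Kn' WU.
  pose I (i : nat) V := W V /\ (good U -> good V).
  apply: (foldl_inv (I := I)) => // i V il [WV gV].
  by have [h1 h2] := w1 K i V Kn' WV; split=> // /gV.
apply: (foldl_hit (W := W) Kn) => // [z i il Wz|z i il Wz|z Wz].
- exact: (w2 i z il Wz).1.
- exact: (w2 i z il Wz).2.
apply: (foldl_hit (W := W) kn) => // [y i il Wy|y i il Wy|y Wy].
- exact: (w1 K0 i y Kn Wy).1.
- exact: (w1 K0 i y Kn Wy).2.
apply: (foldl_hit (W := W) Ln) => // [x i il Wx|x i il Wx|x Wx].
- by have [] := body K0 k0 i x Kn Wx.
- by have [] := body K0 k0 i x Kn Wx.
- by have [_ _] := body K0 k0 L0 x Kn Wx; apply.
Qed.

End Run.
End Algorithm.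

(** * Sufficiency of the level *)

Section Exponents.
Variable R : realType.
Implicit Types (x y : R).

Lemma ln2_gt0 : 0 < ln 2%:R :> R.
Proof. by rewrite ln_gt0 // ltr1n. Qed.

Lemma log2K y : 0 < y -> 2%:R `^ log2 y = y.
Proof.
move=> y0; rewrite /powR pnatr_eq0 /= /log2 divfK ?lnK // gt_eqF //.
exact: ln2_gt0.
Qed.

Lemma log2_ge a y : (2 ^ a)%:R <= y -> a%:R <= log2 y.
Proof.
move=> h; rewrite /log2 ler_pdivlMr ?ln2_gt0 //.
have p0 : 0 < (2 ^ a)%:R :> R by rewrite ltr0n expn_gt0.
have y0 : 0 < y by exact: lt_le_trans h.
have <- : ln ((2 ^ a)%:R) = a%:R * ln 2%:R :> R by rewrite natrX lnXn // mulr_natl.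
by rewrite ler_ln.
Qed.

(** By Bernoulli, 8 M factors already reach 1 + M eps / m >= 2. *)
Lemma growth (eps : R) (m M N : nat) : (0 < m)%N -> 0 < eps -> m%:R <= eps * M%:R ->
  (2 ^ N)%:R <= (1 + eps / (8 * m)%:R) ^+ (8 * M * N).
Proof.
move=> m0 e0 hM; have m8 : 0 < (8 * m)%:R :> R by rewrite ltr0n; lia.
have q0 : 0 < eps / (8 * m)%:R by rewrite divr_gt0.
have bern i : 1 + i%:R * (eps / (8 * m)%:R) <= (1 + eps / (8 * m)%:R) ^+ i.
  elim: i => [|i IH]; first by rewrite expr0 mul0r addr0.
  rewrite exprS; move: IH q0; set q := eps / _; set X := _ ^+ i => IH q0.
  have : (1 + q) * (1 + i%:R * q) <= (1 + q) * X by rewrite ler_pM2l //; lra.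
  apply: le_trans; rewrite -natr1.
  have : 0 <= i%:R * q * q by rewrite !mulr_ge0 // ltW.
  by rewrite mulrDl !mulrDr; lra.
rewrite exprM natrX; apply: lerXn2r; rewrite ?nnegrE ?exprn_ge0 //; first by lra.
apply: (le_trans _ (bern _)); rewrite mulrA.
suff : 1 <= (8 * M)%:R * eps / (8 * m)%:R by lra.
by rewrite ler_pdivlMr // mul1r !natrM; lra.
Qed.

(* As m <= eps M, this K bounds the total loss and this k makes
   (1 + eps/(8m))^k exceed L + 1. *)
Lemma level_large (n m : nat) (eps : R) : (4 <= n)%N -> (0 < m)%N -> 0 < eps < 1 ->
  let L := up_log 2 n in let M := (Num.truncn (m%:R / eps)).+1 in
  let K := (24 * M * L.+1)%N in let k := (8 * M * up_log 2 L.+1)%N in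
  (n <= level 876 n m eps)%N \/ (L * (m * K ^ (2 * k + 1)) <= level 876 n m eps)%N.
Proof.
move=> n4 m0 /andP[e0 e1] L M K k.
set u := m%:R / eps; set b := log2 n%:R : R; set e := log2 b : R.
have b2 : 2 <= b by apply: (@log2_ge 2 n%:R); rewrite ler_nat.
have e1' : 1 <= e by apply: (@log2_ge 1 b); rewrite expn1.
have m1 : 1 <= m%:R :> R by rewrite ler1n.
have mu : m%:R <= u by rewrite ler_pdivlMr // ler_piMr // ltW.
have u1 : 1 <= u by lra.
have -> : level 876 n m eps = Num.truncn (b `^ (876%:R * (u ^+ 2) * e)).
  by rewrite /level expr_div_n.
have uu : u <= u ^+ 2 by rewrite expr2 ler_peMr //; lra.
have uue : u ^+ 2 <= u ^+ 2 * e by rewrite ler_peMr // exprn_ge0 //; lra.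
have b1 : 1 <= b by lra.
have b0 : 0 <= b by lra.
rewrite !truncn_ge_nat ?powR_ge0 //.
(* If log n <= m / eps, then n = 2^b <= b^b is already within the level, and conditioning is
   unrestricted. *)
have [bu|ub] := lerP b u.
  left; rewrite -[leLHS]log2K; last by rewrite ltr0n (leq_trans _ n4).
  rewrite -/b; apply: (@le_trans _ _ (b `^ b)).
    by apply: ge0_ler_powR; rewrite ?nnegrE //; lra.
  by apply: ler_powR => //; rewrite -mulrA; lra.
right.
have /andP[L1 L2] : (2 ^ L.-1 < n <= 2 ^ L)%N.
  by apply: up_log_bounds => //; exact: leq_trans n4.
have L0 : (0 < L)%N by rewrite lt0n; apply: contraTneq L2 => ->; rewrite -ltnNge (leq_trans _ n4).
have Lb : L%:R <= b + 1.
  have : (L.-1)%:R <= b by apply: log2_ge; rewrite ler_nat ltnW.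
  by rewrite -(prednK L0) -natr1 /=; lra.
have /andP[l1 _] : (2 ^ (up_log 2 L.+1).-1 < L.+1 <= 2 ^ (up_log 2 L.+1))%N.
  by apply: up_log_bounds => //; lia.
set lu := up_log 2 L.+1 in k l1 *.
have lub : lu%:R <= 3%:R * e.
  have : (lu.-1)%:R <= log2 (2%:R * b).
    apply: log2_ge; apply: le_trans (_ : L.+1%:R <= _); first by rewrite ler_nat ltnW.
    by rewrite -natr1; lra.
  have -> : log2 (2%:R * b) = 1 + e.
    rewrite /log2 lnM ?posrE //; last by lra.
    by rewrite mulrDl divff // gt_eqF // ln2_gt0.
  by case: (lu) => [|l]; [rewrite mulr0n; lra|rewrite /= -natr1; lra].
have Mu : M%:R <= 2%:R * u.
  have : (Num.truncn u)%:R <= u by rewrite truncn_le; lra.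
  by rewrite /M -/u -natr1; lra.
have M0 : 0 <= M%:R :> R by [].
clearbody e u; clearbody b.
(* 24 (2 u) (2 b) <= 2^7 b^2 <= b^9, by u < b and b >= 2. *)
have Kb : K%:R <= b `^ 9%:R.
  rewrite powR_mulrn // /K !natrM -[L.+1%:R]natr1.
  have b7 : 2%:R ^+ 7 <= b ^+ 7 by rewrite ler_pXn2r ?nnegrE //; lra.
  have h1 : M%:R * (L%:R + 1) <= (2%:R * u) * (2%:R * b).
    by apply: ler_pM => //; lra.
  have h2 : u * b <= b * b by rewrite ler_wpM2r // ltW.
  have h3 : 2%:R ^+ 7 * (b * b) <= b ^+ 7 * (b * b) by rewrite ler_wpM2r // mulr_ge0.
  have -> : b ^+ 9 = b ^+ 7 * (b * b) by rewrite -expr2 -exprD.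
  apply: le_trans h3; rewrite -natrX; have : (2 ^ 7)%:R = 128%:R :> R by [].
  have bb : 0 <= b * b by rewrite mulr_ge0.
  by move=> ->; rewrite -mulrA; lra.
(* k <= 8 (2 u) (3 e) = 48 u e, and 1 <= u e. *)
have kk : (2 * k + 1)%:R <= 97%:R * u * e.
  rewrite natrD /k !natrM.
  have h1 : M%:R * lu%:R <= (2%:R * u) * (3%:R * e) by apply: ler_pM.
  have h2 : 1 <= u * e by exact: mulr_ege1.
  lra.
have ue : u * e <= u ^+ 2 * e by rewrite ler_wpM2r //; lra.
(* 873 = 9 * 97; the factor L m <= b^3 below completes it to 876. *)
have h1 : (K ^ (2 * k + 1))%:R <= b `^ (873%:R * (u * e)).
  rewrite natrX -powR_mulrn //; apply: (@le_trans _ _ ((b `^ 9%:R) `^ (2 * k + 1)%:R)).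
    by apply: ge0_ler_powR; rewrite ?nnegrE ?powR_ge0.
  by rewrite -powRrM; apply: ler_powR => //; lra.
have h2 : L%:R * m%:R <= b `^ 3%:R.
  rewrite powR_mulrn //; apply: (@le_trans _ _ ((2%:R * b) * b)).
    by apply: ler_pM => //; lra.
  have -> : b ^+ 3 = b * b * b by rewrite !exprS expr0 mulr1 mulrA.
  by rewrite ler_wpM2r // ler_wpM2r.
rewrite mulnA natrM [in X in X * _]natrM.
apply: (@le_trans _ _ (b `^ 3%:R * b `^ (873%:R * (u * e)))); first by apply: ler_pM.
rewrite -powRD; last by rewrite implybE; apply/orP; right; rewrite gt_eqF //; lra.
apply: ler_powR => //; rewrite -mulrA.
have h3 : 1 <= u * e by exact: mulr_ege1.
lra.
Qed.

Lemma level_gt0 (C n m : nat) (eps : R) : (4 <= n)%N -> (0 < level C n m eps)%N.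
Proof.
move=> n4; rewrite /level truncn_gt0.
have b2 : 2 <= log2 n%:R :> R by apply: (@log2_ge 2); rewrite ler_nat.
have e1 : 1 <= log2 (log2 n%:R) :> R by apply: (@log2_ge 1); rewrite expn1.
rewrite -[leLHS](powRr0 (log2 n%:R)); apply: ler_powR; first by apply: (le_trans _ b2); rewrite ler1n.
apply: mulr_ge0; last exact: le_trans ler01 e1.
by apply: mulr_ge0 => //; apply: divr_ge0; rewrite exprn_even_ge0.
Qed.

Lemma parameters_exist (n m T : nat) (eps : R) : (4 <= n)%N -> (0 < m)%N ->
  0 < eps < 1 -> (T < n)%N -> let r := level 876 n m eps in
  exists K k L, [/\ (1 < K < n)%N, (0 < k < n)%N, (0 < L)%N /\ (L.+1 < n)%N,
    (T <= K ^ L)%N & [/\ (n <= r)%N \/ (L * (m * K ^ (2 * k + 1)) <= r)%N,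
      (L <= k)%N \/ (L.+1%:R <= (1 + eps / (8 * m)%:R) ^+ k)%R
      & (12 * m * (L - k))%:R <= eps * K%:R]].
Proof.
move=> n4 m0 e01 Tn r; have /andP[e0 e1] := e01.
have [nr|rn] := leqP n r.
  (* One level is enough when r >= n: T <= n - 1 = K, and L <= k means that nothing is lost. *)
  exists n.-1, 1%N, 1%N; split; try lia.
  by split; [left|left|rewrite subnn muln0 mulr_ge0 // ltW].
set L := up_log 2 n; set M := (Num.truncn (m%:R / eps)).+1.
set K := (24 * M * L.+1)%N; set k := (8 * M * up_log 2 L.+1)%N.
have hr : (L * (m * K ^ (2 * k + 1)) <= r)%N.
  have [h|//] := level_large n4 m0 e01; by move: rn; rewrite ltnNge h.
have /andP[L1 L2] : (2 ^ L.-1 < n <= 2 ^ L)%N by apply: up_log_bounds => //; lia.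
have L0 : (1 < L)%N.
  case: (leqP 2 L) => // h; have : (2 ^ L <= 2 ^ 1)%N by rewrite leq_pexp2l.
  by rewrite expn1; lia.
have /andP[_ l2] : (2 ^ (up_log 2 L.+1).-1 < L.+1 <= 2 ^ (up_log 2 L.+1))%N.
  by apply: up_log_bounds => //; lia.
have lu0 : (0 < up_log 2 L.+1)%N.
  by rewrite lt0n; apply: contraTneq l2 => ->; lia.
have K1 : (1 < K)%N by rewrite /K; lia.
have k0 : (0 < k)%N by rewrite /k !muln_gt0.
(* The parameters must be below n to be met by the loops; r < n provides this. *)
have Kk : (K ^ (2 * k + 1) < n)%N.
  apply: leq_ltn_trans (leq_trans _ hr) rn.
  by rewrite mulnA leq_pmull // muln_gt0 m0; lia.
have pw (x : nat) : (x <= 2 * k + 1)%N -> (K ^ x < n)%N.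
  by move=> h; apply: leq_ltn_trans Kk; rewrite leq_pexp2l //; lia.
have kK : (k < K ^ k)%N by exact: ltn_expl.
have Mm : m%:R <= eps * M%:R.
  rewrite mulrC -ler_pdivrMr //; apply: ltW.
  have q0 : 0 <= m%:R / eps by rewrite divr_ge0 // ltW.
  by have /andP[_] := truncn_itv q0.
exists K, k, L; split.
- by rewrite K1 -[K]expn1 pw //; lia.
- by rewrite k0 (ltn_trans kK) // pw //; lia.
- split; first by lia.
  have : (L.-1 < 2 ^ L.-1)%N by exact: ltn_expl.
  case: (leqP L 3) => h; last first.
    move=> _; suff : (L.+1 <= 2 ^ L.-1)%N by lia.
    have [l ->] : exists l, L = l.+4 by exists (L - 4)%N; lia.
    elim: l => // l IH; rewrite [in X in (_ <= X)%N]/= expnS; rewrite /= in IH; lia.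
  by move: L1; case: (L) L0 h => [|[|[|[|]]]] //=; lia.
- apply: leq_trans (ltnW Tn) (leq_trans L2 _); rewrite leq_exp2r //; lia.
split; [by right| |].
- right; apply: le_trans (growth (up_log 2 L.+1) m0 e0 Mm); by rewrite ler_nat.
have h1 : (12 * m * (L - k))%:R <= 12%:R * (m%:R * L.+1%:R) :> R.
  by rewrite -!natrM ler_nat mulnA leq_mul2l; apply/orP; right; lia.
have h2 : m%:R * L.+1%:R <= eps * M%:R * L.+1%:R by rewrite ler_wpM2r.
have h3 : 0 <= m%:R * L.+1%:R :> R by rewrite mulr_ge0.
apply: le_trans h1 _; rewrite /K !natrM.
have -> : eps * (24%:R * M%:R * L.+1%:R) = 24%:R * (eps * M%:R * L.+1%:R) by ring.
lra.
Qed.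

End Exponents.

(** * In every case some triple is accepted *)

Section Assembly.
Variables (R : realType) (J : finType) (prec : rel J) (m T r : nat) (eps : R).
Variable x : passign J T -> lpvec R J T.
Hypotheses (pirr : irreflexive prec) (ptrans : transitive prec).
Hypotheses (n4 : (4 <= #|J|)%N) (m0 : (0 < m)%N) (eps0 : 0 < eps).
Hypothesis xSA : SA (lpK prec m T) r x.
Notation n := #|J|.
Notation inp := (@Input R J prec m T eps r x).
Notation P := (prec_num inp).

Local Open Scope nat_scope.

Let irr i : ~~ P i i. Proof. exact: prec_num_irr. Qed.
Let tr i j l : P i j -> P j l -> P i l. Proof. exact: prec_num_trans. Qed.

Lemma greedy_feasible G Rl D : pfeasible n m P (greedy n m P G Rl D (fun=> 0)).
Proof. by case: (greedy_invP n m G Rl D irr). Qed.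

Lemma sched_feasible K k L : pfeasible n m P (sched inp K k L) /\
  forall i, i < n -> 0 < sched inp K k L i.
Proof.
have [|h1 h2] := @insert_allP n m P irr m0 tr
  (greedy n m P (tG inp K k L) (tR inp K k L) (tD inp K k L) (fun=> 0))
  (maxof n xpredT (greedy n m P (tG inp K k L) (tR inp K k L) (tD inp K k L) (fun=> 0)))
  (greedy_feasible _ _ _).
  by move=> i il; exact: maxof_le.
by split=> // i il; have /andP[] := h2 i il.
Qed.

Lemma accepted_le K k L N :
  (forall i, i < n -> greedy n m P (tG inp K k L) (tR inp K k L) (tD inp K k L) (fun=> 0) i <= N) ->
  let u := cnt n (fun i => greedy n m P (tG inp K k L) (tR inp K k L) (tD inp K k L) (fun=> 0) i == 0) in
  ((N + u - T)%:R <= eps * T%:R)%R -> accepted inp (sched inp K k L).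
Proof.
move=> hN u hu; rewrite /accepted; apply/negP => /cnt_gt0P[j jn /negP]; apply.
have [h1 h2] := insert_allP irr m0 tr
  (greedy_feasible _ _ _) hN.
apply: le_trans hu; rewrite ler_nat; apply: leq_sub2r.
by have /andP[] := h2 j jn.
Qed.

(** For K = 0 all groups are 0, so greedy places nothing and the insertion uses one slot per job. *)
Lemma accepted_trivial : ((n - T)%:R <= eps * T%:R)%R -> accepted inp (sched inp 0 0 0).
Proof.
move=> h; apply: (@accepted_le 0 0 0 0) => [i il|]; last first.
  apply: le_trans h; rewrite ler_nat leq_sub2r // add0n; exact: cnt_max.
have [_ hw _ _] := greedy_invP n m (tG inp 0 0 0) (tR inp 0 0 0) (tD inp 0 0 0)
  irr.
rewrite leqNgt; apply/negP => /(hw _ il)[]; rewrite /tG /table /=.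
by case: ifP.
Qed.

Hypothesis Tn : T < n.

Lemma jobs_le : n <= m * T.
Proof.
rewrite -[leqLHS](cntT n) -[T in m * T]subn0.
apply: leq_trans (lpx_packing eps Tn (lpx_empty xSA) (leq0n T)).
apply: cnt_le => i il _; have [? ? ?] := lpx_win eps Tn (lpx_empty xSA) il; lia.
Qed.

Lemma accepted_list : (1 <= eps)%R -> 2 * T < n -> accepted inp (sched inp 1 0 0).
Proof.
move=> e1 T2.
have tab j : j < n -> [/\ tG inp 1 0 0 j = 1, tR inp 1 0 0 j = 0 & tD inp 1 0 0 j = n.-1].
  by move=> jn; rewrite /tG /tR /tD jn /= subn1.
have compat : compatible n P (tG inp 1 0 0) (tR inp 1 0 0) (tD inp 1 0 0).
  move=> i j il jn _ _ _; right.
  by have [-> -> ->] := tab i il; have [-> -> ->] := tab j jn.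
have spec := greedyP m irr compat.
have h j : j < n -> 0 < greedy n m P (tG inp 1 0 0) (tR inp 1 0 0) (tD inp 1 0 0) (fun=> 0) j <= 2 * T.
  apply: (list_schedule (r := rw n (suppq inp) (fun=> 0)) _ m0 spec tab) => //; try lia.
  - move=> i il; have [? ? ?] := lpx_win eps Tn (lpx_empty xSA) il; lia.
  - by move=> i l il ll Pil; have [] := lpx_prec (eps := eps) Tn (lpx_empty xSA) il ll Pil.
  - exact: jobs_le.
apply: (@accepted_le 1 0 0 (2 * T)) => [i il|]; first by have /andP[] := h i il.
rewrite cnt_eq0 => [|i il]; last by have := h i il; lia.
have -> : 2 * T + 0 - T = T by lia.
by rewrite ler_peMl.
Qed.

Lemma accepted_main K k L : 1 < K < n -> 0 < k < n -> 0 < L -> L.+1 < n -> T <= K ^ L ->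
  n <= r \/ L * (m * K ^ (2 * k + 1)) <= r ->
  L <= k \/ (L.+1%:R <= (1 + eps / (8 * m)%:R) ^+ k)%R ->
  ((12 * m * (L - k))%:R <= eps * K%:R)%R ->
  accepted inp (sched inp K k L).
Proof.
move=> /andP[K1 Kn] /andP[k0 kn] L0 Ln TK hr hg h12.
have pwE i : i <= n -> pwr inp K i = K ^ i by rewrite /pwr => ->.
pose F := tG inp K k L; pose Rl := tR inp K k L; pose D := tD inp K k L.
have lv := @lpx_empty R J prec m T r x xSA.
have win := @lpx_win R J prec m T r eps x Tn.
have winP := @lpx_prec R J prec m T r eps x Tn.
have pack := @lpx_packing R J prec m T r eps x Tn.
have fix_ := @lpx_fixed R J prec m T r eps x Tn.
have cnd := @lpx_condition R J prec m T r eps x xSA Tn.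
have IN0 j : j < n -> 0 < members0 inp j by rewrite /members0 => ->.
have outE j : j < n -> out n m P (epsle inp) (suppq inp) (pwr inp K) k L n
    (fun=> 0) (members0 inp) 0 L j = (F j, Rl j, D j).
  move=> jn; rewrite /F /Rl /D /tG /tR /tD jn /table K1 gtn_eqF //.
  by case: (out _ _ _ _ _ _ _ _ _ _ _ _ _ _) => [ [? ?] ?].
have compat : compatible n P F Rl D.
  exact: (root_compat irr Tn m0 K1 k0 Ln pwE win winP pack fix_ cnd eps0 hg hr lv TK IN0 outE).
have dl j : j < n -> 0 < F j -> D j <= T.
  exact: (root_deadline irr Tn m0 K1 k0 Ln pwE win winP pack fix_ cnd eps0 hg hr lv TK IN0 outE).
have spec := greedyP m irr compat.
have loss := root_loss irr tr Tn m0 K1 k0 Ln pwE win winP pack fix_ cnd eps0 hg hr spec compat lv TK L0 IN0 outE h12.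
apply: (@accepted_le K k L T) => [i il|]; last by rewrite addnC addnK.
rewrite leqNgt; apply/negP => h.
have [|/(dl _ il) DT /andP[_ SD] ] := gr_win spec il; first exact: leq_ltn_trans h.
by have := leq_trans h (leq_trans SD DT); rewrite ltnn.
Qed.

End Assembly.

Theorem theorem3 :
  exists (C D : nat) (A : cmd),
  forall (R : realType) (J : finType) (prec : rel J) (m T : nat) (eps : R)
    (x : passign J T -> lpvec R J T),
    irreflexive prec -> transitive prec ->
    (4 <= #|J|)%N -> (1 <= m)%N -> 0 < eps ->
    let r := level C #|J| m eps in
    SA (lpK prec m T) r x ->
    exists (k : nat) (s : store R),
      [/\ exec (Input prec m eps r x) A (store0 R) k s,
          (k <= #|J| ^ (D * r))%N,
          feasible prec m (output s)
        & (\max_(j : J) output s j)%N%:R <= (1 + eps) * T%:R].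
Proof.
have [D run_time] := compile_program s_main.
exists 876%N, D, (scomp 0 s_main) => R J prec m T eps x pirr ptrans n4 m0 eps0 r xSA.
pose inp := Input prec m eps r x.
have r0 : (1 <= r)%N by apply: level_gt0.
have [K0 [k0 [L0 [K0n k0n L0n acc0] ] ] ] : exists K k L,
    [/\ (K < #|J|)%N, (k < #|J|)%N, (L < #|J|)%N & accepted inp (sched inp K k L)].
  have [nT|Tn] := leqP #|J| T.
    exists 0%N, 0%N, 0%N; split; [lia|lia|lia|apply: accepted_trivial => //].
    by rewrite (eqP nT); apply: mulr_ge0; rewrite ?(ltW eps0).
  have [e1|e1] := leP 1 eps; last first.
    have e01 : 0 < eps < 1 by rewrite eps0.
    have [K [k [L [/andP[K1 Kn] kn [L0 Ln] TK [hr hg h12] ] ] ] ] :=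
      parameters_exist n4 m0 e01 Tn.
    by exists K, k, L; split; [|lia|lia|apply: accepted_main; rewrite ?K1].
  (* For eps >= 1 a makespan of 2 T is good enough; list scheduling is analysed only for 2 T < n,
     where its common deadline n - 1 is not too early. *)
  have [nT|T2] := leqP #|J| (2 * T).
    exists 0%N, 0%N, 0%N; split; [lia|lia|lia|apply: accepted_trivial => //].
    apply: le_trans (_ : _ <= T%:R) _; first by rewrite ler_nat; lia.
    by rewrite ler_peMl.
  by exists 1%N, 0%N, 0%N; split; [lia|lia|lia|apply: accepted_list].
have [k [s [ex kt out] ] ] := run_time R inp r n4 r0.
have [K [k' [L [_ acc runE] ] ] ] := @run_main R inp K0 k0 L0 K0n k0n L0n acc0.
have [[fS cS] pS] := @sched_feasible R J prec m T r eps x pirr ptrans m0 K k' L.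
have outE (j : J) : output s j = sched inp K k' L (job_num j).
  exact: etrans (out j) (runE _ (job_num_lt j)).
exists k, s; split=> //.
  split=> [j|t|i j ij].
  - by rewrite outE; exact: pS (job_num_lt _).
  - case: (posnP t) => [->|t0].
      rewrite eq_card0 // => j; rewrite inE outE.
      by apply/negbTE; rewrite -lt0n pS ?job_num_lt.
    apply: leq_trans (cS t t0); rewrite cnt_card.
    by apply/subset_leq_card/fintype.subsetP => j; rewrite !inE outE.
  - rewrite !outE; apply: fS; rewrite ?job_num_lt ?prec_numE //; exact: pS (job_num_lt _).
have le_out (j : J) : ((output s j)%:R <= (1 + eps) * T%:R :> R).
  have h : ((sched inp K k' L (job_num j) - T)%:R <= eps * T%:R :> R).
    move: acc => /negP acc; rewrite leNgt; apply/negP => h; apply: acc.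
    apply/cnt_gt0P; exists (job_num j); first exact: job_num_lt.
    by rewrite /epsle -ltNge.
  rewrite outE mulrDl mul1r; apply: le_trans (lerD (lexx T%:R) h).
  by rewrite -natrD ler_nat; lia.
apply: (big_ind (fun k : nat => k%:R <= (1 + eps) * T%:R :> R)) => //.
  by rewrite mulr_ge0 // addr_ge0 ?ltW.
by move=> a b ha hb; rewrite /maxn; case: ifP.
Qed.
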